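(* Let $H$ be a finitely presented group and let $1\to \mathbf{Z}/2\mathbf{Z}\to\widetilde H\to H\to 1$ be an extension of $H$ by $\mathbf{Z}/2\mathbf{Z}$. Assume that $H$ is isomorphic to a semi-direct product $G\rtimes Q$ such that $G$ is finitely generated and $H^2(G,\mathbf{Z}/2\mathbf{Z})$ is infinite. Assume moreover that $G$ has an element of infinite order and that the preimages in $\widetilde H$ of every element of $G$ of order $2$ have order $2$. Then there is a Cayley graph $X$ of $\widetilde H$ that is not LG-rigid among transitive graphs. More precisely, there is a Cayley graph $X$ of $\widetilde H$ such that for every $R\ge 1$ there exists a family $(X_i)_{i\in I}$, with $I$ of the cardinality of the continuum, of large-scale simply connected vertex-transitive graphs that are pairwise non-isometric and such that for every $i\in I$: (i) $X_i$ is $R$-locally $X$ and $4$-bilipschitz equivalent to $X$; (ii) the isometry group of $X_i$ is an extension of a discrete group by $(\mathbf{Z}/2\mathbf{Z})^{\mathbf{N}}$ (that is, it has a normal subgroup isomorphic to $(\mathbf{Z}/2\mathbf{Z})^{\mathbf{N}}$ with discrete quotient).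
   Context: A ''graph'' means a connected, locally finite graph without loops or multiple edges, equipped with the geodesic metric giving each edge length $1$; ''$x\in X$'' means that $x$ is a vertex of $X$; balls are closed balls. The isometry group of a graph is equipped with the topology of pointwise convergence (and $(\mathbf{Z}/2\mathbf{Z})^{\mathbf{N}}$ with the product topology). A covering from a graph $X$ to a graph $Y$ is a graph covering map (a surjective graph morphism which, for every vertex $x$, maps the neighbors of $x$ bijectively onto the neighbors of its image); $Y$ is covered by $X$ if such a map $X\to Y$ exists. Given a finitely generated group $G$ and a finite symmetric generating set $S$, the Cayley graph $(G,S)$ is the graph with vertex set $G$ and distance $d(g,h)=|g^{-1}h|_S$ (word length). Given a graph $X$ and $R>0$, a graph $Y$ is $R$-locally $X$ if for every vertex $y\in Y$ there exists $x\in X$ such that the balls $B_X(x,R)$ and $B_Y(y,R)$, equipped with their intrinsic geodesic metrics, are isometric. $X$ is LG-rigid among transitive graphs if there is $R>0$ such that every vertex-transitive graph which is $R$-locally $X$ is covered by $X$. Two graphs are $4$-bilipschitz equivalent if there is a bijection between their vertex sets such that it and its inverse are $4$-Lipschitz. For a graph $X$ and $k\in\mathbf{N}$, $P_k(X)$ is the 2-dimensional CW-complex whose 1-skeleton is $X$ and whose 2-cells are $m$-gons, $0\le m\le k$, one attached along each simple loop of length $m$ in $X$ (up to cyclic permutations). $X$ is large-scale simply connected if $P_k(X)$ is simply connected for some $k$. $H^2(G,\mathbf{Z}/2\mathbf{Z})$ is the second group cohomology with trivial coefficients; in $G\rtimes Q$ the subgroup $G$ is the normal factor, viewed as a subgroup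 of $H$. *)

(* Defs.v *)
From HB Require Import structures.
From mathcomp Require Import all_boot all_order all_algebra.
From mathcomp Require Import all_classical all_reals all_analysis.

Set Implicit Arguments.
Unset Strict Implicit.
Unset Printing Implicit Defensive.

Import Order.TTheory GRing.Theory Num.Theory.
Import numFieldNormedType.Exports.
Local Open Scope classical_set_scope.
Local Open Scope ring_scope.

Section Generation.
Local Open Scope group_scope.
Variable G : groupType.

Definition symmetric_set (S : seq G) := forall s, s \in S -> s^-1 \in S.

Definition generates (S : seq G) := forall g : G,
  exists2 w : seq G,
    all (fun s => (s \in S) || (s^-1 \in S)) w & \prod_(s <- w) s = g.

Definition finitely_generated := exists S : seq G, generates S.

Definition infinite_order (g : G) := forall n, (0 < n)%N -> g ^+ n <> 1.

Definition order2 (g : G) := g <> 1 /\ g ^+ 2 = 1.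

End Generation.

(* The letter (b, i) stands for the generator x_i if b is false and for its
   inverse if b is true. *)
Definition word n := seq (bool * 'I_n).

Definition eval_letter n (G : groupType) (x : 'I_n -> G) (l : bool * 'I_n) : G :=
  (if l.1 then (x l.2)^-1 else x l.2)%g.

Definition eval_word n (G : groupType) (x : 'I_n -> G) (w : word n) : G :=
  (\prod_(l <- w) eval_letter x l)%g.

(* Equality of words in the presented group < x_0, ..., x_(n-1) | rels >. *)
Inductive presented_eq n (rels : seq (word n)) : word n -> word n -> Prop :=
| presented_refl w : presented_eq rels w w
| presented_sym w1 w2 : presented_eq rels w1 w2 -> presented_eq rels w2 w1
| presented_trans w1 w2 w3 :
    presented_eq rels w1 w2 -> presented_eq rels w2 w3 ->
    presented_eq rels w1 w3
| presented_cancel (u v : word n) b i :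
    presented_eq rels (u ++ (b, i) :: (~~ b, i) :: v) (u ++ v)
| presented_rel (u v r : word n) :
    r \in rels -> presented_eq rels (u ++ r ++ v) (u ++ v).

Definition finitely_presented (G : groupType) :=
  exists n (x : 'I_n -> G) (rels : seq (word n)),
    (forall g, exists w, eval_word x w = g) /\
    (forall w1 w2, eval_word x w1 = eval_word x w2 <-> presented_eq rels w1 w2).

(* Extension 0 -> A -> E -> B -> 1 with abelian kernel A, written additively.
   The group Z/2Z is bool, whose addition in ring_scope is exclusive or, and
   (Z/2Z)^N is nat -> bool with pointwise addition. *)
Definition group_extension (A : zmodType) (E B : groupType)
    (i : A -> E) (p : E -> B) :=
  [/\ {morph i : a b / a + b >-> (a * b)%g},
      injective i,
      {morph p : x y / (x * y)%g},
      (forall b, exists x, p x = b) &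
      range i = p @^-1` [set 1%g]].

Section SemidirectProduct.
Local Open Scope group_scope.

Record group_action (Q G : groupType) := GroupAction {
  gact :> Q -> G -> G;
  gactM : forall q, {morph gact q : x y / x * y};
  gact_1 : forall x, gact 1 x = x;
  gact_comp : forall p q x, gact (p * q) x = gact p (gact q x) }.

Record semidirect (Q G : groupType) (a : group_action Q G) :=
  Semidirect { sd_normal : G; sd_quotient : Q }.

Variables (Q G : groupType) (a : group_action Q G).

HB.instance Definition _ := gen_eqMixin (semidirect a).
HB.instance Definition _ := gen_choiceMixin (semidirect a).

Implicit Types x y z : semidirect a.

Definition sd_one := Semidirect a 1 1.

Definition sd_mul x y := Semidirect a
  (sd_normal x * a (sd_quotient x) (sd_normal y))
  (sd_quotient x * sd_quotient y).

Definition sd_inv x := Semidirect a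
  (a (sd_quotient x)^-1 (sd_normal x)^-1) (sd_quotient x)^-1.

Lemma gact1 q : a q 1 = 1.
Proof. by apply: (@mulgI _ (a q 1)); rewrite -gactM !mulg1. Qed.

Lemma sd_mulA : associative sd_mul.
Proof.
by move=> [g1 q1] [g2 q2] [g3 q3]; rewrite /sd_mul/= gactM gact_comp !mulgA.
Qed.

Lemma sd_mul1 : left_id sd_one sd_mul.
Proof. by move=> [g q]; rewrite /sd_mul/= gact_1 !mul1g. Qed.

Lemma sd_mulr1 : right_id sd_one sd_mul.
Proof. by move=> [g q]; rewrite /sd_mul/= gact1 !mulg1. Qed.

Lemma sd_mulV : left_inverse sd_one sd_inv sd_mul.
Proof. by move=> [g q]; rewrite /sd_mul/sd_inv/= -gactM !mulVg gact1. Qed.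

Lemma sd_mulrV : right_inverse sd_one sd_inv sd_mul.
Proof.
by move=> [g q]; rewrite /sd_mul/sd_inv/= -gact_comp !mulgV gact_1 mulgV.
Qed.

HB.instance Definition _ := isGroup.Build (semidirect a)
  sd_mulA sd_mul1 sd_mulr1 sd_mulV sd_mulrV.

End SemidirectProduct.

Definition group_isomorphism (G1 G2 : groupType) (f : G1 -> G2) :=
  bijective f /\ {morph f : x y / (x * y)%g}.

(* Second cohomology with trivial coefficients, as the set of cosets of the
   2-coboundaries in the 2-cocycles (inhomogeneous cochains). *)
Section SecondCohomology.
Variables (G : groupType) (A : zmodType).

Definition cocycle2 (c : G -> G -> A) := forall x y z,
  c y z - c (x * y)%g z + c x (y * z)%g - c x y = 0.

Definition coboundary2 (c : G -> G -> A) :=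
  exists b : G -> A, forall x y, c x y = b y - b (x * y)%g + b x.

Definition H2 : set (set (G -> G -> A)) :=
  [set [set c' | cocycle2 c' /\ coboundary2 (fun x y => c' x y - c x y)]
    | c in [set c | cocycle2 c]].

End SecondCohomology.
Arguments H2 : clear implicits.

Record graph := Graph {
  vertex :> choiceType;
  adj : rel vertex;
  adj_sym : symmetric adj;
  adj_irrefl : irreflexive adj;
  graph_inhabited : inhabited vertex;
  graph_connected : forall x y, exists2 p, path adj x p & last x p = y;
  graph_locally_finite : forall x, finite_set [set y | adj x y] }.

Section GraphDistance.
Variable X : graph.
Implicit Types x y : X.

Definition has_path x y n :=
  `[< exists p, [/\ path (@adj X) x p, last x p = y & size p = n] >].

Lemma has_path_ex x y : exists n, has_path x y n.
Proof.
have [p xp py] := graph_connected x y.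
by exists (size p); apply/asboolP; exists p.
Qed.

(* The geodesic metric, restricted to the vertices. *)
Definition gdist x y : nat := ex_minn (has_path_ex x y).

End GraphDistance.

Definition isometry (X Y : graph) (f : X -> Y) :=
  bijective f /\ forall x y, gdist (f x) (f y) = gdist x y.

Definition isometric (X Y : graph) := exists f : X -> Y, isometry f.

Definition vertex_transitive (X : graph) :=
  forall x y : X, exists2 f : X -> X, isometry f & f x = y.

Definition lipschitz_map (L : nat) (X Y : graph) (f : X -> Y) :=
  forall x y, (gdist (f x) (f y) <= L * gdist x y)%N.

Definition bilipschitz_equivalent (L : nat) (X Y : graph) :=
  exists (f : X -> Y) (g : Y -> X),
    [/\ cancel f g, cancel g f, lipschitz_map L f & lipschitz_map L g].

Definition covering (X Y : graph) (f : X -> Y) :=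
  (forall y, exists x, f x = y) /\
  forall x, set_bij [set x' | adj x x'] [set y' | adj (f x) y'] f.

Section CayleyGraph.
Local Open Scope group_scope.
Variables (G : groupType) (S : seq G).
Hypotheses (symS : symmetric_set S) (genS : generates S).

Definition cayley_adj : rel G := [rel g h | (g != h) && (g^-1 * h \in S)].

Lemma cayley_adj_sym : symmetric cayley_adj.
Proof.
move=> g h; rewrite /cayley_adj/= eq_sym; congr (_ && _).
by apply/idP/idP => /symS; rewrite invgM invgK.
Qed.

Lemma cayley_adj_irrefl : irreflexive cayley_adj.
Proof. by move=> g; rewrite /cayley_adj/= eqxx. Qed.

Lemma cayley_path g (w : seq G) : all (mem S) w ->
  exists p, [/\ path cayley_adj g p, last g p = g * \prod_(s <- w) s
              & (size p <= size w)%N].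
Proof.
elim: w g => [|s w IHw] g /=; first by exists [::]; rewrite big_nil mulg1.
case/andP=> Ss /(IHw (g * s)) [p [gp pE sp]]; rewrite big_cons mulgA.
have [s1|s1] := eqVneq g (g * s).
  by exists p; rewrite -s1 in gp pE *; rewrite pE; split => //; exact: leqW.
by exists (g * s :: p) => /=; split => //; rewrite /cayley_adj/= s1 mulKg Ss.
Qed.

Lemma symmetric_generates g :
  exists2 w : seq G, all (mem S) w & \prod_(s <- w) s = g.
Proof.
have [w Sw wE] := genS g; exists w => //; apply: sub_all Sw => s.
by case/orP=> // /symS; rewrite invgK.
Qed.

Lemma cayley_connected g h : exists2 p, path cayley_adj g p & last g p = h.
Proof.
have [w Sw wE] := symmetric_generates (g^-1 * h).
by have [p [gp pE _]] := cayley_path g Sw; exists p; rewrite ?pE ?wE ?mulVKg.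
Qed.

Lemma cayley_locally_finite g : finite_set [set h | cayley_adj g h].
Proof.
apply: (@sub_finite_set _ _ [set` [seq g * s | s <- S]]); last exact: finite_seq.
by move=> h /andP[_ Sh]; apply/mapP; exists (g^-1 * h); rewrite ?mulVKg.
Qed.

Definition cayley : graph :=
  Graph cayley_adj_sym cayley_adj_irrefl (inhabits 1)
    cayley_connected cayley_locally_finite.

Definition has_word g n :=
  `[< exists w, [/\ all (mem S) w, \prod_(s <- w) s = g & size w = n] >].

Lemma has_word_ex g : exists n, has_word g n.
Proof.
have [w Sw wE] := symmetric_generates g.
by exists (size w); apply/asboolP; exists w.
Qed.

Definition word_length (g : G) : nat := ex_minn (has_word_ex g).

Lemma cayley_gdist (g h : cayley) :
  gdist g h = word_length ((g : G)^-1 * (h : G)).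
Proof.
rewrite /gdist /word_length; case: ex_minnP => m /asboolP [p [gp pE <-]] minp.
case: ex_minnP => n /asboolP [w [Sw wE <-]] minw; apply/eqP.
rewrite eqn_leq; apply/andP; split.
  have [q [gq qE sq]] := cayley_path g Sw; apply: leq_trans sq.
  by apply: minp; apply/asboolP; exists q; rewrite qE wE mulVKg.
apply: minw; apply/asboolP.
elim: p g gp pE {minp wE} => [|k p IHp] g /=.
  by move=> _ <-; exists [::]; rewrite big_nil mulVg.
case/andP=> /andP[_ Sk] /IHp/[apply] -[v [Sv vE sv]].
exists ((g : G)^-1 * k :: v); split; rewrite /= ?sv ?Sk //.
by rewrite big_cons vE mulgA mulgK.
Qed.

End CayleyGraph.

(* Points of geometric realizations are given by barycentric coordinates:
   functions from a set of extreme points to R. *)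
Section Barycentric.
Variables (R : realType) (I : eqType).

Definition corner (i : I) : I -> R := fun j => (j == i)%:R.

Definition segment_point (p q : I -> R) (t : R) : I -> R :=
  fun j => (1 - t) * p j + t * q j.

Definition edge_point (u v : I) : R -> I -> R :=
  segment_point (corner u) (corner v).

End Barycentric.

Section MetricGraph.
Variables (R : realType) (X : graph).
Implicit Types (A : set (X -> R)) (p q : X -> R) (u v : X).

Definition realization : set (X -> R) :=
  [set p | exists u v t,
    [/\ u = v \/ adj u v, 0 <= t <= 1 & p = edge_point u v t]].

(* piecewise_linear A p q l: there is a path of length l from p to q inside A
   that is a concatenation of finitely many segments, each in one edge. *)
Inductive piecewise_linear A : (X -> R) -> (X -> R) -> R -> Prop :=
| pl_nil p : A p -> piecewise_linear A p p 0
| pl_cons u v (t t' : R) q l :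
    adj u v -> 0 <= t <= 1 -> 0 <= t' <= 1 ->
    (forall a : R, 0 <= a <= 1 -> A (edge_point u v ((1 - a) * t + a * t'))) ->
    piecewise_linear A (edge_point u v t') q l ->
    piecewise_linear A (edge_point u v t) q (`|t - t'| + l).

Definition intrinsic_dist A p q : \bar R :=
  ereal_inf [set l%:E | l in piecewise_linear A p q].

Definition graph_ball (x : X) (r : R) : set (X -> R) :=
  [set p | realization p /\
           (intrinsic_dist realization (corner R x) p <= r%:E)%E].

End MetricGraph.

Definition intrinsically_isometric (R : realType) (X Y : graph)
    (A : set (X -> R)) (B : set (Y -> R)) :=
  exists2 f : (X -> R) -> (Y -> R), set_bij A B f &
    forall p q, A p -> A q -> intrinsic_dist B (f p) (f q) = intrinsic_dist A p q.

Definition locally_like (R : realType) (r : R) (X Y : graph) :=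
  forall y : Y, exists x : X,
    intrinsically_isometric (graph_ball x r) (graph_ball y r).

Definition LG_rigid_transitive (R : realType) (X : graph) :=
  exists2 r : R, 0 < r &
    forall Y : graph, vertex_transitive Y -> locally_like r X Y ->
      exists f : X -> Y, covering f.

Section SimplyConnected.
Variables (R : realType) (T : topologicalType) (A : set T).

Definition path_connected := A !=set0 /\
  forall x y, A x -> A y -> exists g : R -> T,
    [/\ {within `[0, 1], continuous g}, g @` `[0, 1] `<=` A, g 0 = x & g 1 = y].

Definition simply_connected := path_connected /\
  forall g : R -> T,
    {within `[0, 1], continuous g} -> g @` `[0, 1] `<=` A -> g 0 = g 1 ->
    exists h : R * R -> T,
      [/\ {within `[0, 1] `*` `[0, 1], continuous h},
          h @` (`[0, 1] `*` `[0, 1]) `<=` A,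
          (forall t, 0 <= t <= 1 -> h (0, t) = g t),
          (forall t, 0 <= t <= 1 -> h (1, t) = g 0) &
          (forall s, 0 <= s <= 1 -> h (s, 0) = g 0 /\ h (s, 1) = g 0)].

End SimplyConnected.

Section PolygonalComplex.
Variables (R : realType) (X : graph).

(* The sequence of the distinct vertices of an embedded cycle, which has length
   at least 3 as there are no loops or multiple edges. *)
Definition simple_loop (s : seq X) := (2 < size s)%N && ucycleb (@adj X) s.

Definition cyclic_class (s : seq X) : set (seq X) :=
  [set s' | exists n, s' = rot n s].

(* The complex P_k(X). Its extreme points are the vertices of X (inl) and a
   centre for each cyclic class of loops (inr); the polygon attached along a
   loop is the cone over that loop with apex at the centre. As X is locally
   finite, so is P_k(X), and its CW topology is that of pointwise convergence
   of barycentric coordinates. *)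
Definition polygonal_complex (k : nat) : set {ptws (X + set (seq X)) -> R} :=
  [set p | exists u v t,
     [/\ u = v \/ adj u v, 0 <= t <= 1 & p = edge_point (inl u) (inl v) t]]
  `|`
  [set p | exists (s : seq X) u (t c : R),
     [/\ simple_loop s && (size s <= k)%N, u \in s, 0 <= t <= 1, 0 <= c <= 1 &
         p = segment_point (corner R (inr (cyclic_class s)))
               (edge_point (inl u) (inl (next s u)) t) c]].

Definition large_scale_simply_connected :=
  exists k, simply_connected R (polygonal_complex k).

End PolygonalComplex.

Section IsometryGroup.
Variable X : graph.

Record isometry_group := Isometry {
  isom_fun :> X -> X;
  isom_isometry : isometry isom_fun }.

HB.instance Definition _ := gen_eqMixin isometry_group.
HB.instance Definition _ := gen_choiceMixin isometry_group.

Lemma isom_ext (f g : isometry_group) : f =1 g -> f = g.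
Proof.
case: f g => [f fP] [g gP] /= /funext fg; case: _ / fg gP => gP.
by rewrite (Prop_irrelevance fP gP).
Qed.

Lemma isometry_id : isometry (@id X).
Proof. by split; first exact: inv_bij. Qed.

Lemma isometry_comp (f g : isometry_group) : isometry (f \o g).
Proof.
case: f g => [f [fB fD]] [g [gB gD]]; split; first exact: bij_comp.
by move=> x y /=; rewrite fD gD.
Qed.

Lemma isometry_inv_ex (f : isometry_group) :
  exists g : isometry_group, cancel f g /\ cancel g f.
Proof.
case: f => [f [[g fK gK] fD]]; have gP : isometry g.
  by split=> [|x y]; [exists f | rewrite -fD !gK].
by exists (Isometry gP).
Qed.

Definition isom_one := Isometry isometry_id.
Definition isom_mul f g := Isometry (isometry_comp f g).
Definition isom_inv f : isometry_group := projT1 (cid (isometry_inv_ex f)).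

Lemma isom_mulA : associative isom_mul.
Proof. by move=> f g h; exact: isom_ext. Qed.

Lemma isom_mul1 : left_id isom_one isom_mul.
Proof. by move=> f; exact: isom_ext. Qed.

Lemma isom_mulr1 : right_id isom_one isom_mul.
Proof. by move=> f; exact: isom_ext. Qed.

Lemma isom_mulV : left_inverse isom_one isom_inv isom_mul.
Proof.
by move=> f; apply: isom_ext => x; rewrite /isom_inv /=; case: cid => g [].
Qed.

Lemma isom_mulrV : right_inverse isom_one isom_inv isom_mul.
Proof.
by move=> f; apply: isom_ext => x; rewrite /isom_inv /=; case: cid => g [].
Qed.

HB.instance Definition _ := isGroup.Build isometry_group
  isom_mulA isom_mul1 isom_mulr1 isom_mulV isom_mulrV.

(* Pointwise convergence; the metric on the vertex set is discrete. *)
HB.instance Definition _ := Topological.copy isometry_group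
  (initial_topology (fun f : isometry_group =>
     (isom_fun f : {ptws X -> discrete_topology X}))).

End IsometryGroup.

(* The isometry group is, as a topological group, an extension of a discrete
   group D by (Z/2Z)^N with its product topology: i is a topological embedding,
   and the quotient topology on D is discrete. *)
Definition isometry_group_discrete_by_Z2N (X : graph) :=
  exists (D : groupType) (i : (nat -> bool) -> isometry_group X)
         (p : isometry_group X -> D),
    [/\ group_extension i p,
        (forall U : set {ptws nat -> bool},
           open U <-> exists2 W, open W & i @^-1` W = U) &
        (forall U : set D, open (p @^-1` U))].

(* Main.v *)
(* The Cayley graph X of Ht has as generators the central involution z, all the
   lifts of the elements of a finite symmetric set B of H, and a single lift of
   each element of a finite symmetric generating set S of G. These single lifts
   are compatible with inversion because elements of order 2 lift to elements of
   order 2. A 2-cocycle c on G twists X into a graph X_c: the single edge from x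
   to x s is moved to x s z^(c(g, s)), where g is the G-coordinate of x. By the
   cocycle identity, the left translations of H lift to X_c, so X_c is vertex
   transitive. If c vanishes on a large finite set, X_c and X agree on a large
   ball.

   B is chosen so that the number of triangles over an edge determines the short
   elements of H up to inversion. Hence isomorphisms X_c -> X_c' induce maps of H
   preserving a colouring of the edges, which are determined by their values on a
   ball. An isomorphism over the identity of H flips fibres, which makes c and c'
   cohomologous and, if c = c', is constant on the cosets of G. So the isometries
   of X_c over the identity form (Z/2Z)^Q, and Q is infinite as H is finitely
   presented and H^2(G, Z/2Z) is infinite. Each isometry class contains countably
   many of the graphs X_c, while H^2(G, Z/2Z) infinite yields a Cantor set of
   pairwise non-cohomologous c vanishing on a given finite set.

   Loops in X_c are generated by loops of length at most k, where k does not
   depend on c. If c vanishes on a large finite set, a covering X -> X_c is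
   injective on the balls of radius k by counting, hence is an isometry. So X
   covers at most one of the graphs up to isometry. *)

Require Import Defs.
From HB Require Import structures.
From mathcomp Require Import all_boot all_order all_algebra.
From mathcomp Require Import all_classical all_reals all_analysis.
From mathcomp Require Import ring lra.

Set Implicit Arguments.
Unset Strict Implicit.
Unset Printing Implicit Defensive.

Import Order.TTheory GRing.Theory Num.Theory.
Import numFieldNormedType.Exports.
Local Open Scope classical_set_scope.
Local Open Scope card_scope.
Local Open Scope ring_scope.

(** * Separating elements by counting triangles *)

(** The count of triangles over [c] is raised by adjoining to [B] the elements [x], [c^-1 * x] and
    their inverses, where [x] is a high power of an element [t] of infinite order. The product
    [x * (x^-1 * c)] is a new triangle over [c], and the products of two new elements leave any
    given finite set, except for 1, [c], [c^-1] and, if [c] inverts a power of [t], the squares of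
    [c] and [c^-1]. These exceptions dictate the order of the work. The count of 1 grows at every
    step, so 1 comes last. An inverting [c] may disturb [c ^+ 2]; but [c ^+ 2] does not invert, so
    it suffices to treat the inverting elements before the others. Over [B] every lift is an edge,
    so this part of the graph is the same for all cocycles. The relators of [H] are read along such
    edges, which is why one [k] serves all [c]. Simple connectedness concerns the geometric complex.
    A continuous loop is replaced by an edge path through vertices whose open stars cover it, and
    the combinatorial moves of edge paths are realized by straight-line homotopies inside
    simplices. *)

Definition gsimpl (G : groupType) :=
  (@invgM G, @invgK G, @invg1 G, @mulgA G, @mulgK G, @mulgVK G, @mulVg G,
   @mulgV G, @mulg1 G, @mul1g G).

Section Triangles.
Local Open Scope group_scope.
Variable H : groupType.
Implicit Types (B K D : seq H) (c g h t : H).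

(** The common neighbours of 1 and [h] in the Cayley graph of [H] with respect to [B]. *)
Definition triangles B h := count (fun b => b^-1 * h \in B) B.

Lemma uniq_count_leq (T : eqType) (P P' : pred T) (s s' : seq T) (f : T -> T) :
  injective f -> uniq s ->
  (forall x, x \in s -> P x -> f x \in s' /\ P' (f x)) ->
  (count P s <= count P' s')%N.
Proof.
move=> fI us sub; rewrite -!size_filter -(size_map f).
apply: uniq_leq_size; first by rewrite map_inj_uniq ?filter_uniq.
move=> y /mapP[x]; rewrite mem_filter => /andP[Px sx] ->.
by have [s'fx P'fx] := sub _ sx Px; rewrite mem_filter P'fx.
Qed.

Lemma triangles_inv B h : uniq B -> symmetric_set B ->
  triangles B h^-1 = triangles B h.
Proof.
move=> uB symB.
have le k : (triangles B k <= triangles B k^-1)%N.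
  apply: (uniq_count_leq (f := *%g k^-1)) => //; first exact: mulgI.
  move=> b Bb /symB; rewrite invgM invgK => Bkb; split=> //.
  by rewrite invgM invgK mulgK symB.
by apply/eqP; rewrite eqn_leq le -{2}(invgK h) le.
Qed.

Lemma near_avoid (f : nat -> H) K : injective f ->
  \forall n \near \oo, f n \notin K.
Proof.
move=> fI; elim: K => [|k K IHK]; first by near=> n.
have ak : \forall n \near \oo, f n != k.
  have [[n0 fn0]|nf] := pselect (exists n, f n = k); last first.
    by near=> n; apply/eqP => fn; apply: nf; exists n.
  exists n0.+1 => // n /= n0n; apply/eqP; rewrite -fn0 => /fI nn0.
  by rewrite nn0 ltnn in n0n.
by near=> n; rewrite inE negb_or; apply/andP; split; near: n.
Unshelve. all: by end_near. Qed.

Lemma infinite_order_inj t : infinite_order t ->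
  injective (fun n => t ^+ n).
Proof.
move=> tinf; suff le m n : (m <= n)%N -> t ^+ m = t ^+ n -> m = n.
  by move=> m n /= mn; case/orP: (leq_total m n) => [/le|/le/(_ (esym mn))]; auto.
rewrite leq_eqVlt => /orP[/eqP//|mn]; rewrite -(subnKC (ltnW mn)) expgnDr.
rewrite -{1}(mulg1 (t ^+ m)) => /mulgI tmn.
by case: (tinf (n - m)%N) => //; rewrite subn_gt0.
Qed.

Lemma infinite_order_expg t k : infinite_order t -> (0 < k)%N ->
  infinite_order (t ^+ k).
Proof. by move=> tinf k0 n n0; rewrite -expgnA; apply: tinf; rewrite muln_gt0 k0. Qed.

Definition inverts g c := exists2 k, (0 < k)%N & c * g ^+ k * c^-1 = (g ^+ k)^-1.

Lemma conjgX_prod c t k : (c * t * c^-1) ^+ k = c * t ^+ k * c^-1.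
Proof.
elim: k => [|k IHk]; first by rewrite !expg0 mulg1 mulgV.
by rewrite !expgS IHk !mulgA mulgVK.
Qed.

(** Otherwise [c ^+ 2] would both centralize and invert [g ^+ (k * l)], whose square would be 1. *)
Lemma inverts_sqr g c : infinite_order g -> inverts g c -> ~ inverts g (c ^+ 2).
Proof.
move=> ginf [k k0 ck] [l l0 cl].
have c1 : c * g ^+ (k * l) * c^-1 = (g ^+ (k * l))^-1.
  by rewrite expgnA -conjgX_prod ck expVgn.
have c2 : c ^+ 2 * g ^+ (k * l) * (c ^+ 2)^-1 = (g ^+ (k * l))^-1.
  by rewrite mulnC expgnA -conjgX_prod cl expVgn.
have c3 : c ^+ 2 * g ^+ (k * l) * (c ^+ 2)^-1 = g ^+ (k * l).
  rewrite expgS expg1 invgM !mulgA -(mulgA c c) -(mulgA c).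
  have -> : c * g ^+ (k * l) = (g ^+ (k * l))^-1 * c by rewrite -c1 mulgVK.
  rewrite !mulgA -(mulgA _ c c^-1) mulgV mulg1.
  by apply: invg_inj; rewrite !invgM !invgK mulgA c1.
apply: (ginf ((k * l) * 2)%N); first by rewrite !muln_gt0 k0 l0.
by rewrite expgnA expgS expg1 -{1}c3 c2 mulVg.
Qed.

End Triangles.

(** * Four elements creating a triangle over a given one *)

Section Gadget.
Local Open Scope group_scope.
Variable H : groupType.
Implicit Types (B K D : seq H) (c g h t : H).

Lemma invertsX g c k : (0 < k)%N -> inverts (g ^+ k) c -> inverts g c.
Proof.
by move=> k0 [l l0 cl]; exists (k * l)%N; rewrite ?muln_gt0 ?k0// expgnA.
Qed.

Definition commutes_power g c := exists2 k, (0 < k)%N & commute c (g ^+ k).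

Lemma commutesX g c k : (0 < k)%N -> commutes_power (g ^+ k) c -> commutes_power g c.
Proof.
by move=> k0 [l l0 cl]; exists (k * l)%N; rewrite ?muln_gt0 ?k0// expgnA.
Qed.

Lemma inj_shift (f : nat -> H) :
  (forall m d, f m <> f (d.+1 + m)%N) -> injective f.
Proof.
move=> lt m n mn; case: (ltngtP m n) => // ltmn; exfalso.
  by apply: (lt m (n - m.+1)%N); rewrite addSnnS subnK.
by apply: (lt n (m - n.+1)%N); rewrite addSnnS subnK.
Qed.

(** Equal values at two exponents that differ by [d] give [c^-1 = t ^+ d * c^-1 * t ^+ d], which
    says that [c] inverts [t ^+ d]. *)
Lemma inj_twist t c : ~ inverts t c -> injective (fun n => t ^+ n * c^-1 * t ^+ n).
Proof.
move=> tc; apply: inj_shift => m d; rewrite {1}addnC !expgnDr !mulgA => E.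
case: tc; exists d.+1 => //; apply: (mulIg c); rewrite mulgVK.
have {}E : c^-1 = t ^+ d.+1 * c^-1 * t ^+ d.+1.
  by move/mulIg : E; rewrite -!mulgA => /mulgI; rewrite !mulgA.
by rewrite -[in LHS](invgK c) {1}E !gsimpl.
Qed.

Lemma inj_conj t c : ~ commutes_power t c ->
  injective (fun n => (t ^+ n)^-1 * c^-1 * t ^+ n).
Proof.
move=> tc; apply: inj_shift => m d; rewrite !expgnDr !invgM => E.
case: tc; exists d.+1 => //; rewrite /commute; symmetry.
move: E; rewrite -!mulgA => /mulgI; rewrite !mulgA => /mulIg E.
by rewrite -[in LHS](invgK c) {1}E !gsimpl.
Qed.

(** Passing to a power [t] of [g] sharpens the alternatives: [c] inverts no positive power of [t] or
    all of them, and likewise for commuting. Then each word in [c] and [t ^+ n] that occurs in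
    [gadget] is either injective or constant as a function of [n]. *)
Lemma eq_gadget_base g c : infinite_order g -> exists t,
  [/\ infinite_order t, inverts t c -> inverts g c,
      (forall n, inverts t c -> t ^+ n * c^-1 * t ^+ n = c^-1) &
      (forall n, commutes_power t c -> (t ^+ n)^-1 * c^-1 * t ^+ n = c^-1)].
Proof.
move=> ginf.
have [k k0 kP] : exists2 k, (0 < k)%N & inverts g c ->
    c * g ^+ k * c^-1 = (g ^+ k)^-1.
  by have [[k]|?] := pselect (inverts g c); [exists k | exists 1%N].
have [l l0 lP] : exists2 l, (0 < l)%N & commutes_power g c ->
    commute c (g ^+ l).
  by have [[l]|?] := pselect (commutes_power g c); [exists l | exists 1%N].
have kl0 : (0 < k * l)%N by rewrite muln_gt0 k0.
exists (g ^+ (k * l)%N); split.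
- exact: infinite_order_expg.
- exact: invertsX.
- move=> n /invertsX => /(_ kl0) /kP E.
  have {}E : c * g ^+ (k * l)%N ^+ n * c^-1 = (g ^+ (k * l)%N ^+ n)^-1.
    by rewrite -expgnA -mulnA [g ^+ _]expgnA -conjgX_prod E expVgn.
  by rewrite -{2}(invgK (g ^+ (k * l)%N ^+ n)) -E !gsimpl.
- move=> n /commutesX => /(_ kl0) /lP E.
  have {}E : commute c (g ^+ (k * l)%N ^+ n).
    by rewrite -expgnA (mulnC k) -mulnA expgnA; exact: commuteX.
  by rewrite -mulgA -(commuteV (commute_sym E)) mulKg.
Qed.

Lemma gadget K g c : infinite_order g -> symmetric_set K -> 1 \in K ->
  exists D : seq H,
  [/\ uniq D, symmetric_set D, (size D <= 4)%N,
     (forall a b, a \in D -> b \in K -> a * b \notin K) &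
     (forall a b, a \in D -> b \in D -> a * b \in K ->
        [\/ a * b = 1, a * b = c, a * b = c^-1 |
            inverts g c /\ (a * b = c ^+ 2 \/ a * b = c^-1 ^+ 2)])] /\
  exists2 a, a \in D & a^-1 * c \in D.
Proof.
move=> ginf symK K1; have [t [tinf tg tinv tcom]] := eq_gadget_base c ginf.
have tI := infinite_order_inj tinf.
(* If [a * b] and [b] both lie in [K], then [a] lies in [K2]. *)
pose K2 := [seq a * b^-1 | a <- K, b <- K].
have N1 : \forall n \near \oo, t ^+ n \notin K2 by exact: near_avoid.
have N2 : \forall n \near \oo, c^-1 * t ^+ n \notin K2.
  by apply: (near_avoid (f := fun n => c^-1 * t ^+ n)) => m n /mulgI /tI.
have N3 : \forall n \near \oo, t ^+ n * t ^+ n \notin K.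
  apply: (near_avoid (f := fun n => t ^+ n * t ^+ n)) => m n.
  by rewrite -!expgnDr => /tI; rewrite !addnn => /double_inj.
have N4 : \forall n \near \oo, c^-1 * t ^+ n * t ^+ n \notin K.
  apply: (near_avoid (f := fun n => c^-1 * t ^+ n * t ^+ n)) => m n.
  by rewrite -!mulgA => /mulgI; rewrite -!expgnDr => /tI; rewrite !addnn => /double_inj.
have N5 : \forall n \near \oo, t ^+ n * c^-1 * t ^+ n \in K ->
    inverts g c /\ t ^+ n * c^-1 * t ^+ n = c^-1.
  have [tc|tc] := pselect (inverts t c).
    by near=> n => _; split; [exact: tg | exact: tinv].
  near=> n => tK; exfalso; apply/negP: tK; near: n.
  by apply: near_avoid; exact: inj_twist.
have N6 : \forall n \near \oo, (t ^+ n)^-1 * c^-1 * t ^+ n \in K ->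
    (t ^+ n)^-1 * c^-1 * t ^+ n = c^-1.
  have [tc|tc] := pselect (commutes_power t c).
    by near=> n => _; exact: tcom.
  near=> n => tK; exfalso; apply/negP: tK; near: n.
  by apply: near_avoid; exact: inj_conj.
have N7 : \forall n \near \oo, c^-1 * t ^+ n * (c^-1 * t ^+ n) \in K ->
    inverts g c /\ c^-1 * t ^+ n * (c^-1 * t ^+ n) = c^-1 ^+ 2.
  have [tc|tc] := pselect (inverts t c).
    near=> n => _; split; first exact: tg.
    by rewrite -mulgA (mulgA (t ^+ n)) tinv// expg2.
  near=> n => tK; exfalso; apply/negP: tK; near: n.
  apply: (near_avoid (f := fun n => c^-1 * t ^+ n * (c^-1 * t ^+ n))) => m n.
  by rewrite -!mulgA => /mulgI; rewrite !mulgA => /inj_twist; apply.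
have [n [{}N1 {}N2 {}N3 [{}N4 {}N5 {}N6 {}N7]]] : exists n,
    [/\ t ^+ n \notin K2, c^-1 * t ^+ n \notin K2, t ^+ n * t ^+ n \notin K &
    [/\ c^-1 * t ^+ n * t ^+ n \notin K,
       t ^+ n * c^-1 * t ^+ n \in K ->
         inverts g c /\ t ^+ n * c^-1 * t ^+ n = c^-1,
       (t ^+ n)^-1 * c^-1 * t ^+ n \in K ->
         (t ^+ n)^-1 * c^-1 * t ^+ n = c^-1 &
       c^-1 * t ^+ n * (c^-1 * t ^+ n) \in K ->
         inverts g c /\ c^-1 * t ^+ n * (c^-1 * t ^+ n) = c^-1 ^+ 2]].
  by near \oo => n; exists n; split; [near: n..|split; near: n].
move: (t ^+ n) N1 N2 N3 N4 N5 N6 N7 => x N1 N2 N3 N4 N5 N6 N7.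
have KV h : h^-1 \in K -> h \in K by move/symK; rewrite invgK.
have inK2 a b : a \in K -> b \in K -> a * b \in K2.
  by move=> aK bK; apply/allpairsP; exists (a, b^-1); rewrite /= invgK; split => //; exact: symK.
have symK2 h : h^-1 \in K2 -> h \in K2.
  by case/allpairsP => -[a b] /= [aK bK E]; rewrite -(invgK h) E invgM invgK inK2 ?symK.
pose D := undup [:: x; x^-1; c^-1 * x; x^-1 * c].
have memD h : h \in D -> [\/ h = x, h = x^-1, h = c^-1 * x | h = x^-1 * c].
  by rewrite mem_undup !inE => /or4P[] /eqP ->; [constructor 1|constructor 2|constructor 3|constructor 4].
exists D; split; first split.
- exact: undup_uniq.
- move=> h /memD; rewrite mem_undup !inE => -[] ->; by rewrite ?gsimpl eqxx ?orbT.
- exact: leq_trans (size_undup _) _.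
- move=> a b aD bK; apply/negP => abK.
  have: a \in K2 by apply/allpairsP; exists (a * b, b); rewrite /= mulgK; split.
  case/memD: aD => ->; apply/negP => //.
    by apply: contra N1 => ?; apply: symK2.
  by apply: contra N2 => E; apply: symK2; rewrite !gsimpl.
- have cont h : h^-1 \notin K -> h \in K -> False by move=> /negP + /symK.
  move=> a b /memD + /memD; case=> -> [] ->; rewrite ?gsimpl.
  + by move=> E; rewrite E in N3.
  + by constructor 1.
  + by case/N5 => ? ->; constructor 3.
  + by constructor 2.
  + by constructor 1.
  + by move/cont; rewrite !gsimpl => /(_ N3).
  + by move/N6 => ->; constructor 3.
  + by move/cont; rewrite !gsimpl => /(_ N4).
  + by move=> E; rewrite E in N4.
  + by constructor 3.
  + rewrite -!mulgA (mulgA c^-1) => /N7[? ->]; constructor 4; split => //.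
    by right.
  + by constructor 1.
  + move/symK; rewrite !gsimpl => /N6 E; constructor 2.
    by apply: invg_inj; rewrite !gsimpl.
  + move/symK; rewrite !gsimpl => /N5[_ E]; constructor 2.
    by apply: invg_inj; rewrite !gsimpl.
  + by constructor 1.
  + move/symK; rewrite !gsimpl -!mulgA (mulgA c^-1) => /N7[? E].
    constructor 4; split => //; left; apply: invg_inj.
    by rewrite -expVgn -E !gsimpl.
- exists x; first by rewrite mem_undup !inE eqxx.
  by rewrite mem_undup !inE eqxx !orbT.
Unshelve. all: by end_near. Qed.

End Gadget.

(** * Generating sets with well separated triangle counts *)

Section Separation.
Local Open Scope group_scope.
Variables (H : groupType) (g : H).
Hypothesis ginf : infinite_order g.
Implicit Types (B C K D W S l : seq H) (c h : H).

(* Raising the count of c leaves the counts of the watched elements of W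
   unchanged, up to the listed exceptions. *)
Definition may_change c h :=
  [\/ h = 1, h = c, h = c^-1 | inverts g c /\ (h = c ^+ 2 \/ h = c^-1 ^+ 2)].

(** A new triangle over a watched [h] cannot have exactly one side in the gadget [D], because the
    products of [D] with [K] miss [K]. If both sides are in [D], then [h] is one of the exceptions.
    Every triangle over an element of [D] has a side in [D], which leaves at most [4 + 4] of
    them. *)
Lemma triangles_step B W c :
  uniq B -> symmetric_set B -> 1 \notin B -> exists B',
  [/\ uniq B', symmetric_set B', 1 \notin B',
      {subset B <= B'} & forall h, h \in W -> h \in B' -> h \in B] /\
  [/\ forall h, h \in W -> ~ may_change c h -> triangles B' h = triangles B h,
      (triangles B c < triangles B' c)%N &
      forall h, h \in B' -> h \notin B -> (triangles B' h <= 8)%N].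
Proof.
move=> uB symB B1; pose K0 := 1 :: W ++ B; pose K := K0 ++ [seq h^-1 | h <- K0].
have symK : symmetric_set K.
  move=> h; rewrite !mem_cat => /orP[hK|/mapP[k kK ->]].
    by rewrite (map_f (fun h => h^-1)) ?orbT.
  by rewrite invgK kK.
have WK h : h \in W -> h \in K by rewrite !(inE, mem_cat) => ->; rewrite ?orbT.
have BK h : h \in B -> h \in K by rewrite !(inE, mem_cat) => ->; rewrite ?orbT.
have K1 : 1 \in K by rewrite !(inE, mem_cat) eqxx.
have [D [[uD symD sD DK DD] [a aD acD]]] := gadget c ginf symK K1.
have DnK d : d \in D -> d \notin K by move/DK => /(_ _ K1); rewrite mulg1.
have DB d : d \in D -> d \notin B by move/DnK; apply: contra; exact: BK.
have tE h : triangles (B ++ D) h =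
    (count (fun b => (b^-1 * h \in B) || (b^-1 * h \in D))%g B +
     count (fun b => (b^-1 * h \in B) || (b^-1 * h \in D))%g D)%N.
  by rewrite /triangles count_cat; congr (_ + _)%N; apply: eq_count => b;
    rewrite mem_cat.
exists (B ++ D); split; split.
- by rewrite cat_uniq uB uD andbT /=; apply/hasPn => d /DB.
- by move=> h; rewrite !mem_cat => /orP[/symB|/symD] ->; rewrite ?orbT.
- rewrite mem_cat negb_or B1; apply/negP => /DnK; by rewrite K1.
- by move=> h; rewrite mem_cat => ->.
- move=> h /WK hK; rewrite mem_cat => /orP[//|/DnK]; by rewrite hK.
- move=> h /WK hK nch; rewrite tE -[RHS]addn0; congr (_ + _)%N.
    apply: eq_in_count => b Bb; apply/orb_idr => /DK.
    by move/(_ _ (symK _ hK)); rewrite mulgK symK ?BK.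
  apply/eqP; rewrite eqn0Ngt -has_count; apply/hasPn => d Dd.
  rewrite negb_or; apply/andP; split; apply/negP.
    by move/BK; apply/negP; apply: DK hK; exact: symD.
  move=> dhD; have := DD _ _ Dd dhD; rewrite mulVKg => /(_ hK) hc.
  by apply: nch.
- rewrite tE -addn1 leq_add//; first by apply: sub_count => b /= ->.
  by rewrite -has_count; apply/hasP; exists a => //; rewrite acD orbT.
- move=> h; rewrite mem_cat => /orP[->//|hD _]; rewrite tE.
  apply: (@leq_trans (size D + size D)); last exact: (leq_add sD sD).
  rewrite leq_add ?count_size//; rewrite -(count_predT D).
  have fI : injective (fun b => b^-1 * h) by move=> x y /mulIg /invg_inj.
  apply: (uniq_count_leq fI) => // b Bb /orP[bhB|->//].
  have := DK _ _ hD (symK _ (BK _ bhB)); rewrite invgM invgK mulVKg.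
  by rewrite BK.
Qed.

Section Colors.
Variables (C S : seq H) (E : nat).
Hypotheses (uC : uniq C) (symC : symmetric_set C) (C1 : 1 \notin C).
Hypotheses (S1 : 1 \notin S) (SC : forall s, s \in S -> s \notin C).
Hypothesis SCC : forall s c, s \in S -> c \in C -> s <> c ^+ 2.

(** Here 8 bounds the counts of newly added elements and [size C] the initial counts. The squares of
    elements of [C] are watched because raising a count may disturb theirs: as they enter [B] only
    if they are in [C], the bound [V] outside [C] survives. *)
Let V := (8 + size C)%N.
Let W0 := 1 :: S ++ C ++ [seq c ^+ 2 | c <- C].

Definition color_base B :=
  [/\ uniq B, symmetric_set B, 1 \notin B, {subset C <= B} &
      forall h, h \in W0 -> h \in B -> h \in C] /\
  (forall h, h \in S \/ (h \in B /\ h \notin C) -> (triangles B h <= V)%N).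

Lemma color_base0 : color_base C.
Proof.
split; [by split | move=> h _].
by apply: leq_trans (count_size _ _) _; rewrite leq_addl.
Qed.

Lemma may_changeW c h : c \in C \/ c = 1 -> may_change c h ->
  h = 1 \/ h \in C ++ [seq c ^+ 2 | c <- C].
Proof.
move=> cC; case=> [->|->|->|[_ [] ->]].
- by left.
- by rewrite mem_cat; case: cC => ->; [right | left].
- by rewrite mem_cat; case: cC => [/symC ->|->]; [right | left; rewrite invg1].
- rewrite mem_cat; case: cC => [cC|->]; last by left; rewrite expg1n.
  by right; apply/orP; right; apply/mapP; exists c.
- rewrite mem_cat; case: cC => [cC|->]; last by left; rewrite invg1 expg1n.
  by right; apply/orP; right; apply/mapP; exists c^-1 => //; exact: symC.
Qed.

Lemma color_step B c l n : color_base B -> c \in C \/ c = 1 ->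
  {subset l <= C} -> (forall c', c' \in l -> ~ may_change c c') ->
  exists B', [/\ color_base B', (n <= triangles B' c)%N &
    forall c', c' \in l -> triangles B' c' = triangles B c'].
Proof.
move=> BB cC lC lc; elim: n => [|n [B' [[[uB symB B1 CB W0B] VB] nB lB]]].
  by exists B.
have [B'' [[uB' symB' B1' sB WB] [eqB ltB le8]]] :=
  triangles_step (W0 ++ B') c uB symB B1.
have W0l h : h \in C -> h \in W0 ++ B'.
  by rewrite !(inE, mem_cat) => ->; rewrite !orbT.
exists B''; split; last 1 first.
- move=> c' lc'; rewrite -lB// eqB//; first exact/W0l/lC.
  exact: lc.
- split.
    split => //; first by move=> h /CB /sB.
    move=> h hW hB; apply: W0B => //; apply: WB => //; by rewrite mem_cat hW.
  move=> h hB; have [hB'|hB'] := boolP ((h \in S) || (h \in B')); last first.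
    move: hB' hB; rewrite negb_or => /andP[/negbTE -> hB'] [//|[hB'' _]].
    by apply: leq_trans (le8 _ hB'' hB') _; rewrite leq_addr.
  have hnC : h \notin C by case: hB => [/SC|[]].
  rewrite eqB.
  + apply: VB; case/orP: hB' => [->|hB']; first by left.
    by right.
  + rewrite !(inE, mem_cat); case/orP: hB' => ->; by rewrite ?orbT.
  + move/(may_changeW cC) => [h1|].
      by case/orP: hB'; rewrite h1; apply/negP.
    rewrite mem_cat (negbTE hnC) /= => /mapP[k kC hk].
    case/orP: hB' => [hS|hB']; first exact: SCC hS kC hk.
    case/negP: hnC; apply: W0B => //.
    by rewrite !(inE, mem_cat) hk (map_f (fun c => c ^+ 2)) ?orbT.
- exact: leq_ltn_trans nB ltB.
Qed.

(** The counts are raised from the end of the list to its head, so a step must only respect the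
    elements further right. *)
Lemma color_list l : {subset behead l <= C} -> head 1 l \in C \/ head 1 l = 1 ->
  pairwise (fun c c' => `[< ~ may_change c c' >]) l ->
  exists B, [/\ color_base B, forall c, c \in l -> (V + E < triangles B c)%N &
    pairwise (fun c c' => triangles B c' + E < triangles B c)%N l].
Proof.
elim: l => [|c l IHl]; first by move=> _ _ _; exists C; split => //; exact: color_base0.
move=> /= lC cC /andP[/allP cl pl].
have [||//|B [BB VB pB]] := IHl.
- by move=> h hl; apply: lC; exact: mem_behead.
- case: l lC {IHl pl cl} => [|c' l] lC /=; first by right.
  by left; apply: lC; rewrite inE eqxx.
have cl' c' : c' \in l -> ~ may_change c c' by move/cl/asboolP.
(* Exceeds by more than [E] both [V] and all the counts already fixed. *)
pose n := (V + E + \sum_(c' <- l) triangles B c').+1.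
have [B' [BB' nB' eqB']] := color_step n BB cC lC cl'.
exists B'; split => //.
  move=> h; rewrite inE => /orP[/eqP ->|hl]; last by rewrite eqB'// VB.
  by apply: leq_trans nB'; rewrite ltnS leq_addr.
rewrite (_ : pairwise _ l); last first.
  apply: (sub_in_pairwise (P := mem l) _ (allss l) pB) => x y xl yl /=.
  by rewrite !eqB'.
rewrite andbT; apply/allP => c' lc'; apply: leq_trans nB'.
rewrite ltnS eqB'// addnC leq_add ?leq_addl//.
by rewrite (big_rem c') //= leq_addr.
Qed.

Lemma inverts_inv c : inverts g c -> inverts g c^-1.
Proof.
move=> [k k0 ck]; exists k => //; apply: invg_inj.
by rewrite !gsimpl -ck !gsimpl.
Qed.

Lemma inverse_representatives : exists l, [/\ {subset l <= C},
  forall c, c \in C -> c \in l \/ c^-1 \in l &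
  pairwise (fun c c' => (c' != c) && (c' != c^-1)) l].
Proof.
clear uC symC C1 S1 SC SCC V W0; elim: C => [|c s [l [ls sl pl]]].
  by exists [::]; split.
have [cl|] := boolP ((c \in l) || (c^-1 \in l)).
  exists l; split=> //.
    by move=> h /ls; rewrite inE orbC => ->.
  by move=> h; rewrite inE => /orP[/eqP ->|/sl//]; exact/orP.
rewrite negb_or => /andP[cl cVl]; exists (c :: l); split.
- by move=> h; rewrite !inE => /orP[->//|/ls ->]; rewrite orbT.
- move=> h; rewrite !inE => /orP[->|/sl[->|->]]; rewrite ?orbT; by [left|right].
- rewrite /= pl andbT; apply/allP => h hl /=.
  by apply/andP; split; apply: contraTneq hl => ->.
Qed.

Lemma separating_set : exists B,
  [/\ uniq B, symmetric_set B, 1 \notin B, {subset C <= B} &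
      forall s, s \in S -> s \notin B] /\ forall c c', c \in C \/ c = 1 -> [\/ c' \in B, c' \in S | c' = 1] ->
    (triangles B c <= triangles B c' + E)%N ->
    (triangles B c' <= triangles B c + E)%N -> c' = c \/ c' = c^-1.
Proof.
have [r [rC Cr pr]] := inverse_representatives.
(* Read from the right: inverting elements, then the others, then 1. *)
pose l := 1 :: [seq c <- r | ~~ `[< inverts g c >]] ++ [seq c <- r | `[< inverts g c >]].
have lC : {subset behead l <= C}.
  by move=> h /=; rewrite mem_cat !mem_filter => /orP[]/andP[_ /rC].
have [||B [[[uB symB B1 CB W0B] VB] ltB pB]] := color_list lC; first by right.
  have ninv1 : ~ inverts g 1.
    by move=> inv1; apply: (inverts_sqr ginf inv1); rewrite expg1n.
  rewrite /l /=; apply/andP; split.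
    apply/allP => h /= /lC hC; apply/asboolP => -[h1|h1|h1|[/ninv1 []]].
    - by rewrite h1 (negbTE C1) in hC.
    - by rewrite h1 (negbTE C1) in hC.
    - by rewrite h1 invg1 (negbTE C1) in hC.
  have ok c c' : c \in C -> c' \in C -> (c' != c) && (c' != c^-1) ->
      (inverts g c -> inverts g c') -> ~ may_change c c'.
    move=> cC c'C /andP[/eqP cc' /eqP ccV'] ii [h1|//|//|[ci h]].
      by rewrite h1 (negbTE C1) in c'C.
    case: h => h; move: (ii ci); rewrite h; first exact: inverts_sqr.
    by apply: inverts_sqr => //; exact: inverts_inv.
  rewrite pairwise_cat; apply/and3P; split.
  - apply/allrelP => c c'; rewrite !mem_filter.
    move=> /andP[/asboolPn ci cr] /andP[/asboolP c'i c'r]; apply/asboolP.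
    apply: ok; rewrite ?rC//; apply/andP; split; apply/eqP => E1; apply: ci.
      by rewrite -E1.
    by rewrite -(invgK c) -E1; exact: inverts_inv.
  - have {}pr := pairwise_filter (fun c => ~~ `[< inverts g c >]) pr.
    apply: (sub_in_pairwise (P := mem [seq c <- r | ~~ `[< inverts g c >]]) _ (allss _) pr).
    move=> c c' /=; rewrite !mem_filter => /andP[/asboolPn ci cr] /andP[_ c'r] cc'.
    by apply/asboolP; apply: ok; rewrite ?rC.
  - have {}pr := pairwise_filter (fun c => `[< inverts g c >]) pr.
    apply: (sub_in_pairwise (P := mem [seq c <- r | `[< inverts g c >]]) _ (allss _) pr).
    move=> c c' /=; rewrite !mem_filter => /andP[/asboolP ci cr] /andP[/asboolP c'i c'r] cc'.
    by apply/asboolP; apply: ok; rewrite ?rC.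
exists B; split.
  split=> // s sS; apply/negP => sB; apply/negP: (SC sS) => /=.
  by rewrite W0B// !(inE, mem_cat) sS orbT.
have memr c : c \in r -> c \in l.
  by move=> cr; rewrite inE mem_cat !mem_filter cr !andbT orNb orbT.
have repr c : c \in C \/ c = 1 -> exists2 k, k \in l & (k = c \/ k = c^-1).
  move=> [/Cr[cr|cr]|->]; first by exists c; [exact: memr|left].
    by exists c^-1; [exact: memr|right].
  by exists 1; [rewrite inE eqxx | left].
have triV c k : k = c \/ k = c^-1 -> triangles B k = triangles B c.
  by case=> -> //; rewrite triangles_inv.
have gap x y : x \in l -> y \in l -> x <> y ->
   (triangles B x + E < triangles B y)%N \/ (triangles B y + E < triangles B x)%N.
  move=> xl yl xy; rewrite -(nth_index 1 xl) -(nth_index 1 yl).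
  move/(pairwiseP 1): pB => pB.
  case: (ltngtP (index x l) (index y l)) => [lt|lt|eq].
  - by right; apply: pB; rewrite ?inE ?index_mem.
  - by left; apply: pB; rewrite ?inE ?index_mem.
  - by case: xy; rewrite -(nth_index 1 xl) eq nth_index.
move=> c c' cC c'B le1 le2; have [k kl kc] := repr _ cC.
have [c'C|c'C] := pselect (c' \in C \/ c' = 1); last first.
  have: (triangles B c' <= V)%N.
    apply: VB; case: c'B => [c'B|c'S|c'1]; [right|by left|by case: c'C; right].
    by split=> //; apply/negP => ?; apply: c'C; left.
  move=> leV; have := ltB _ kl; rewrite (triV _ _ kc).
  by rewrite ltnNge (leq_trans le1)// leq_add2r.
have [k' kl' kc'] := repr _ c'C.
have kk' : k = k'.
  apply: contrapT => /(gap _ _ kl kl'); rewrite (triV _ _ kc) (triV _ _ kc').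
  by rewrite !ltnNge le1 le2; case.
move: kc kc'; rewrite -kk' => -[] -> [] E'.
- by left.
- by right; rewrite E' invgK.
- by right.
- by left; apply: invg_inj.
Qed.

End Colors.
End Separation.

(** * Colour-preserving maps *)

Section WordBall.
Local Open Scope group_scope.
Variables (H : groupType) (T : seq H).
Implicit Types (h s t v w : H).

Fixpoint word_ball n : seq H :=
  if n is m.+1 then [seq a * b | a <- word_ball m, b <- T] else [:: 1].

Lemma word_ballM m n a b : a \in word_ball m -> b \in word_ball n ->
  a * b \in word_ball (m + n).
Proof.
move=> am; elim: n b => [|n IHn] b; first by rewrite addn0 inE => /eqP ->; rewrite mulg1.
rewrite addnS => /allpairsP[[x y]] /= [xn yT ->].
by apply/allpairsP; exists (a * x, y); rewrite /= mulgA IHn.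
Qed.

Lemma mem_word_ball1 a : (a \in word_ball 1) = (a \in T).
Proof.
apply/allpairsP/idP => [[[x y]] /= []|aT]; first by rewrite inE => /eqP -> ? ->; rewrite mul1g.
by exists (1, a); rewrite /= mul1g inE.
Qed.

Hypothesis symT : symmetric_set T.

Lemma word_ball_sym n : symmetric_set (word_ball n).
Proof.
elim: n => [|n IHn] h /=; first by rewrite !inE => /eqP ->; rewrite invg1.
move=> /allpairsP[[x y]] /= [/IHn xn /symT yT ->].
by rewrite invgM; apply: (@word_ballM 1 n) => //; rewrite mem_word_ball1.
Qed.

Hypothesis T1 : 1 \in T.

Lemma word_ball_mono m n : (m <= n)%N -> {subset word_ball m <= word_ball n}.
Proof.
move=> mn h hm; rewrite -(subnKC mn); elim: (n - m)%N => [|k IHk]; first by rewrite addn0.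
by rewrite addnS; apply/allpairsP; exists (h, 1); rewrite /= mulg1.
Qed.

Lemma word_ball_prod (w : seq H) : all (mem T) w ->
  \prod_(s <- w) s \in word_ball (size w).
Proof.
elim: w => [|s w IHw] /=; first by rewrite big_nil inE.
move=> /andP[sT /IHw]; rewrite big_cons; apply: (@word_ballM 1 (size w)).
by rewrite mem_word_ball1.
Qed.

(** The radius is 2 + 3: [color_rigid] compares points [g * u] and [g * w] with [u] in the ball of
    radius 2 and [w] in the ball of radius 3. *)
Definition color_preserving (psi : H -> H) := forall h s, s \in word_ball 5 ->
  psi (h * s) = psi h * s \/ psi (h * s) = psi h * s^-1.

Hypothesis genT : forall h, exists n, h \in word_ball n.

(* If psi fixes g v for all v in the ball of radius 2 but not g w, where w is in
   the ball of radius 3, then w^-1 = v w^-1 v for all these v. *)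
Lemma color_rigid psi : color_preserving psi ->
  {in word_ball 2, forall v, psi v = v} -> psi =1 id.
Proof.
move=> cp fix2.
have step g : {in word_ball 2, forall v, psi (g * v) = g * v} ->
    {in word_ball 3, forall w, psi (g * w) = g * w}.
  move=> fixg w w3; apply: contrapT => npsi.
  have twist v : v \in word_ball 2 -> w^-1 = v * w^-1 * v.
    move=> v2; have v5 u : u \in word_ball 2 -> u^-1 * w \in word_ball 5.
      by move=> u2; apply: (@word_ballM 2 3) => //; exact: word_ball_sym.
    have psiE u : u \in word_ball 2 -> psi (g * w) = g * (u * w^-1 * u).
      move=> u2; have := cp (g * u) (u^-1 * w) (v5 _ u2).
      by rewrite fixg// !gsimpl; case.
    have := psiE _ v2; rewrite (psiE 1); first by rewrite mulg1 mul1g => /mulgI.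
    by apply: (@word_ball_mono 0) => //; rewrite inE.
  have T2 s : s \in T -> s \in word_ball 2.
    by rewrite -mem_word_ball1; exact: word_ball_mono.
  (* Comparing [twist] at [s], [t] and [s * t] gives [s * t = t * s]. So [s] commutes with [w^-1],
     and [w^-1 = s * w^-1 * s] forces [s * s = 1]. Hence the group is abelian of exponent 2, so
     [w^-1 = w], and preserving colours already fixes [g * w]. *)
  have sqr s : s \in T -> s * s = 1.
    move=> sT; have cT t : t \in T -> commute s t.
      move=> tT; have := twist (s * t); rewrite (@word_ballM 1 1) ?mem_word_ball1// => /(_ isT).
      rewrite {1}(twist s) ?T2// {1}(twist t) ?T2// -!mulgA => /mulgI/mulgI/mulgI E.
      by rewrite /commute -E.
    have cH n h : h \in word_ball n -> commute s h.
      elim: n h => [|n IHn] h /=; first by rewrite inE => /eqP ->; exact: commute1.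
      by move=> /allpairsP[[x y]] /= [/IHn sx /cT sy ->]; exact: commuteM.
    have := twist s (T2 _ sT); rewrite (cH 3) ?word_ball_sym//.
    by rewrite -mulgA -{1}[w^-1]mulg1 => /mulgI.
  have cT s t : s \in T -> t \in T -> commute s t.
    move=> sT tT; rewrite /commute; apply: invg_inj.
    have := twist (s * t); rewrite (@word_ballM 1 1) ?mem_word_ball1// => /(_ isT).
    rewrite {1}(twist s) ?T2// {1}(twist t) ?T2// -!mulgA => /mulgI/mulgI/mulgI E.
    by rewrite E.
  have sqrH n h : h \in word_ball n -> h * h = 1.
    elim: n h => [|n IHn] h /=; first by rewrite inE => /eqP ->; rewrite mulg1.
    move=> /allpairsP[[x y]] /= [xn yT ->].
    have cy k z : z \in word_ball k -> commute y z.
      elim: k z => [|k IHk] z /=; first by rewrite inE => /eqP ->; exact: commute1.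
      by move=> /allpairsP[[a b]] /= [/IHk ya bT ->]; apply: commuteM => //; exact: cT.
    by rewrite mulgA -(mulgA x) (cy _ _ xn) mulgA IHn// mul1g sqr.
  apply: npsi; have := cp g w; rewrite (@word_ball_mono 3)// => /(_ isT).
  have g1 : psi g = g.
    by have := fixg 1; rewrite mulg1; apply; apply: (@word_ball_mono 0); rewrite ?inE.
  have -> : w^-1 = w by apply: (mulgI w); rewrite mulgV (sqrH 3).
  by rewrite g1; case.
have all n h : h \in word_ball n -> {in word_ball 2, forall v, psi (h * v) = h * v}.
  elim: n h => [|n IHn] h /=; first by rewrite inE => /eqP -> v v2; rewrite mul1g fix2.
  move=> /allpairsP[[x y]] /= [/IHn/step fx yT ->] v v2.
  by rewrite -mulgA fx// (@word_ballM 1 2)// mem_word_ball1.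
move=> h; have [n hn] := genT h.
have := all _ _ hn 1; rewrite mulg1; apply.
by apply: (@word_ball_mono 0); rewrite ?inE.
Qed.

Lemma color_determined phi1 phi2 : bijective phi2 ->
  color_preserving phi1 -> color_preserving phi2 ->
  {in word_ball 2, phi1 =1 phi2} -> phi1 =1 phi2.
Proof.
move=> [psi phi2K psiK] c1 c2 e12 h.
rewrite -[LHS]psiK; congr phi2; apply: (color_rigid (psi := psi \o phi1)) h; last first.
  by move=> v v2; rewrite /= e12// phi2K.
(* The inverse map preserves colours as well: [phi2] maps [psi y * s] and [psi y * s^-1] into the
   pair [y * s], [y * s^-1], and it is injective. *)
have cpsi y s : s \in word_ball 5 -> psi (y * s) = psi y * s \/ psi (y * s) = psi y * s^-1.
  move=> s5; have sV5 := word_ball_sym s5.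
  have := c2 (psi y) _ s5; have := c2 (psi y) _ sV5; rewrite psiK invgK.
  move=> [E1|<-]; last by rewrite phi2K; right.
  move=> [<-|E2]; first by rewrite phi2K; left.
  have ss : s = s^-1.
    apply: (mulgI (psi y)); apply: (can_inj phi2K); by rewrite E1.
  by left; rewrite {1}ss -E2 phi2K.
move=> k s s5 /=; case: (c1 k s s5) => ->; first exact: cpsi.
by have := cpsi (phi1 k) _ (word_ball_sym s5); rewrite invgK; case; [right|left].
Qed.

End WordBall.

(** * Two-cocycles with values in Z/2Z *)

Ltac xor_atom a :=
  match a with
  | true => fail 1 | false => fail 1 | addb _ _ => fail 1
  | _ => let h := fresh in generalize a; case
  end.
Ltac xor_cases := repeat match goal with
  | |- context [addb ?a ?b] => first [xor_atom a | xor_atom b]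
  end; try (by move=> /=).

Section BoolCocycles.
Local Open Scope group_scope.
Variable G : groupType.
Implicit Types (c : G -> G -> bool) (b : G -> bool) (x y z s : G) (w : seq G).

Lemma cocycleP c : cocycle2 c <->
  forall x y z, c y z (+) c x (y * z) = c x y (+) c (x * y) z.
Proof.
have conv (a1 a2 a3 a4 : bool) : (a1 - a2 + a3 - a4 = 0 :> bool)%R <-> a1 (+) a3 = a4 (+) a2.
  by case: a1 a2 a3 a4 => -[] [] [].
by split=> cc x y z; apply/conv/cc.
Qed.

Lemma coboundaryP c : coboundary2 c <->
  exists b, forall x y, c x y = b x (+) b y (+) b (x * y).
Proof.
have conv (a1 a2 a3 : bool) : (a1 - a2 + a3 = a3 (+) a1 (+) a2 :> bool)%R.
  by case: a1 a2 a3 => -[] [].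
by split=> -[b bP]; exists b => x y; rewrite bP conv.
Qed.

Lemma cocycle_add c c' : cocycle2 c -> cocycle2 c' ->
  cocycle2 (fun x y => c x y (+) c' x y).
Proof.
move=> /cocycleP cP /cocycleP cP'; apply/cocycleP => x y z.
by rewrite addbACA cP cP' addbACA.
Qed.

Lemma coboundary_cocycle c : coboundary2 c -> cocycle2 c.
Proof.
move=> /coboundaryP[b bP]; apply/cocycleP => x y z.
have E : x * (y * z) = x * y * z by rewrite mulgA.
by rewrite !bP E; xor_cases.
Qed.

Section Normalized.
Variable c : G -> G -> bool.
Hypotheses (cP : cocycle2 c) (c11 : c 1 1 = false).

Lemma cocycle_x1 x : c x 1 = false.
Proof.
move/cocycleP: cP => /(_ x 1 1); rewrite !mulg1 c11.
by case: (c x 1).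
Qed.

Lemma cocycle_1x x : c 1 x = false.
Proof.
move/cocycleP: cP => /(_ 1 1 x); rewrite !mul1g c11.
by case: (c 1 x).
Qed.

(** By the cocycle identity [c x (g * s)] is the sum of [c x g], [c (x * g) s] and [c g s]. Only the
    values along prefixes of [w] are assumed to vanish, so that the lemma applies to cocycles that
    vanish on a finite set. *)
Lemma cocycle_vanish_prod (S : seq G) x w : all (mem S) w ->
  (forall u v s, s \in S -> w = u ++ s :: v ->
     c (x * \prod_(t <- u) t) s = false /\ c (\prod_(t <- u) t) s = false) ->
  c x (\prod_(s <- w) s) = false.
Proof.
elim/last_ind: w => [|w s IHw] /=; first by rewrite big_nil cocycle_x1.
rewrite all_rcons => /andP[/= sS wS] vs.
rewrite -cats1 big_cat big_seq1 /=; move/cocycleP: cP => /(_ x (\prod_(t <- w) t) s).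
rewrite IHw//; last first.
  by move=> u v t tS E; apply: (vs u (rcons v s)) => //; rewrite E rcons_cat.
have [-> ->] : c (x * \prod_(t <- w) t) s = false /\ c (\prod_(t <- w) t) s = false.
  by apply: (vs w [::]) => //; rewrite cats1.
by case: (c x _).
Qed.

End Normalized.

Variable S : seq G.
Hypothesis genS : forall g, exists2 w, all (mem S) w & \prod_(s <- w) s = g.

Lemma cocycle_vanish c : cocycle2 c -> c 1 1 = false ->
  (forall x s, s \in S -> c x s = false) -> forall x y, c x y = false.
Proof.
move=> cP c11 cS x y; have [w wS <-] := genS y.
by apply: (cocycle_vanish_prod cP c11 wS) => u v s sS _; rewrite !cS.
Qed.

(** The sum of [c] along the path with labels [w] from [x] in the Cayley graph of [G]. *)
Fixpoint holonomy c x w := if w is s :: v then c x s (+) holonomy c (x * s) v else false.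

Lemma holonomy_cat c x v w :
  holonomy c x (v ++ w) = holonomy c x v (+) holonomy c (x * \prod_(s <- v) s) w.
Proof.
elim: v x => [|s v IHv] x /=; first by rewrite big_nil mulg1.
by rewrite IHv big_cons mulgA addbA.
Qed.

Fixpoint prefix_products x (w : seq G) :=
  x :: if w is s :: v then prefix_products (x * s) v else [::].

Lemma holonomy_coboundary c b (F : seq G) x w : all (mem S) w ->
  {subset prefix_products x w <= F} ->
  {in F & S, forall y s, c y s = b y (+) b s (+) b (y * s)} ->
  holonomy c x w = b x (+) b (x * \prod_(s <- w) s) (+) \big[addb/false]_(s <- w) b s.
Proof.
elim: w x => [|s w IHw] x /=; first by rewrite !big_nil mulg1 addbb.
move=> /andP[sS wS] wF cb; rewrite IHw//; last first.
  by move=> y yw; apply: wF; rewrite inE yw orbT.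
rewrite cb ?wF ?inE ?eqxx// !big_cons.
have -> : x * (s * \prod_(t <- w) t) = x * s * \prod_(t <- w) t by rewrite mulgA.
by xor_cases.
Qed.

(* Being a coboundary is decided by the holonomies along finitely many pairs of
   words, as there are finitely many cochains on S. *)
Lemma coboundary_closed c : cocycle2 c -> c 1 1 = false -> ~ coboundary2 c ->
  exists F : seq G, forall b,
    ~ {in F & S, forall y s, c y s = b y (+) b s (+) b (y * s)}.
Proof.
move=> cP c11 ncb.
(* [X] is the support of a cochain on [S]. If no two words for the same element disagreed, the
   holonomies would extend this cochain to a function [b] on [G], and [c] would differ from its
   coboundary by a cocycle vanishing on all [x], [s] with [s] in [S]. *)
have obs (X : seq G) : exists ww : seq G * seq G,
    [/\ all (mem S) ww.1, all (mem S) ww.2,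
        \prod_(s <- ww.1) s = \prod_(s <- ww.2) s &
        holonomy c 1 ww.1 (+) \big[addb/false]_(s <- ww.1) (s \in X) <>
        holonomy c 1 ww.2 (+) \big[addb/false]_(s <- ww.2) (s \in X)].
  apply: contrapT => nobs; apply: ncb; apply/coboundaryP.
  pose W g := projT1 (cid2 (genS g)).
  have WS g : all (mem S) (W g) by rewrite /W; case: cid2.
  have WE g : \prod_(s <- W g) s = g by rewrite /W; case: cid2.
  pose b g := holonomy c 1 (W g) (+) \big[addb/false]_(s <- W g) (s \in X).
  have bE w : all (mem S) w -> b (\prod_(s <- w) s) =
      holonomy c 1 w (+) \big[addb/false]_(s <- w) (s \in X).
    move=> wS; apply: contrapT => bw; apply: nobs.
    by exists (W (\prod_(s <- w) s), w); split=> //=; rewrite WE.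
  have b1 : b 1 = false by have := bE [::] isT; rewrite !big_nil.
  exists b => x y; pose d x y := c x y (+) (b x (+) b y (+) b (x * y)).
  suff: d x y = false by rewrite /d; xor_cases.
  apply: (cocycle_vanish (c := d)) => {x y} [||x s sS].
  - apply: cocycle_add => //; apply: coboundary_cocycle; apply/coboundaryP.
    by exists b.
  - by rewrite /d mulg1 c11 b1.
  - have bs : b s = (s \in X).
      have := bE [:: s]; rewrite /= !big_seq1 cocycle_1x//= andbT.
      by apply.
    have bx := bE _ (WS x); rewrite WE in bx.
    have bxs : b (x * s) = b x (+) c x s (+) (s \in X).
      have := bE (rcons (W x) s); rewrite all_rcons /= WS sS => /(_ isT).
      rewrite -cats1 !big_cat !big_seq1 /= WE holonomy_cat /= mul1g WE addbF => ->.
      by rewrite bx -!addbA; congr (_ (+) _); rewrite addbCA.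
    by rewrite /d bs bxs; xor_cases.
have [ww wwP] := choice obs.
(* Every cochain on [S] has its support in this finite list. *)
pose P := [seq mask (val m) S | m <- enum {: (size S).-tuple bool}].
exists (flatten [seq prefix_products 1 (ww X).1 ++ prefix_products 1 (ww X).2 | X <- P]).
move=> b bP; pose X := [seq s <- S | b s].
have bX s : s \in S -> b s = (s \in X) by move=> sS; rewrite mem_filter sS andbT.
have XP : X \in P.
  apply/mapP; exists [tuple of map b (in_tuple S)]; rewrite ?mem_enum//=.
  by rewrite /X filter_mask.
have [w1S w2S ww12] := wwP X; apply.
have bigX w : all (mem S) w -> \big[addb/false]_(s <- w) (s \in X) = \big[addb/false]_(s <- w) b s.
  by move=> /allP wS; apply: eq_big_seq => s /wS /bX ->.
rewrite (holonomy_coboundary w1S _ bP); last first.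
  move=> x xw; apply/flattenP; exists (prefix_products 1 (ww X).1 ++ prefix_products 1 (ww X).2).
    by apply/mapP; exists X.
  by rewrite mem_cat xw.
rewrite (holonomy_coboundary w2S _ bP); last first.
  move=> x xw; apply/flattenP; exists (prefix_products 1 (ww X).1 ++ prefix_products 1 (ww X).2).
    by apply/mapP; exists X.
  by rewrite mem_cat xw orbT.
by rewrite !bigX// ww12 -!addbA !addbb.
Qed.

End BoolCocycles.

(** * A Cantor set of cohomology classes vanishing on a finite set *)

Section CocycleFamily.
Local Open Scope group_scope.
Variable G : groupType.
Implicit Types (c : G -> G -> bool) (b : G -> bool) (x y z s : G) (w : seq G).
Hypothesis H2inf : infinite_set (H2 G bool).

(** Otherwise the class of a cocycle would be determined by its values on the finite set [K],
    leaving only finitely many classes. *)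
Lemma H2_vanishing_exists (K : seq (G * G)) : exists c,
  [/\ cocycle2 c, forall k, k \in K -> c k.1 k.2 = false & ~ coboundary2 c].
Proof.
apply: contrapT => ncb; apply: H2inf.
have {}ncb c : cocycle2 c -> (forall k, k \in K -> c k.1 k.2 = false) -> coboundary2 c.
  by move=> cP cK; apply: contrapT => ?; apply: ncb; exists c.
pose r c : (size K).-tuple bool := [tuple of [seq c k.1 k.2 | k <- in_tuple K]].
pose cls c := [set c' | cocycle2 c' /\ coboundary2 (fun x y => (c' x y - c x y)%R)].
have sub_add c c' : (fun x y => (c' x y - c x y)%R) = (fun x y => c' x y (+) c x y).
  by [].
pose rep v := xget (fun _ _ => false) [set c | cocycle2 c /\ r c = v].
apply: (@sub_finite_set _ _ [set cls (rep v) | v in [set: (size K).-tuple bool]]);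
  last by apply: finite_image; exact: finite_finset.
move=> _ [c cP <-]; exists (r c) => //.
have [repP repr] : cocycle2 (rep (r c)) /\ r (rep (r c)) = r c.
  rewrite /rep; case: xgetP => [c' _ []//|/(_ c)[]]; by split.
have eqK k : k \in K -> rep (r c) k.1 k.2 = c k.1 k.2.
  by move=> kK; move/(congr1 val): repr => /= /eq_in_map; exact.
rewrite -/(cls c) -/(cls (rep (r c))); move: (rep (r c)) repP eqK => d dP eqK {repr}.
have /coboundaryP[b bP] : coboundary2 (fun x y => c x y (+) d x y).
  by apply: ncb; [exact: cocycle_add | move=> k kK; rewrite eqK// addbb].
apply/seteqP; split=> c' [c'P]; rewrite !sub_add => /coboundaryP[b' b'P]; split=> //;
  apply/coboundaryP; exists (fun x => b' x (+) b x) => x y;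
  have := bP x y; have := b'P x y;
  [change (c' x y - c x y)%R with (c' x y (+) c x y)|change (c' x y - d x y)%R with (c' x y (+) d x y)];
  xor_cases.
Qed.

Variable S : seq G.
Hypothesis genS : forall g, exists2 w, all (mem S) w & \prod_(s <- w) s = g.
Hypothesis S1 : 1 \in S.

Lemma mem_ball_prod g : exists n, g \in word_ball S n.
Proof. by have [w wS <-] := genS g; exists (size w); exact: word_ball_prod. Qed.

Lemma vanishing_step (F : seq G) : exists cF : (G -> G -> bool) * seq G,
  [/\ cocycle2 cF.1, cF.1 1 1 = false,
      {in F & S, forall x s, cF.1 x s = false} &
      forall b, ~ {in cF.2 & S, forall y s, cF.1 y s = b y (+) b s (+) b (y * s)}].
Proof.
have [c [cP cK ncb]] := H2_vanishing_exists ((1, 1) :: [seq (x, s) | x <- F, s <- S]).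
have c11 : c 1 1 = false by apply: (cK (1, 1)); rewrite inE eqxx.
have [F' F'P] := coboundary_closed genS cP c11 ncb.
exists (c, F'); split=> // x s xF sS /=.
by apply: (cK (x, s)); rewrite inE; apply/orP; right; apply/allpairsP; exists (x, s).
Qed.

(* Cocycles vanishing on fast growing sets can be summed along any f : nat ->
   bool, and the first term where f and f' differ is detected on a finite set
   where all the later ones vanish. *)
Lemma cocycle_family (F0 : seq G) : exists cc : (nat -> bool) -> G -> G -> bool,
  [/\ forall f, cocycle2 (cc f), forall f, cc f 1 1 = false,
      forall f, {in F0 & S, forall x s, cc f x s = false} &
      forall f f', coboundary2 (fun x y => cc f x y (+) cc f' x y) -> f = f'].
Proof.
have [step stepP] := choice vanishing_step.
(* The word balls make [c n x y] vanish for large [n], so the sums are finite. The last term makes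
   all later cocycles vanish where the current one is detected. *)
pose F := fix F n := if n is m.+1 then F m ++ word_ball S m ++ (step (F m)).2 else F0.
pose c n := (step (F n)).1.
have cP n : cocycle2 (c n) by case: (stepP (F n)).
have c11 n : c n 1 1 = false by case: (stepP (F n)).
have cF n : {in F n & S, forall x s, c n x s = false} by case: (stepP (F n)).
have Fle m n : (m <= n)%N -> {subset F m <= F n}.
  move=> mn x xm; rewrite -(subnKC mn); elim: (n - m)%N => [|k IHk]; first by rewrite addn0.
  by rewrite addnS /= mem_cat IHk.
have ballF m n : (m < n)%N -> {subset word_ball S m <= F n}.
  by move=> mn x xm; apply: (Fle _ _ mn); rewrite /= !mem_cat xm orbT.
have vanish x y : exists N, forall n, (N <= n)%N -> c n x y = false.
  have [k xk] := mem_ball_prod x; have [w wS <-] := genS y.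
  exists (k + size w).+1 => n lt; apply: (cocycle_vanish_prod (cP n) (c11 n) wS) => u v s sS wE.
  have uw : (size u <= size w)%N by rewrite wE size_cat leq_addr.
  have uu : \prod_(t <- u) t \in word_ball S (size u).
    by apply: word_ball_prod; move: wS; rewrite wE all_cat => /andP[].
  split; apply: cF => //; apply: (ballF (k + size w)%N) => //.
    apply: (word_ballM xk); exact: (word_ball_mono S1 uw).
  by apply: (word_ball_mono S1 _ uu); rewrite (leq_trans uw) ?leq_addl.
have [N NP] : exists N : G -> G -> nat, forall x y n, (N x y <= n)%N -> c n x y = false.
  have [N NP] := choice (fun xy : G * G => vanish xy.1 xy.2).
  by exists (fun x y => N (x, y)) => x y; exact: NP (x, y).
pose ps M (f : nat -> bool) x y := \big[addb/false]_(n < M) (f n && c n x y).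
pose cc (f : nat -> bool) x y := ps (N x y) f x y.
have ccE M f x y : (N x y <= M)%N -> cc f x y = ps M f x y.
  move=> NM; rewrite /cc /ps -(subnKC NM) big_split_ord /= [X in _ = _ (+) X]big1 ?addbF//.
  by move=> i _; rewrite NP ?leq_addr ?andbF.
have psD M f x y : ps M.+1 f x y = ps M f x y (+) (f M && c M x y) by rewrite /ps big_ord_recr.
exists cc; split.
- move=> f; apply/cocycleP => x y z.
  pose M := (N y z + N x (y * z)%g + (N x y + N (x * y)%g z))%N.
  have l1 : (N y z <= M)%N by rewrite /M -addnA leq_addr.
  have l2 : (N x (y * z)%g <= M)%N by rewrite /M addnAC leq_addl.
  have l3 : (N x y <= M)%N by rewrite /M addnCA leq_addr.
  have l4 : (N (x * y)%g z <= M)%N by rewrite /M addnA leq_addl.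
  rewrite !(ccE M)//; elim: {l1 l2 l3 l4}M => [|M IHM]; first by rewrite /ps !big_ord0.
  rewrite !psD addbACA IHM [RHS]addbACA; congr (_ (+) _).
  by case: (f M) => //=; exact: (proj1 (cocycleP _) (cP M)).
- by move=> f; rewrite /cc /ps big1 // => i _; rewrite c11 andbF.
- move=> f x s xF sS; rewrite /cc /ps big1 // => i _; rewrite cF ?andbF//.
  exact: (Fle 0%N).
- move=> f f' /coboundaryP[b bP]; apply: contrapT => /eqP ff'.
  have ex : exists n, f n != f' n.
    apply: contrapT => nex; move/eqP: ff'; apply; apply/funext => n.
    by apply/eqP/negPn/negP => fn; apply: nex; exists n.
  case: (ex_minnP ex) => n fn minn.
  have [_ _ _ /(_ b)] := stepP (F n); apply => y s yF sS; rewrite -bP.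
  have yFn : y \in F n.+1 by rewrite /= !mem_cat yF !orbT.
  have {}yFn m : (n < m)%N -> y \in F m by move/Fle; apply.
  pose M := (N y s + n.+1)%N.
  rewrite !(ccE M) ?leq_addr//; have nM : (n < M)%N by rewrite leq_addl.
  have tail k g : (n < k)%N -> ps k g y s = ps n.+1 g y s.
    move=> nk; rewrite -(subnKC nk); elim: (k - n.+1)%N => [|j IHj]; first by rewrite addn0.
    by rewrite addnS psD IHj cF ?andbF ?addbF// yFn// addSn ltnS leq_addr.
  have eqps k : (k <= n)%N -> ps k f y s = ps k f' y s.
    move=> kn; apply: eq_bigr => i _; congr (_ && _); apply/eqP/negPn/negP => /minn.
    by apply/negP; rewrite -ltnNge (leq_trans (ltn_ord i)).
  rewrite !tail// !psD eqps//; rewrite /c.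
  by move: fn; case: (f n) (f' n) => -[] //= _; xor_cases.
Qed.

End CocycleFamily.

(** * Coordinates on a semidirect product and the infinite quotient *)

(* A retract H -> Q with kernel G: every h is uniquely cs (cq h) * cj (cg h). *)
Record coset_coordinates (G Q H : groupType) := CosetCoordinates {
  cj : G -> H;
  cq : H -> Q;
  cg : H -> G;
  cs : Q -> H;
  cjM : {morph cj : x y / (x * y)%g};
  cqM : {morph cq : x y / (x * y)%g};
  cq_j : forall u, cq (cj u) = 1%g;
  cg_j : forall h u, cg (h * cj u)%g = (cg h * u)%g;
  cq_s : forall x, cq (cs x) = x;
  cg_s : forall x, cg (cs x) = 1%g;
  cs1 : cs 1%g = 1%g;
  coordinatesE : forall h, h = (cs (cq h) * cj (cg h))%g }.

Section Coordinates.
Local Open Scope group_scope.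
Variables (G Q H : groupType) (K : coset_coordinates G Q H).
Implicit Types (h k : H) (u v : G).

Lemma morph_one (G1 G2 : groupType) (f : G1 -> G2) :
  {morph f : x y / x * y} -> f 1 = 1.
Proof. by move=> fM; apply: (mulgI (f 1)); rewrite -fM !mulg1. Qed.

Lemma morph_inv (G1 G2 : groupType) (f : G1 -> G2) :
  {morph f : x y / x * y} -> {morph f : x / x^-1}.
Proof. by move=> fM x; apply: (mulgI (f x)); rewrite -fM !mulgV morph_one. Qed.

Lemma cg1 : cg K 1 = 1. Proof. by rewrite -(cs1 K) cg_s. Qed.

Lemma cg_cj u : cg K (cj K u) = u.
Proof. by rewrite -[cj K u]mul1g cg_j cg1 mul1g. Qed.

Lemma cj_inj : injective (cj K). Proof. exact: can_inj cg_cj. Qed.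

Lemma cj1 : cj K 1 = 1. Proof. exact: morph_one (cjM K). Qed.

Lemma cjV u : cj K u^-1 = (cj K u)^-1. Proof. exact: morph_inv (cjM K) u. Qed.

Lemma cq_mulj h u : cq K (h * cj K u) = cq K h.
Proof. by rewrite cqM cq_j mulg1. Qed.

Lemma cgM h k : cg K (h * k) = cg K (h * cs K (cq K k)) * cg K k.
Proof. by rewrite -cg_j -mulgA -coordinatesE. Qed.

Variable c : G -> G -> bool.
Hypotheses (cP : cocycle2 c) (c11 : c 1 1 = false).

(* The fibre coordinate of left translation by h at k: adding it intertwines
   the c-twisted right multiplications by elements of G (translation_cj). *)
Definition translation h k := c (cg K (h * cs K (cq K k))) (cg K k).

Lemma translation_cj h k u : translation h (k * cj K u) =
  translation h k (+) c (cg K (h * k)) u (+) c (cg K k) u.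
Proof.
rewrite /translation cg_j cq_mulj (cgM h k).
move/cocycleP: cP => /(_ (cg K (h * cs K (cq K k))) (cg K k) u).
by move=> <-; rewrite addbAC addbb.
Qed.

Section Words.
Variables (n : nat) (x : 'I_n -> H).

(** The arguments of [c] in the shift caused by one letter. The inverse of a generator undoes the
    shift of that generator, which is therefore taken at the endpoint. Arguments are recorded
    instead of values to obtain finite sets that do not depend on [c]. *)
Definition letter_pair (l : bool * 'I_n) h : G * G :=
  let k := if l.1 then (x l.2)^-1 * h else h in
  (cg K (x l.2 * cs K (cq K k)), cg K k).

Fixpoint word_pairs (w : word n) h : seq (G * G) :=
  if w is l :: v then letter_pair l (eval_word x v * h) :: word_pairs v h else [::].

Definition word_shift w h := \big[addb/false]_(k <- word_pairs w h) c k.1 k.2.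

Lemma letter_pair_cj l h u :
  c (letter_pair l (h * cj K u)).1 (letter_pair l (h * cj K u)).2 =
  c (letter_pair l h).1 (letter_pair l h).2 (+) c (cg K (eval_letter x l * h)) u
    (+) c (cg K h) u.
Proof.
case: l => [[] i]; rewrite /letter_pair /eval_letter /=.
  by rewrite mulgA -!/(translation _ _) translation_cj mulVKg addbAC.
by rewrite -!/(translation _ _) translation_cj.
Qed.

Lemma eval_word_cat (v w : word n) : eval_word x (v ++ w) = eval_word x v * eval_word x w.
Proof. by rewrite /eval_word big_cat. Qed.

Lemma eval_word_cons l (w : word n) : eval_word x (l :: w) = eval_letter x l * eval_word x w.
Proof. by rewrite /eval_word big_cons. Qed.

Lemma word_shift_cons l (w : word n) h : word_shift (l :: w) h =
  c (letter_pair l (eval_word x w * h)).1 (letter_pair l (eval_word x w * h)).2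
  (+) word_shift w h.
Proof. by rewrite /word_shift /= big_cons. Qed.

Lemma word_shift_cj (w : word n) h u : word_shift w (h * cj K u) =
  word_shift w h (+) c (cg K (eval_word x w * h)) u (+) c (cg K h) u.
Proof.
elim: w => [|l w IHw]; first by rewrite /word_shift /eval_word /= !big_nil mul1g addbb.
have E1 : eval_word x w * (h * cj K u) = eval_word x w * h * cj K u by rewrite mulgA.
have E2 : eval_word x (l :: w) * h = eval_letter x l * (eval_word x w * h).
  by rewrite eval_word_cons mulgA.
by rewrite !word_shift_cons IHw E1 E2 letter_pair_cj; xor_cases.
Qed.

Lemma word_shift_cat (v w : word n) h :
  word_shift (v ++ w) h = word_shift w h (+) word_shift v (eval_word x w * h).
Proof.
elim: v => [|l v IHv]; first by rewrite [X in _ (+) X]/word_shift /= big_nil addbF.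
by rewrite cat_cons !word_shift_cons IHv eval_word_cat mulgA addbCA.
Qed.

Lemma word_shift_presented rels (w1 w2 : word n) :
  (forall r, r \in rels -> eval_word x r = 1 /\ forall h, word_shift r h = false) ->
  presented_eq rels w1 w2 ->
  eval_word x w1 = eval_word x w2 /\ word_shift w1 =1 word_shift w2.
Proof.
move=> relP; elim=> {w1 w2} [w|w1 w2 _ [-> IH]|w1 w2 w3 _ [-> IH] _ [-> IH']|u v b i|u v r rr].
- by [].
- by split=> // h; rewrite IH.
- by split=> // h; rewrite IH IH'.
- have E : eval_letter x (b, i) * eval_letter x (~~ b, i) = 1.
    by case: b; rewrite /eval_letter /= ?mulVg ?mulgV.
  split; first by rewrite !eval_word_cat !eval_word_cons (mulgA (eval_letter x (b, i))) E mul1g.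
  move=> h; rewrite !word_shift_cat !word_shift_cons !eval_word_cons.
  rewrite (mulgA (eval_letter x (b, i))) E mul1g; congr (_ (+) _).
  have -> : letter_pair (b, i) (eval_letter x (~~ b, i) * eval_word x v * h) =
            letter_pair (~~ b, i) (eval_word x v * h).
    by case: b {E}; rewrite /letter_pair /eval_letter /= -!mulgA ?mulKg.
  by rewrite addbA addbb.
- have [r1 rs] := relP _ rr; split; first by rewrite !eval_word_cat r1 mul1g.
  by move=> h; rewrite !word_shift_cat eval_word_cat rs r1 mul1g addbF.
Qed.

End Words.
End Coordinates.

Section InfiniteQuotient.
Local Open Scope group_scope.
Variables (G Q H : groupType) (K : coset_coordinates G Q H).

(* A word w in the generators of H moves fibres by word_shift w, which depends on
   its argument through finitely many cosets if Q is finite. If it vanishes for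
   the relators, then the shift of a word representing u is a function of u,
   whose coboundary is c. *)
Lemma finite_quotient_coboundary : finitely_presented H -> finite_set [set: Q] ->
  exists P : seq (G * G), forall c : G -> G -> bool, cocycle2 c -> c 1 1 = false ->
    (forall k, k \in P -> c k.1 k.2 = false) -> coboundary2 c.
Proof.
move=> [n [x [rels [xgen xrel]]]] /finite_seqP[qs qsE].
exists (flatten [seq word_pairs K x r (cs K y) | r <- rels, y <- qs]).
move=> c cP c11 cK; apply/coboundaryP.
have relP r : r \in rels -> eval_word x r = 1 /\ forall h, word_shift K c x r h = false.
  move=> rr; have r1 : eval_word x r = 1.
    have -> : 1 = eval_word x [::] by rewrite /eval_word big_nil.
    by apply/xrel; have := presented_rel [::] [::] rr; rewrite cats0.
  (* A relator fixes [h], so the two correction terms of [word_shift_cj] cancel and only the coset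
     representatives matter. *)
  split=> // h; rewrite (coordinatesE K h) word_shift_cj// r1 mul1g addbK.
  rewrite /word_shift big_seq big1// => k kr; apply: cK.
  apply/flattenP; exists (word_pairs K x r (cs K (cq K h))) => //.
  apply/allpairsP; exists (r, cq K h); split=> //=.
  by have : [set: Q] (cq K h) by []; rewrite qsE.
have [W WE] := choice (fun u => xgen (cj K u)).
exists (fun u => word_shift K c x (W u) 1) => u v.
have Wuv : presented_eq rels (W u ++ W v) (W (u * v)).
  by apply/xrel; rewrite eval_word_cat !WE cjM.
have [_ <-] := word_shift_presented relP Wuv.
rewrite word_shift_cat WE mulg1 -[cj K v]mul1g word_shift_cj// WE mulg1 cg_cj.
rewrite cg1 (cocycle_1x cP c11).
by rewrite addbF -addbA !addKb.
Qed.

Lemma quotient_infinite : finitely_presented H -> infinite_set (H2 G bool) ->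
  infinite_set [set: Q].
Proof.
move=> Hfp H2inf Qfin; have [P PP] := finite_quotient_coboundary Hfp Qfin.
have [c [cP cK]] := H2_vanishing_exists H2inf ((1, 1) :: P); apply; apply: PP => //.
  by apply: (cK (1, 1)); rewrite inE eqxx.
by move=> k kP; apply: cK; rewrite inE kP orbT.
Qed.

End InfiniteQuotient.

(** * Twisted graphs and their isomorphisms *)

Section Extension.
Local Open Scope group_scope.
Variables (Ht H : groupType) (iota : bool -> Ht) (p : Ht -> H).
Hypothesis ext : group_extension iota p.
Implicit Types (x y : Ht).

Lemma extM : {morph p : x y / x * y}. Proof. by case: ext. Qed.
Lemma extV : {morph p : x / x^-1}. Proof. exact: morph_inv extM. Qed.
Lemma ext1 : p 1 = 1. Proof. exact: morph_one extM. Qed.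
Lemma extD a b : iota (a (+) b) = iota a * iota b. Proof. by case: ext => /(_ a b). Qed.
Lemma ext_inj : injective iota. Proof. by case: ext. Qed.

Lemma ext0 : iota false = 1.
Proof. by apply: (mulgI (iota false)); rewrite -extD mulg1. Qed.

Lemma ext_iota a : p (iota a) = 1.
Proof. by case: ext => _ _ _ _ /seteqP[+ _] => /(_ (iota a)); apply; exists a. Qed.

Lemma ext_ker x : p x = 1 -> exists a, x = iota a.
Proof. by case: ext => _ _ _ _ /seteqP[_ /(_ x)] /[apply] -[a _ <-]; exists a. Qed.

Lemma ext_sqr a : iota a * iota a = 1.
Proof. by rewrite -extD addbb ext0. Qed.

(** Conjugation fixes the only nontrivial element of the kernel. *)
Lemma ext_central a x : iota a * x = x * iota a.
Proof.
have [b bE] : exists b, x^-1 * iota a * x = iota b.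
  by apply: ext_ker; rewrite !extM ext_iota mulg1 extV mulVg.
suff ab : b = a by apply: (mulgI x^-1); rewrite mulgA bE ab mulKg.
case: a b bE => -[] //; rewrite ext0.
  move/(congr1 (fun y => x * y * x^-1)); rewrite !gsimpl -ext0.
  by move/ext_inj.
by rewrite mulg1 mulVg -ext0 => /ext_inj.
Qed.

Lemma ext_true : iota true != 1.
Proof. by apply/eqP; rewrite -ext0 => /ext_inj. Qed.

Lemma ext_fiber x y : p x = p y -> exists a, y = x * iota a.
Proof.
move=> pxy; have [|a aE] := @ext_ker (x^-1 * y).
  by rewrite extM extV pxy mulVg.
by exists a; rewrite -aE mulVKg.
Qed.

Lemma ext_p_iota x a : p (x * iota a) = p x.
Proof. by rewrite extM ext_iota mulg1. Qed.

Definition ext_lift h : Ht := projT1 (cid (let: And5 _ _ _ s _ := ext in s h)).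

Lemma ext_liftK h : p (ext_lift h) = h.
Proof. by rewrite /ext_lift; case: cid. Qed.

End Extension.

(* The generators of Ht are the central element fi true, all the lifts of fB, and
   the lifts fs u of the elements u of fS. The finite set fT generates H, and by
   f_sep the elements of its ball of radius 5 are recognized, up to inversion and
   among the generators, by their numbers of triangles; the tolerance absorbs
   the triangles with a side over fS or 1. *)
Record frame (G Q H Ht : groupType) := Frame {
  fK : coset_coordinates G Q H;
  fi : bool -> Ht;
  fp : Ht -> H;
  f_ext : group_extension fi fp;
  fS : seq G;
  fS_uniq : uniq fS;
  fS_sym : symmetric_set fS;
  fS1 : 1%g \notin fS;
  fS_gen : forall g, exists2 w, all (mem fS) w & (\prod_(s <- w) s)%g = g;
  fs : G -> Ht;
  fs_p : forall u, fp (fs u) = cj fK u;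
  fsV : {morph fs : u / (u^-1)%g};
  fT : seq H;
  fT1 : 1%g \in fT;
  fT_sym : symmetric_set fT;
  fT_gen : forall h, exists n, h \in word_ball fT n;
  fB : seq H;
  fB_uniq : uniq fB;
  fB_sym : symmetric_set fB;
  fB1 : 1%g \notin fB;
  fTB : forall t, t \in word_ball fT 5 -> t <> 1%g -> t \in fB;
  fSB : forall u, u \in fS -> cj fK u \notin fB;
  f_sep : forall t b, t \in word_ball fT 5 ->
    [\/ b \in fB, b \in map (cj fK) fS | b = 1%g] ->
    (triangles fB t <= triangles fB b + (size fS).+1)%N ->
    (triangles fB b <= triangles fB t + (size fS).+1)%N ->
    b = t \/ b = (t^-1)%g }.

Section Twist.
Local Open Scope group_scope.
Variables (G Q H Ht : groupType) (F : frame G Q H Ht).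
Local Notation K := (fK F).
Local Notation S := (fS F).
Local Notation B := (fB F).
Local Notation iota := (fi F).
Local Notation p := (fp F).
Local Notation s := (fs F).
Local Notation ext := (f_ext F).
Local Notation z := (iota true).
Local Notation lift := (ext_lift ext).
Implicit Types (x y w : Ht) (h k : H) (u v : G) (c : G -> G -> bool) (a e : bool).

Definition double_lifts := [seq lift b * iota a | b <- B, a <- [:: false; true]].

(* The fibres of p are edges, the edges over B come in all possible lifts, and
   those over S in one lift only, which is twisted by the cocycle c. *)
Definition neighbors c x : seq Ht :=
  [seq x * b | b <- z :: double_lifts] ++
  [seq x * s u * iota (c (cg K (p x)) u) | u <- S].

Definition twist_adj c : rel Ht := [rel x y | y \in neighbors c x].

Lemma mem_double_lifts x : (x \in double_lifts) = (p x \in B).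
Proof.
apply/allpairsP/idP => [[[b a]] /= [bB _ ->]|xB].
  by rewrite (ext_p_iota ext) ext_liftK.
have [a xE] := ext_fiber ext (ext_liftK ext (p x)).
by exists (p x, a); split=> //; case: a {xE}.
Qed.

Lemma twist_adjP c x y : reflect
  [\/ y = x * z, p (x^-1 * y) \in B |
      exists2 u, u \in S & y = x * s u * iota (c (cg K (p x)) u)]
  (twist_adj c x y).
Proof.
rewrite /twist_adj /= mem_cat; apply: (iffP orP) => [[/mapP[b]|/mapP[u uS ->]]|[->|xyB|[u uS ->]]].
- rewrite inE => /orP[/eqP ->|bB] ->; first by constructor 1.
  by constructor 2; rewrite mulKg -mem_double_lifts.
- by constructor 3; exists u.
- by left; rewrite map_f ?inE ?eqxx.
- left; apply/mapP; exists (x^-1 * y); last by rewrite mulVKg.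
  by rewrite inE mem_double_lifts xyB orbT.
- by right; apply/mapP; exists u.
Qed.

Lemma pVM x y : p (x^-1 * y) = (p x)^-1 * p y.
Proof. by rewrite (extM ext) (extV ext). Qed.

Lemma p_single x u a : p (x * s u * iota a) = p x * cj K u.
Proof. by rewrite (ext_p_iota ext) (extM ext) fs_p. Qed.

Lemma twist_adj_base c x y : twist_adj c x y ->
  [\/ (p x)^-1 * p y \in B, (p x)^-1 * p y \in map (cj K) S | (p x)^-1 * p y = 1].
Proof.
case/twist_adjP => [->|xyB|[u uS ->]].
- by constructor 3; rewrite (ext_p_iota ext) mulVg.
- by constructor 1; rewrite -(extV ext) -(extM ext).
- by constructor 2; rewrite p_single mulKg map_f.
Qed.

Lemma single_not_double x u a : u \in S -> p (x^-1 * (x * s u * iota a)) \notin B.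
Proof. by move=> uS; rewrite (extM ext) (extV ext) p_single mulKg fSB. Qed.

Lemma cj_S_neq1 u : u \in S -> cj K u <> 1.
Proof. by move=> + u1; rewrite -(cg_cj K u) u1 cg1 => uS; have := fS1 F; rewrite uS. Qed.

Lemma double_lifts_uniq : uniq double_lifts.
Proof.
apply: allpairs_uniq; rewrite ?fB_uniq// => -[b a] [b' a'] _ _ /= E.
have bb' : b = b'.
  by have := congr1 p E; rewrite !(ext_p_iota ext) !ext_liftK.
by move: E; rewrite bb' => /mulgI/(ext_inj ext) ->.
Qed.

Lemma neighbors_uniq c x : uniq (neighbors c x).
Proof.
rewrite cat_uniq map_inj_uniq; last exact: mulgI.
rewrite /= mem_double_lifts (ext_iota ext) fB1 double_lifts_uniq /=.
apply/andP; split.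
  apply/hasPn => _ /mapP[u uS ->]; apply/negP => yd.
  have /mapP[b] : x * s u * iota (c (cg K (p x)) u) \in [seq x * b | b <- z :: double_lifts] := yd.
  rewrite inE => /orP[/eqP ->|].
    move/(congr1 p); rewrite p_single (ext_p_iota ext) -{2}[p x]mulg1 => /mulgI.
    exact: cj_S_neq1.
  by move=> bB E; have := single_not_double x (c (cg K (p x)) u) uS; rewrite E mulKg -mem_double_lifts bB.
rewrite map_inj_in_uniq ?fS_uniq// => u v uS vS /(congr1 p).
by rewrite !p_single => /mulgI/cj_inj.
Qed.

Lemma twist_adj_irrefl c : irreflexive (twist_adj c).
Proof.
move=> x; apply/negP => /twist_adjP[|xB|[u uS]].
- by rewrite -{1}[x]mulg1 => /mulgI E; have := ext_true ext; rewrite -E eqxx.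
- by move: xB; rewrite mulVg (ext1 ext) (negbTE (fB1 F)).
- by move/(congr1 p); rewrite p_single -{1}[p x]mulg1 => /mulgI/esym; exact: cj_S_neq1.
Qed.

(** The vanishing condition serves twice: [c u v] is zero for [u], [v] in [S], which makes adjacency
    symmetric, and the neighbours of the neighbours of 1 are those of the untwisted graph, so
    triangles at 1 can be counted there. *)
Definition tame c := [/\ cocycle2 c, c 1 1 = false &
  forall x u, x \in neighbors (fun _ _ => false) 1 -> u \in S -> c (cg K (p x)) u = false].

Lemma tame0 : tame (fun _ _ => false).
Proof. by split=> //; apply/cocycleP. Qed.

Lemma tame_S c u v : tame c -> u \in S -> v \in S -> c u v = false.
Proof.
move=> [_ _ /(_ (s u) v)] + uS vS; rewrite fs_p cg_cj; apply=> //.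
rewrite mem_cat; apply/orP; right; apply/mapP; exists u => //.
by rewrite mul1g (ext0 ext) mulg1.
Qed.

Lemma twist_adj_sym c : tame c -> symmetric (twist_adj c).
Proof.
move=> ct; have [cP c11 _] := ct.
have imp x y : twist_adj c x y -> twist_adj c y x.
  case/twist_adjP => [->|xyB|[u uS ->]]; apply/twist_adjP.
  - by constructor 1; rewrite -mulgA (ext_sqr ext) mulg1.
  - by constructor 2; rewrite -[y^-1 * x]invgK invgM invgK (extV ext); exact: fB_sym.
  - constructor 3; exists u^-1; first exact: fS_sym.
    rewrite p_single cg_j fsV.
    set a := c _ u; set a' := c _ u^-1.
    (* The cocycle identity for [u] and [u^-1], where [c u u^-1] vanishes by tameness. *)
    have -> : a' = a.
      have := proj1 (cocycleP c) cP (cg K (p x)) u u^-1.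
      rewrite (tame_S ct) ?fS_sym// mulgV (cocycle_x1 cP c11) -/a -/a'.
      by case: a; case: a'.
    by rewrite -!mulgA (ext_central ext) -!mulgA (ext_sqr ext) mulg1 mulgV mulg1.
by move=> x y; apply/idP/idP; exact: imp.
Qed.

Definition twist_translate c y x := y * x * iota (translation K c (p y) (p x)).

Lemma p_translate c y x : p (twist_translate c y x) = p y * p x.
Proof. by rewrite (ext_p_iota ext) (extM ext). Qed.

Lemma translate_bij c y : bijective (twist_translate c y).
Proof.
exists (fun x => y^-1 * x * iota (translation K c (p y) ((p y)^-1 * p x))) => x.
  rewrite p_translate mulKg /twist_translate -!mulgA (ext_sqr ext) mulg1.
  by rewrite mulKg.
rewrite /twist_translate (ext_p_iota ext) (extM ext) (extV ext) -!mulgA (ext_sqr ext).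
by rewrite mulg1 mulVKg.
Qed.

Lemma translate1 c y : c 1 1 = false -> cocycle2 c -> twist_translate c y 1 = y.
Proof.
by move=> c11 cP; rewrite /twist_translate /translation (ext1 ext) cg1 cocycle_x1// (ext0 ext) !mulg1.
Qed.

(** By [translation_cj] the fibre coordinate of a translation changes along a single edge by exactly
    the difference of the twists at the two places. *)
Lemma twist_adj_translate c y : cocycle2 c ->
  {mono twist_translate c y : x x' / twist_adj c x x'}.
Proof.
move=> cP x x'; have [g _ gK] := translate_bij c y.
have inj := can_inj gK; have {}inj := bij_inj (translate_bij c y).
have e1 w : twist_translate c y (w * z) = twist_translate c y w * z.
  by rewrite /twist_translate (ext_p_iota ext) -!mulgA (ext_central ext true).
have e3 w u : u \in S ->
  twist_translate c y (w * s u * iota (c (cg K (p w)) u)) =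
  twist_translate c y w * s u * iota (c (cg K (p (twist_translate c y w))) u).
  move=> uS; rewrite /twist_translate p_single translation_cj// p_translate.
  rewrite !(extD ext) -!mulgA !(mulgA (iota _) (s u)) (ext_central ext _ (s u)) -!mulgA.
  rewrite -!(extD ext); do 3!congr (_ * _); congr iota.
  by xor_cases.
apply/twist_adjP/twist_adjP => -[E|xB|[u uS E]].
- by constructor 1; apply: inj; rewrite e1.
- constructor 2; move: xB; rewrite !pVM !p_translate.
  by rewrite invgM -!mulgA mulKg.
- by constructor 3; exists u => //; apply: inj; rewrite e3.
- by constructor 1; rewrite E e1.
- constructor 2; move: xB; rewrite !pVM !p_translate.
  by rewrite invgM -!mulgA mulKg.
- by constructor 3; exists u => //; rewrite -e3 // E.
Qed.

Lemma neighbors_agree c c' x : (forall u, u \in S -> c (cg K (p x)) u = c' (cg K (p x)) u) ->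
  neighbors c x = neighbors c' x.
Proof. by move=> cc'; congr (_ ++ _); apply/eq_in_map => u uS; rewrite cc'. Qed.

Lemma tame_neighbors c : tame c -> neighbors c 1 = neighbors (fun _ _ => false) 1.
Proof. by move=> [cP c11 _]; apply: neighbors_agree => u _; rewrite (ext1 ext) cg1 cocycle_1x. Qed.

End Twist.

(** * Maps of [H] induced by isomorphisms of twisted graphs *)

Section Recognition.
Local Open Scope group_scope.
Variables (G Q H Ht : groupType) (F : frame G Q H Ht).
Local Notation K := (fK F).
Local Notation S := (fS F).
Local Notation B := (fB F).
Local Notation T := (fT F).
Local Notation iota := (fi F).
Local Notation p := (fp F).
Local Notation s := (fs F).
Local Notation ext := (f_ext F).
Local Notation z := (iota true).
Local Notation lift := (ext_lift ext).
Local Notation c0 := (fun _ _ => false).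
Implicit Types (x y w : Ht) (h k : H) (u v : G) (c : G -> G -> bool) (a e : bool).

Lemma neighbors0 : neighbors F c0 1 = z :: double_lifts F ++ map s S.
Proof.
rewrite /neighbors (eq_map (fun b => mul1g b)) map_id /= (ext0 ext).
by congr (_ :: _ ++ _); apply: eq_map => u; rewrite mulg1 mul1g.
Qed.

Definition common c x y := count (fun w => twist_adj F c w y) (neighbors F c x).

Definition twist_iso c c' (f : Ht -> Ht) :=
  bijective f /\ forall x y, twist_adj F c' (f x) (f y) = twist_adj F c x y.

Lemma common_iso c c' f x y : twist_iso c c' f ->
  common c' (f x) (f y) = common c x y.
Proof.
move=> [[g fK gK] fadj]; have fI := can_inj fK.
have perm : perm_eq (neighbors F c' (f x)) [seq f w | w <- neighbors F c x].
  apply: uniq_perm; rewrite ?map_inj_uniq ?neighbors_uniq// => w.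
  rewrite -[LHS]/(twist_adj F c' (f x) w) -{1}(gK w) fadj.
  by rewrite -{2}(gK w) (mem_map fI).
by rewrite /common (permP perm) count_map; apply: eq_count => w /=; rewrite fadj.
Qed.

Lemma translate_iso c y : cocycle2 c -> twist_iso c c (twist_translate F c y).
Proof. by move=> cP; split; [exact: translate_bij | exact: twist_adj_translate]. Qed.

(** Translating [x] to 1 brings the triangles to where [c] vanishes. *)
Lemma common_tame c x y : tame F c -> exists y',
  p y' = (p x)^-1 * p y /\ common c x y = common c0 1 y'.
Proof.
move=> ct; have [cP c11 cS] := ct; have [g gK Kg] := translate_bij F c x.
exists (g y); split; first by rewrite -{2}(Kg y) p_translate mulKg.
rewrite -{1}(translate1 F x c11 cP) -{1}(Kg y) (common_iso _ _ (translate_iso x cP)).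
rewrite /common (tame_neighbors ct); apply: eq_in_count => w wn.
rewrite /twist_adj /= (neighbors_agree (c' := c0)) // => u uS; exact: cS.
Qed.

Lemma count_double_lifts h :
  count (fun b => (p b)^-1 * h \in B) (double_lifts F) = (triangles B h).*2.
Proof.
suff gen l : count (fun b => (p b)^-1 * h \in B)
    [seq lift b * iota a | b <- l, a <- [:: false; true]] =
    (count (fun b => b^-1 * h \in B) l).*2 by exact: gen.
elim: l => //= b l IHl; rewrite IHl !(ext_p_iota ext) !ext_liftK.
by case: (_ \in B); rewrite ?addn0 ?add0n // doubleD.
Qed.

(** A triangle with both sides over [B] has two lifts, one for each lift of its middle vertex. In
    the remaining ones the first or the second side lies over [S] or in a fibre, which allows at
    most [(size S).+1] for each of the two sides. *)
Lemma common_bounds y :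
  ((triangles B (p y)).*2 <= common c0 1 y <= (triangles B (p y) + (size S).+1).*2)%N.
Proof.
pose X := [seq y * x^-1 | x <- z :: map s S].
have countX : (count (mem X) (double_lifts F) <= (size S).+1)%N.
  have <- : size X = (size S).+1 by rewrite size_map /= size_map.
  rewrite -size_filter.
  apply: uniq_leq_size; first by rewrite filter_uniq// double_lifts_uniq.
  by move=> x; rewrite mem_filter => /andP[].
rewrite /common neighbors0 /= count_cat count_map.
apply/andP; split.
  rewrite -count_double_lifts; apply: leq_trans (leq_addl _ _); apply: leq_trans (leq_addr _ _).
  apply: sub_count => b /= bB; apply/twist_adjP; constructor 2; by rewrite pVM.
have le1 : (count (fun w => twist_adj F c0 w y) (double_lifts F) <=
            (triangles B (p y)).*2 + (size S).+1)%N.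
  rewrite -count_double_lifts; apply: leq_trans (leq_add (leqnn _) countX).
  rewrite -count_predUI; apply: leq_trans (leq_addr _ _).
  apply: sub_count => b /twist_adjP[E|bB|[u uS E]] /=.
  - by apply/orP; right; apply/mapP; exists z; rewrite ?inE ?eqxx// E mulgK.
  - by apply/orP; left; rewrite -pVM.
  - apply/orP; right; apply/mapP; exists (s u); first by rewrite inE map_f ?orbT.
    by rewrite E (ext0 ext) mulg1 mulgK.
have leS : (count (preim s (fun w => twist_adj F c0 w y)) S <= size S)%N by exact: count_size.
have lez : (twist_adj F c0 z y <= 1)%N by exact: leq_b1.
rewrite doubleD -[(size S).+1.*2]addnn addnC.
by rewrite -addnA (leq_trans (leq_add le1 (leq_add leS lez)))// addn1 addnA.
Qed.

(** An isomorphism preserves the number of common neighbours, so by [common_bounds] the triangle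
    counts in [H] differ at most by the tolerance of [f_sep]. *)
Lemma iso_base c c' f x y : tame F c -> tame F c' -> twist_iso c c' f ->
  twist_adj F c x y -> (p x)^-1 * p y \in word_ball T 5 ->
  (p (f x))^-1 * p (f y) = (p x)^-1 * p y \/
  (p (f x))^-1 * p (f y) = ((p x)^-1 * p y)^-1.
Proof.
move=> ct ct' fiso xy xyT; have fxy : twist_adj F c' (f x) (f y).
  by rewrite (proj2 fiso).
have [y1 [p1 e1]] := common_tame x y ct.
have [y2 [p2 e2]] := common_tame (f x) (f y) ct'.
have /andP[l1 u1] := common_bounds y1; have /andP[l2 u2] := common_bounds y2.
rewrite -p1 -p2 in xyT *.
have E : common c0 1 y1 = common c0 1 y2 by rewrite -e1 -e2 (common_iso _ _ fiso).
apply: (f_sep xyT); first by rewrite p2; exact: twist_adj_base fxy.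
- by rewrite -leq_double; apply: leq_trans l1 _; rewrite E.
- by rewrite -leq_double; apply: leq_trans l2 _; rewrite -E.
Qed.

Lemma one_word_ball n : 1 \in word_ball T n.
Proof. by apply: (@word_ball_mono _ _ (fT1 F) 0); rewrite ?inE. Qed.

(** This is [iso_base] for the colour 1: fibre edges go to fibre edges. *)
Lemma iso_fiber c c' f x : tame F c -> tame F c' -> twist_iso c c' f ->
  f (x * z) = f x * z.
Proof.
move=> ct ct' fiso; have xz : twist_adj F c x (x * z) by apply/twist_adjP; constructor 1.
have := iso_base ct ct' fiso xz.
rewrite (ext_p_iota ext) mulVg one_word_ball invg1 => /(_ isT).
have [[g fK _] _] := fiso.
move=> E; have {}E : p (f x) = p (f (x * z)).
  by apply: (mulgI (p (f x))^-1); rewrite mulVg; case: E => ->.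
have [[] E'] := ext_fiber ext E; first by [].
move: E'; rewrite (ext0 ext) mulg1 => /(can_inj fK).
by rewrite -{2}[x]mulg1 => /mulgI E'; have := ext_true ext; rewrite E' eqxx.
Qed.

Lemma iso_p c c' f x y : tame F c -> tame F c' -> twist_iso c c' f ->
  p x = p y -> p (f x) = p (f y).
Proof.
move=> ct ct' fiso /(ext_fiber ext)[[] ->]; last by rewrite (ext0 ext) mulg1.
by rewrite (iso_fiber _ ct ct' fiso) (ext_p_iota ext).
Qed.

Definition base_map (f : Ht -> Ht) h := p (f (lift h)).

Lemma base_mapE c c' f x : tame F c -> tame F c' -> twist_iso c c' f ->
  base_map f (p x) = p (f x).
Proof. by move=> ct ct' fiso; apply: (iso_p ct ct' fiso); rewrite ext_liftK. Qed.

Lemma twist_iso_inv c c' f g : twist_iso c c' f -> cancel f g -> cancel g f ->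
  twist_iso c' c g.
Proof.
move=> [fb fadj] fK gK; split; first by exists f.
by move=> x y; rewrite -fadj !gK.
Qed.

Lemma twist_iso_comp c c' c'' f g : twist_iso c c' f -> twist_iso c' c'' g ->
  twist_iso c c'' (g \o f).
Proof.
move=> [fb fadj] [gb gadj]; split; first exact: bij_comp.
by move=> x y /=; rewrite gadj fadj.
Qed.

Lemma base_map_bij c c' f : tame F c -> tame F c' -> twist_iso c c' f ->
  bijective (base_map f).
Proof.
move=> ct ct' fiso; have [[g fK gK] _] := fiso.
have giso := twist_iso_inv fiso fK gK.
exists (base_map g) => h; rewrite {2}/base_map.
  by rewrite (base_mapE _ ct' ct giso) fK ext_liftK.
by rewrite (base_mapE _ ct ct' fiso) gK ext_liftK.
Qed.

Lemma base_map_color c c' f : tame F c -> tame F c' -> twist_iso c c' f ->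
  color_preserving T (base_map f).
Proof.
move=> ct ct' fiso h t t5.
have [->|t1] := eqVneq t 1; first by left; rewrite !mulg1.
pose y := lift h * lift t.
have pE : (p (lift h))^-1 * p y = t by rewrite (extM ext) !ext_liftK mulKg.
have xy : twist_adj F c (lift h) y.
  by apply/twist_adjP; constructor 2; rewrite pVM pE; apply: fTB => //; exact/eqP.
have -> : h * t = p y by rewrite (extM ext) !ext_liftK.
rewrite (base_mapE _ ct ct' fiso) /base_map.
have := iso_base ct ct' fiso xy; rewrite pE => /(_ t5)[E|E]; [left|right]; by rewrite -E mulVKg.
Qed.

Lemma base_map_determined c c1 c2 f1 f2 : tame F c -> tame F c1 -> tame F c2 ->
  twist_iso c c1 f1 -> twist_iso c c2 f2 ->
  {in word_ball T 2, base_map f1 =1 base_map f2} -> base_map f1 =1 base_map f2.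
Proof.
move=> ct ct1 ct2 f1iso f2iso.
exact: (color_determined (@fT_sym _ _ _ _ F) (fT1 F) (fT_gen F) (base_map_bij ct ct2 f2iso)
  (base_map_color ct ct1 f1iso) (base_map_color ct ct2 f2iso)).
Qed.

Lemma iso_over_id c c' f : tame F c -> tame F c' -> twist_iso c c' f ->
  (forall x, p (f x) = p x) -> exists e : H -> bool,
  (forall x, f x = x * iota (e (p x))) /\
  forall h u, u \in S -> c' (cg K h) u = c (cg K h) u (+) e h (+) e (h * cj K u).
Proof.
move=> ct ct' fiso fp.
have ex h : exists a, f (lift h) = lift h * iota a.
  by apply: (ext_fiber ext); rewrite fp.
have [e eE] := choice ex; exists e.
have fE x : f x = x * iota (e (p x)).
  have [[] ->] := ext_fiber ext (ext_liftK ext (p x)); last first.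
    by rewrite (ext0 ext) mulg1 ext_liftK eE.
  by rewrite (iso_fiber _ ct ct' fiso) eE (ext_p_iota ext) ext_liftK -!mulgA (ext_central ext).
split=> // h u uS.
pose x := lift h; pose y := x * s u * iota (c (cg K (p x)) u).
have xy : twist_adj F c x y by apply/twist_adjP; constructor 3; exists u.
have : twist_adj F c' (f x) (f y) by rewrite (proj2 fiso).
have py : p y = h * cj K u by rewrite p_single ext_liftK.
case/twist_adjP => [E|bB|[v vS E]].
- have := congr1 p E; rewrite (ext_p_iota ext) !fp py ext_liftK -{2}[h]mulg1 => /mulgI.
  by move/(cj_S_neq1 uS).
- by move: bB; rewrite pVM !fp py ext_liftK mulKg (negbTE (fSB uS)).
- have vu : v = u.
    by have := congr1 p E; rewrite p_single !fp py ext_liftK => /mulgI/cj_inj.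
  move: E; rewrite vu !fE py !ext_liftK (ext_p_iota ext) !ext_liftK /y ext_liftK => E.
  have {}E : lift h * s u * iota (c (cg K h) u (+) e (h * cj K u)) =
             lift h * s u * iota (e h (+) c' (cg K h) u).
    rewrite !(extD ext) !mulgA E; rewrite -!mulgA; congr (_ * _).
    by rewrite !mulgA (ext_central ext).
  move/mulgI/(ext_inj ext): E; by case: (c _ _) (c' _ _) (e h) (e _) => -[] [] [].
Qed.

End Recognition.

(** * Null-homotopic loops in twisted graphs *)

Section LazyHomotopy.
Variables (T : eqType) (e : rel T) (k : nat).
Implicit Types (x y : T) (s t u v : seq T).

(** Stationary steps allow trivial generators and a possibly trivial last step inside a fibre. *)
Definition lazy : rel T := [rel x y | (x == y) || e x y].

Lemma lazy_refl x : lazy x x. Proof. by rewrite /lazy /= eqxx. Qed.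

Lemma lazy_path x s : path lazy x s -> exists2 t, path e x t & last x t = last x s.
Proof.
elim: s x => [|y s IHs] x /=; first by exists [::].
move=> /andP[xy /IHs[t yt tE]]; case/orP: xy => [/eqP ->|xy]; first by exists t.
by exists (y :: t) => //=; rewrite xy.
Qed.

(** Only the replaced segment has to be a path. As [u] and [v] are arbitrary lists, the relation is
    stable under concatenation. *)
Inductive homotopic : seq T -> seq T -> Prop :=
| homotopic_refl s : homotopic s s
| homotopic_sym s t : homotopic s t -> homotopic t s
| homotopic_trans s t u : homotopic s t -> homotopic t u -> homotopic s u
| homotopic_step u v x s t : path lazy x s -> path lazy x t ->
    last x s = last x t -> (size s + size t <= k)%N ->
    homotopic (u ++ x :: s ++ v) (u ++ x :: t ++ v).

Lemma homotopic_cat u v s t : homotopic s t -> homotopic (u ++ s ++ v) (u ++ t ++ v).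
Proof.
elim=> {s t} [s|s t _|s t w _ + _|u' v' x s t xs xt st sk].
- exact: homotopic_refl.
- exact: homotopic_sym.
- exact: homotopic_trans.
- rewrite -!catA !cat_cons -!catA !(catA u u').
  by have := homotopic_step (u ++ u') (v' ++ v) xs xt st sk.
Qed.

Lemma homotopic_catl u s t : homotopic s t -> homotopic (u ++ s) (u ++ t).
Proof. by move/(homotopic_cat u [::]); rewrite !cats0. Qed.

Lemma homotopic_catr v s t : homotopic s t -> homotopic (s ++ v) (t ++ v).
Proof. exact: (homotopic_cat [::] v). Qed.

Lemma homotopic_cons x s t : homotopic s t -> homotopic (x :: s) (x :: t).
Proof. exact: (@homotopic_catl [:: x]). Qed.

Lemma homotopic_short x s t : path lazy x s -> path lazy x t ->
  last x s = last x t -> (size s + size t <= k)%N -> homotopic (x :: s) (x :: t).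
Proof.
by move=> xs xt st sk; have := homotopic_step [::] [::] xs xt st sk; rewrite !cats0.
Qed.

End LazyHomotopy.

Section TwistHomotopy.
Local Open Scope group_scope.
Variables (G Q H Ht : groupType) (F : frame G Q H Ht).
Local Notation K := (fK F).
Local Notation S := (fS F).
Local Notation B := (fB F).
Local Notation T := (fT F).
Local Notation p := (fp F).
Local Notation ext := (f_ext F).
Local Notation lift := (ext_lift ext).
Variables (n : nat) (g : 'I_n -> H) (rels : seq (word n)).
Hypothesis gT : forall i, g i \in T.
Hypothesis g_rels : forall w1 w2, eval_word g w1 = eval_word g w2 <-> presented_eq rels w1 w2.

Let gh i := lift (g i).

Lemma p_eval_letter l : p (eval_letter gh l) = eval_letter g l.
Proof. by case: l => [[] i]; rewrite /eval_letter /= ?(extV ext) ext_liftK. Qed.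

Lemma p_eval_word w : p (eval_word gh w) = eval_word g w.
Proof.
elim: w => [|l w IHw]; first by rewrite /eval_word !big_nil (ext1 ext).
by rewrite !eval_word_cons (extM ext) IHw p_eval_letter.
Qed.

Fixpoint word_path (x : Ht) (w : word n) : seq Ht :=
  if w is l :: v then x * eval_letter gh l :: word_path (x * eval_letter gh l) v else [::].

Lemma size_word_path x w : size (word_path x w) = size w.
Proof. by elim: w x => //= l w IHw x; rewrite IHw. Qed.

Lemma last_word_path x w : last x (word_path x w) = x * eval_word gh w.
Proof.
elim: w x => [|l w IHw] x /=; first by rewrite /eval_word big_nil mulg1.
by rewrite IHw eval_word_cons mulgA.
Qed.

Lemma word_path_belast x w t : x :: word_path x w ++ t =
  belast x (word_path x w) ++ (x * eval_word gh w) :: t.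
Proof. by rewrite -cat_cons lastI last_word_path cat_rcons. Qed.

Lemma word_path_cat x v w : word_path x (v ++ w) =
  word_path x v ++ word_path (x * eval_word gh v) w.
Proof.
elim: v x => [|l v IHv] x /=; first by rewrite /eval_word big_nil mulg1.
by rewrite IHv eval_word_cons mulgA.
Qed.

Variable c : G -> G -> bool.
Let e := twist_adj F c.

Lemma lazy_ball x y t : t \in word_ball T 5 -> p y = p x * t -> lazy e x y.
Proof.
move=> tT pE; rewrite /lazy /=; have [t1|t1] := eqVneq t 1.
  move: pE; rewrite t1 mulg1 => /esym/(ext_fiber ext)[[] ->].
    by apply/orP; right; apply/twist_adjP; constructor 1.
  by rewrite (ext0 ext) mulg1 eqxx.
apply/orP; right; apply/twist_adjP; constructor 2.
by rewrite pVM pE mulKg; apply: fTB => //; exact/eqP.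
Qed.

Lemma lazy_fiber x y : p x = p y -> lazy e x y.
Proof. by move=> pxy; apply: (lazy_ball (one_word_ball F 5)); rewrite mulg1. Qed.

Lemma lazy_letter x y l : p y = p x * eval_letter g l -> lazy e x y.
Proof.
apply: lazy_ball; apply: (@word_ball_mono _ _ (fT1 F) 1) => //.
by rewrite mem_word_ball1; case: l => [[] i] /=; rewrite /eval_letter /= ?gT//; exact/fT_sym/gT.
Qed.

Lemma path_word_path x w : path (lazy e) x (word_path x w).
Proof.
elim: w x => //= l w IHw x; rewrite IHw andbT; apply: (lazy_letter (l := l)).
by rewrite (extM ext) p_eval_letter.
Qed.

(** The lifted letters of [w] may lead to the other point over the image of [y]; the last step
    corrects this within the fibre. *)
Definition route x w y := x :: word_path x w ++ [:: y].

Variable k : nat.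
Hypothesis k4 : (4 <= k)%N.
Hypothesis k_rels : forall r, r \in rels -> (size r < k)%N.
Local Notation hom := (homotopic e k).

(** The lifts of [w] from [x] and from [x'] are joined by a ladder whose rungs lie in fibres. Its
    squares have length 4. *)
Lemma route_start x x' w y : p x' = p x -> p y = p x * eval_word g w ->
  hom (x' :: route x w y) (route x' w y).
Proof.
elim: w x x' => [|l w IHw] x x' pxx.
  rewrite /eval_word big_nil mulg1 => pyx; apply: homotopic_short => //=.
  - by rewrite !lazy_fiber.
  - by rewrite lazy_fiber// pyx.
  - by apply: leq_trans k4.
rewrite eval_word_cons mulgA => py.
set xl := x * eval_letter gh l; set xl' := x' * eval_letter gh l.
have pxl : p xl = p x * eval_letter g l by rewrite (extM ext) p_eval_letter.
have pxl' : p xl' = p x * eval_letter g l by rewrite (extM ext) p_eval_letter pxx.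
apply: (@homotopic_trans _ _ _ _ (x' :: xl' :: route xl w y)).
  have : hom [:: x'; x; xl] [:: x'; xl'; xl].
    apply: homotopic_short => //=; rewrite andbT; apply/andP; split.
    - exact: lazy_fiber.
    - exact: lazy_letter pxl.
    - by apply: (lazy_letter (l := l)); rewrite pxl' pxx.
    - by apply: lazy_fiber; rewrite pxl.
  by move/(homotopic_catr (word_path xl w ++ [:: y])).
by apply: homotopic_cons; apply: IHw; rewrite ?pxl.
Qed.

Lemma route_cat x w y w' y' : p y = p x * eval_word g w -> p y' = p y * eval_word g w' ->
  hom (route x w y ++ word_path y w' ++ [:: y']) (route x (w ++ w') y').
Proof.
move=> py py'; rewrite /route word_path_cat.
rewrite -catA -cat_cons -[X in hom X]catA cat_cons 2!(word_path_belast x w).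
apply: homotopic_catl; apply: route_start => //.
by rewrite (extM ext) p_eval_word.
Qed.

(** The lift of a relator ends in the fibre where it starts, so it is replaced by a single step, for
    which [size r + 1 <= k] is needed. Then [route_start] moves the rest of the route. *)
Lemma route_presented w1 w2 x y : presented_eq rels w1 w2 ->
  p y = p x * eval_word g w1 -> hom (route x w1 y) (route x w2 y).
Proof.
move=> w12; elim: w12 x y => {w1 w2} [w|w1 w2 /g_rels E IH|w1 w2 w3 /g_rels E IH _ IH'|u v b i|u v r rr] x y.
- by move=> _; exact: homotopic_refl.
- by rewrite -E => py; apply: homotopic_sym; exact: IH.
- by move=> py; apply: homotopic_trans (IH _ _ py) (IH' _ _ _); rewrite py E.
- move=> _; rewrite /route !word_path_cat /= -!catA /=.
  have E : eval_letter gh (b, i) * eval_letter gh (~~ b, i) = 1.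
    by case: b; rewrite /eval_letter /= ?mulVg ?mulgV.
  set x1 := x * _; have x1E : x1 * eval_letter gh (b, i) * eval_letter gh (~~ b, i) = x1.
    by rewrite -mulgA E mulg1.
  rewrite x1E 2!(word_path_belast x u) -/x1.
  apply: homotopic_catl.
  have : hom [:: x1; x1 * eval_letter gh (b, i); x1] [:: x1].
    have px1 : p (x1 * eval_letter gh (b, i)) = p x1 * eval_letter g (b, i).
      by rewrite (extM ext) p_eval_letter.
    apply: homotopic_short => //=; last by apply: leq_trans k4.
    rewrite andbT; apply/andP; split; first exact: lazy_letter px1.
    apply: (lazy_letter (l := (~~ b, i))); rewrite -[in LHS]x1E (extM ext) p_eval_letter.
    by [].
  by move/(homotopic_catr (word_path x1 v ++ [:: y])).
- move=> py; rewrite /route !word_path_cat -!catA.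
  set x1 := x * _; set x2 := x1 * _.
  have r1 : eval_word g r = 1.
    have -> : 1 = eval_word g [::] by rewrite /eval_word big_nil.
    by apply/g_rels; have := presented_rel [::] [::] rr; rewrite cats0.
  have px2 : p x2 = p x1 by rewrite (extM ext) p_eval_word r1 mulg1.
  rewrite 2!(word_path_belast x u) -/x1.
  apply: homotopic_catl.
  apply: (@homotopic_trans _ _ _ _ (x1 :: route x2 v y)); last first.
    apply: route_start => //; rewrite px2 (extM ext) p_eval_word -mulgA -eval_word_cat.
    by rewrite py !eval_word_cat r1 mul1g.
  have : hom (x1 :: word_path x1 r) [:: x1; x2].
    apply: homotopic_short; rewrite ?last_word_path ?size_word_path ?path_word_path//=.
      by rewrite lazy_fiber.
    by rewrite addn1 k_rels.
  by move/(homotopic_catr (word_path x2 v ++ [:: y])).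
Qed.

Hypothesis k_edge : forall b, [\/ b \in B, b \in map (cj K) S | b = 1] ->
  exists2 w, eval_word g w = b & (size w + 2 <= k)%N.

Lemma route_edge x y : lazy e x y -> exists2 w,
  p y = p x * eval_word g w & hom [:: x; y] (route x w y).
Proof.
move=> xy; have [|w wE wk] := k_edge (b := (p x)^-1 * p y).
  case/orP: (xy) => [/eqP ->|]; first by constructor 3; rewrite mulVg.
  exact: twist_adj_base.
have py : p y = p x * eval_word g w by rewrite wE mulVKg.
exists w => //; apply: homotopic_short => /=; first by rewrite xy.
- rewrite cats1 rcons_path path_word_path last_word_path; apply: lazy_fiber.
  by rewrite (extM ext) p_eval_word py.
- by rewrite last_cat.
- by rewrite size_cat size_word_path /= addnC -addnA.
Qed.

Lemma route_path x s : path (lazy e) x s -> exists2 w,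
  p (last x s) = p x * eval_word g w & hom (x :: s) (route x w (last x s)).
Proof.
elim: s x => [|y s IHs] x /=.
  move=> _; exists [::]; first by rewrite /eval_word big_nil mulg1.
  by apply: homotopic_short => //=; [rewrite lazy_refl | apply: leq_trans k4].
move=> /andP[/route_edge[w py xy] /IHs[w' py' ys]].
exists (w ++ w'); first by rewrite py' py eval_word_cat mulgA.
apply: homotopic_trans (route_cat py py').
apply: homotopic_trans (homotopic_cons x ys) _.
by have := homotopic_catr (word_path y w' ++ [:: last y s]) xy.
Qed.

(** Each edge is replaced by a route over [T]. Whether a route is a path does not depend on [c], so
    the presentation of [H] contracts the resulting loop with the same [k] for every cocycle. *)
Theorem twist_simply_connected x s : path (lazy e) x s -> last x s = x ->
  hom (x :: s) [:: x].
Proof.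
move=> xs sx; have [w] := route_path xs; rewrite sx => pw xw.
apply: homotopic_trans xw _.
apply: (@homotopic_trans _ _ _ _ (route x [::] x)).
  apply: route_presented (pw); apply/g_rels.
  by apply: (mulgI (p x)); rewrite -pw /eval_word big_nil mulg1.
by apply: homotopic_short => //=; [rewrite lazy_refl | apply: leq_trans k4].
Qed.

End TwistHomotopy.

(** * Simple connectedness of polygonal complexes *)

Section Continuity.
Variable R : realType.

Lemma continuous_pair (T U V : topologicalType) (f : T -> U) (g : T -> V) :
  continuous f -> continuous g -> continuous (fun x => (f x, g x)).
Proof. by move=> cf cg x; apply: (cvg_pair (cf x) (cg x)). Qed.

Lemma ptws_continuous (T : topologicalType) (I : eqType) (V : topologicalType)
    (f : T -> {ptws I -> V}) :
  (forall i, continuous (fun x => f x i)) -> continuous f.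
Proof.
move=> cf x; apply/cvg_sup => i.
exact: (@continuous_comp_initial {ptws I -> V} T V (fun g => g i) f (cf i) x).
Qed.

(** The projection of the line onto [[0, 1]], in a form whose continuity is immediate. *)
Definition clamp01 (x : R) : R := (`|x| - `|x - 1| + 1) / 2.

Lemma clamp01_continuous : continuous clamp01.
Proof.
move=> x; apply: cvgM; last exact: cvg_cst.
apply: cvgD; last exact: cvg_cst.
apply: cvgB; first exact: norm_continuous.
by apply: cvg_norm; apply: cvgB; [exact: cvg_id | exact: cvg_cst].
Qed.

Lemma clamp01_le0 x : x <= 0 -> clamp01 x = 0.
Proof.
move=> x0; rewrite /clamp01 ler0_norm// ler0_norm; last by rewrite subr_le0 (le_trans x0).
by lra.
Qed.

Lemma clamp01_ge1 x : 1 <= x -> clamp01 x = 1.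
Proof.
move=> x1; rewrite /clamp01 !ger0_norm ?subr_ge0//; last exact: le_trans x1.
by lra.
Qed.

Lemma clamp01_id x : 0 <= x <= 1 -> clamp01 x = x.
Proof.
move=> /andP[x0 x1]; rewrite /clamp01 ger0_norm// ler0_norm ?subr_le0//.
by lra.
Qed.

Lemma clamp01_itv x : 0 <= clamp01 x <= 1.
Proof.
have [x0|x0] := leP x 0; first by rewrite clamp01_le0// lexx ler01.
have [x1|x1] := leP 1 x; first by rewrite clamp01_ge1// lexx ler01.
by rewrite clamp01_id ltW//= ltW.
Qed.

Definition coordwise (T : topologicalType) (I : Type) (f : T -> I -> R) :=
  forall i, continuous (fun x => f x i).

Lemma coordwise_comp (T U : topologicalType) (I : Type) (f : U -> I -> R) (g : T -> U) :
  coordwise f -> continuous g -> coordwise (f \o g).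
Proof.
by move=> cf cg i x; apply: (@continuous_comp _ _ _ g (fun y => f y i)); [exact: cg | exact: cf].
Qed.

End Continuity.

(** * Homotopies between piecewise linear paths *)

Section PathHomotopy.
Variables (R : realType) (I : eqType) (A : set (I -> R)).
Implicit Types (a b p q : I -> R) (f g : R -> I -> R).

(** Paths are defined on the whole line and are constant before 0 and after [M]. Thus paths with
    different numbers of segments are compared without rescaling. *)
Definition path_hom a b f g := exists (M : R) (h : R * R -> I -> R),
  [/\ coordwise h, forall st, A (h st), forall t, h (0, t) = f t,
      forall t, h (1, t) = g t &
      forall s t, (t <= 0 -> h (s, t) = a) /\ (M <= t -> h (s, t) = b)].

Lemma path_hom_sym a b f g : path_hom a b f g -> path_hom a b g f.
Proof.
move=> [M [h [ch Ah h0 h1 hab]]]; exists M, (fun st => h (1 - st.1, st.2)); split.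
- apply: (coordwise_comp (g := fun st : R * R => (1 - st.1, st.2)) ch).
  apply: continuous_pair => x; last exact: cvg_snd.
  by apply: cvgB; [exact: cvg_cst | exact: cvg_fst].
- by move=> st.
- by move=> t /=; rewrite subr0.
- by move=> t /=; rewrite subrr.
- by move=> s t /=; exact: hab.
Qed.

(* On each half of the square one of the two homotopies is constant and equal to
   the middle path, which the third term cancels. *)
Lemma path_hom_trans a b f g k : path_hom a b f g -> path_hom a b g k -> path_hom a b f k.
Proof.
move=> [M [h [ch Ah h0 h1 hab]]] [M' [h' [ch' Ah' h0' h1' hab']]].
pose u (s : R) := clamp01 (2 * s); pose v (s : R) := clamp01 (2 * s - 1).
pose w st i := h (u st.1, st.2) i + h' (v st.1, st.2) i - g st.2 i.
have cg : coordwise g.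
  have -> : g = h \o (fun t => (1, t)) by apply/funext => t; rewrite /= h1.
  apply: coordwise_comp ch _; apply: continuous_pair => x; first exact: cvg_cst.
  exact: cvg_id.
have wE s t : w (s, t) = if s <= 1 / 2 then h (u s, t) else h' (v s, t).
  apply/funext => i; rewrite /w /=; case: leP => s2.
    by rewrite {1}/v clamp01_le0 ?h0' ?addrK//; lra.
  by rewrite {1}/u clamp01_ge1 ?h1 1?addrC ?addKr//; lra.
exists (Order.max M M'), w; split.
- move=> i x; apply: cvgB; last first.
    apply: (@continuous_comp _ _ _ snd (fun y => g y i)); [exact: cvg_snd | exact: cg].
  have c2 : continuous (fun s : R => 2 * s).
    by move=> s; apply: cvgM; [exact: cvg_cst | exact: cvg_id].
  have cu1 : continuous u.
    by move=> s; apply: (@continuous_comp R R R (fun s => 2 * s) (@clamp01 R)); [exact: c2 | exact: clamp01_continuous].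
  have cv1 : continuous v.
    move=> s; apply: (@continuous_comp R R R (fun s => 2 * s - 1) (@clamp01 R)); last exact: clamp01_continuous.
    by apply: cvgB; [exact: c2 | exact: cvg_cst].
  have cu : continuous (fun st : R * R => (u st.1, st.2)).
    apply: continuous_pair => y; last exact: cvg_snd.
    by apply: (@continuous_comp _ _ _ fst u); [exact: cvg_fst | exact: cu1].
  have cv : continuous (fun st : R * R => (v st.1, st.2)).
    apply: continuous_pair => y; last exact: cvg_snd.
    by apply: (@continuous_comp _ _ _ fst v); [exact: cvg_fst | exact: cv1].
  apply: cvgD.
    by apply: (@continuous_comp _ _ _ (fun st : R * R => (u st.1, st.2)) (fun y => h y i)); [exact: cu | exact: ch].
  by apply: (@continuous_comp _ _ _ (fun st : R * R => (v st.1, st.2)) (fun y => h' y i)); [exact: cv | exact: ch'].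
- by move=> [s t]; rewrite wE; case: ifP.
- by move=> t; rewrite wE ifT ?divr_ge0// /u mulr0 clamp01_le0.
- move=> t; rewrite wE ifF; first by rewrite /v clamp01_ge1// mulr1; lra.
  by apply/negbTE; rewrite -ltNge; lra.
- move=> s t; rewrite wE ge_max; have [h1ab h2ab] := hab (u s) t.
  by have [h1ab' h2ab'] := hab' (v s) t; split=> [t0|/andP[? ?]]; case: ifP => _; auto.
Qed.

Lemma path_hom_linear a b f g M : coordwise f -> coordwise g ->
  (forall t s, 0 <= s <= 1 -> A (segment_point (f t) (g t) s)) ->
  (forall t, t <= 0 -> f t = a /\ g t = a) ->
  (forall t, M <= t -> f t = b /\ g t = b) -> path_hom a b f g.
Proof.
move=> cf cg Afg fga fgb; exists M, (fun st => segment_point (f st.2) (g st.2) (clamp01 st.1)).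
have c01 : continuous (fun st : R * R => clamp01 st.1).
  by move=> y; apply: (@continuous_comp _ _ _ fst (@clamp01 R)); [exact: cvg_fst | exact: clamp01_continuous].
split.
- move=> i x; apply: cvgD; apply: cvgM.
  + by apply: cvgB; [exact: cvg_cst | exact: c01].
  + by apply: (@continuous_comp _ _ _ snd (fun y => f y i)); [exact: cvg_snd | exact: cf].
  + exact: c01.
  + by apply: (@continuous_comp _ _ _ snd (fun y => g y i)); [exact: cvg_snd | exact: cg].
- by move=> st; apply: Afg; exact: clamp01_itv.
- by move=> t /=; rewrite clamp01_le0// /segment_point; apply/funext => i; rewrite subr0 mul1r mul0r addr0.
- by move=> t /=; rewrite clamp01_ge1// /segment_point; apply/funext => i; rewrite subrr mul0r mul1r add0r.
- have cc s p : segment_point p p s = p.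
    by apply/funext => i; rewrite /segment_point -mulrDl subrK mul1r.
  by move=> s t; split=> [/fga|/fgb] [-> ->]; rewrite /= cc.
Qed.

Section PiecewiseLinear.
Implicit Types (l u w : seq (I -> R)).

(** Each segment takes unit time. The telescoping form avoids a case distinction on [t], so the
    coordinates are continuous by induction. *)
Fixpoint pl a l (t : R) : I -> R := fun i =>
  if l is b :: l' then (a i - b i) * (1 - clamp01 t) + pl b l' (t - 1) i else a i.

Lemma pl_coordwise a l : coordwise (pl a l).
Proof.
elim: l a => [|b l IHl] a i /=; first by move=> x; exact: cvg_cst.
move=> x; apply: cvgD.
  apply: cvgM; first exact: cvg_cst.
  by apply: cvgB; [exact: cvg_cst | exact: clamp01_continuous].
apply: (@continuous_comp R R R (fun t => t - 1) (fun y => pl b l y i)); last exact: IHl.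
by apply: cvgB; [exact: cvg_id | exact: cvg_cst].
Qed.

Lemma pl_le0 a l t : t <= 0 -> pl a l t = a.
Proof.
elim: l a t => [//|b l IHl] a t t0; apply/funext => i /=.
by rewrite clamp01_le0// IHl; [rewrite subr0 mulr1 subrK | lra].
Qed.

Lemma pl_cons_le1 a b l t : 0 <= t <= 1 -> pl a (b :: l) t = segment_point a b t.
Proof.
move=> /andP[t0 t1]; apply/funext => i /=; rewrite clamp01_id ?t0// pl_le0; last by lra.
by rewrite /segment_point; ring.
Qed.

Lemma pl_cons_ge1 a b l t : 1 <= t -> pl a (b :: l) t = pl b l (t - 1).
Proof.
by move=> t1; apply/funext => i /=; rewrite clamp01_ge1// subrr mulr0 add0r.
Qed.

Lemma pl_ge_size a l t : (size l)%:R <= t -> pl a l t = last a l.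
Proof.
elim: l a t => [//|b l IHl] a t /=; rewrite -natr1 => st.
by rewrite -[LHS]/(pl a (b :: l) t) pl_cons_ge1 ?IHl//; have := ler0n R (size l); lra.
Qed.

Lemma pl_rcons_last a l : pl a (rcons l (last a l)) = pl a l.
Proof.
elim: l a => [|b l IHl] a /=; apply/funext => t; apply/funext => i.
  by rewrite subrr mul0r add0r.
by rewrite IHl.
Qed.

Variable D : set (set (I -> R)).
Hypothesis DA : forall s, D s -> s `<=` A.
Hypothesis D_convex : forall s p q t, D s -> s p -> s q -> 0 <= t <= 1 -> s (segment_point p q t).

Definition tri p q r := exists s, [/\ D s, s p, s q & s r].

(** The changes realized directly by straight-line homotopies. The vertex [c] after the moved one
    keeps the endpoint fixed. *)
Inductive moves a : seq (I -> R) -> seq (I -> R) -> Prop :=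
| moves_refl l : moves a l l
| moves_sym l l' : moves a l l' -> moves a l' l
| moves_trans l l' l'' : moves a l l' -> moves a l' l'' -> moves a l l''
| moves_pad l : moves a l (rcons l (last a l))
| moves_node u b b' c w : tri (last a u) b b' -> tri b b' c ->
    moves a (u ++ b :: c :: w) (u ++ b' :: c :: w).

Fixpoint linked a l := if l is b :: l' then tri a b b /\ linked b l' else tri a a a.

Lemma linked_A a l : linked a l -> A a.
Proof. by case: l => [|b l] /= => [|[+ _]] => -[s [Ds sa _ _]]; exact: DA sa. Qed.

Lemma linked_cat a u w : linked a (u ++ w) <-> linked a u /\ linked (last a u) w.
Proof.
elim: u a => [|x u IHu] a /=.
  split=> [h|[]//]; split=> //; case: w h => [//|b w] /= [[s [Ds sa _ _]] _].
  by exists s.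
by split=> [[? /IHu[]]|[[? ?] ?]]; do ?split=> //; apply/IHu.
Qed.

Lemma pl_A a l t : linked a l -> A (pl a l t).
Proof.
elim: l a t => [|b l IHl] a t ll; have Aa := linked_A ll; first by [].
case: ll => [[s [Ds sa sb _]] bl].
have [t0|t0] := leP t 0; first by rewrite pl_le0.
have [t1|t1] := leP 1 t; first by rewrite pl_cons_ge1//; exact: IHl.
have t01 : 0 <= t <= 1 by rewrite !ltW.
by rewrite pl_cons_le1//; apply: (DA Ds); exact: D_convex.
Qed.

Lemma segment_point_id t p : segment_point p p t = p.
Proof. by apply/funext => i; rewrite /segment_point -mulrDl subrK mul1r. Qed.

Lemma node_linear a u b b' c w t s : tri (last a u) b b' -> tri b b' c ->
  linked a (u ++ b :: c :: w) -> 0 <= s <= 1 ->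
  A (segment_point (pl a (u ++ b :: c :: w) t) (pl a (u ++ b' :: c :: w) t) s).
Proof.
move=> + bbc + s01; elim: u a t => [|x u IHu] a t abb ll; have Aa := linked_A ll;
  rewrite ?cat0s ?cat_cons;
  (have [t0|t0] := leP t 0; first by rewrite !(pl_le0 a (_ :: _))// segment_point_id).
- have [t1|t1] := leP t 1.
    have t01 : 0 <= t <= 1 by rewrite ltW.
    rewrite !(pl_cons_le1 a)//; case: abb => r [Dr ra rb rb'].
    by apply: (DA Dr); do 2?apply: D_convex.
  rewrite !(pl_cons_ge1 a) ?ltW//; have [t2|t2] := leP (t - 1) 1.
    have t01 : 0 <= t - 1 <= 1 by rewrite t2 andbT; lra.
    rewrite !pl_cons_le1//; case: bbc => r [Dr rb rb' rc].
    by apply: (DA Dr); do 2?apply: D_convex.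
  rewrite !(pl_cons_ge1 b) ?(pl_cons_ge1 b') ?ltW// segment_point_id.
  by apply: pl_A; case: ll => _ [].
- have [t1|t1] := leP t 1.
    have t01 : 0 <= t <= 1 by rewrite ltW.
    rewrite !(pl_cons_le1 a)// segment_point_id; case: ll => -[r [Dr ra rx _]] _.
    by apply: (DA Dr); apply: D_convex.
  rewrite !(pl_cons_ge1 a) ?ltW//; apply: IHu => //.
  by case: ll.
Qed.

Lemma tri_permE p q r : tri p q r -> forall x y z,
  x = p \/ x = q \/ x = r -> y = p \/ y = q \/ y = r -> z = p \/ z = q \/ z = r ->
  tri x y z.
Proof.
move=> [s [Ds sp sq sr]] x y z X Y Z; exists s; split=> //.
- by case: X => [->|[]->].
- by case: Y => [->|[]->].
- by case: Z => [->|[]->].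
Qed.

Ltac tri_perm h := apply: (tri_permE h); tauto.

Lemma moves_linked a l l' : moves a l l' -> (linked a l <-> linked a l') /\ last a l = last a l'.
Proof.
elim=> {l l'} [//|l l' _ [[? ?] ->]//|l l' l'' _ [[? ?] ->] _ [[? ?] ->]|l|u b b' c w h1 h2].
- by split=> //; split; auto.
- rewrite last_rcons; split=> //; rewrite -cats1 linked_cat /=; split=> [ll|[]//].
  suff tl : tri (last a l) (last a l) (last a l) by [].
  have := ll; rewrite -[l]cats0 linked_cat /= => -[_]; by rewrite cats0.
- split; last by rewrite !last_cat.
  rewrite !linked_cat /=; split=> -[lu [_ [_ lw]]]; do ?split=> //;
    [tri_perm h1|tri_perm h2|tri_perm h1|tri_perm h2].
Qed.

Lemma moves_hom a l l' : moves a l l' -> linked a l ->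
  path_hom a (last a l) (pl a l) (pl a l').
Proof.
have hrefl k : linked a k -> path_hom a (last a k) (pl a k) (pl a k).
  move=> lk; apply: (path_hom_linear (M := (size k)%:R)) => //.
  - exact: pl_coordwise.
  - exact: pl_coordwise.
  - by move=> t s _; rewrite segment_point_id; exact: pl_A.
  - by move=> t t0; rewrite pl_le0.
  - by move=> t tk; rewrite pl_ge_size.
elim=> {l l'} [l|l l' m IH|l l' l'' m IH m' IH'|l|u b b' c w h1 h2] ll.
- exact: hrefl.
- have [[l1 l2] E] := moves_linked m; rewrite -E; apply: path_hom_sym; exact/IH/l2.
- have [[l1 l2] E] := moves_linked m; apply: path_hom_trans (IH ll) _.
  by rewrite E; apply: IH'; exact: l1.
- by rewrite pl_rcons_last; exact: hrefl.
- apply: (path_hom_linear (M := (size (u ++ b :: c :: w))%:R)) => //.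
  + exact: pl_coordwise.
  + exact: pl_coordwise.
  + by move=> t s s01; exact: node_linear.
  + by move=> t t0; rewrite !pl_le0.
  + move=> t tk; rewrite !pl_ge_size ?last_cat//=.
    by move: tk; rewrite !size_cat.
Qed.

(** The combinatorial homotopies of edge paths, which change the number of vertices anywhere in the
    list. They are reduced to [moves] in [insertions_moves]. *)
Inductive insertions : seq (I -> R) -> seq (I -> R) -> Prop :=
| ins_refl l : insertions l l
| ins_sym l l' : insertions l l' -> insertions l' l
| ins_trans l l' l'' : insertions l l' -> insertions l' l'' -> insertions l l''
| ins_dup u x w : tri x x x -> insertions (u ++ x :: w) (u ++ x :: x :: w)
| ins_step u x b c w : tri x b c -> insertions (u ++ x :: c :: w) (u ++ x :: b :: c :: w).

Lemma insertions_cat u w l l' : insertions l l' -> insertions (u ++ l ++ w) (u ++ l' ++ w).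
Proof.
elim=> {l l'} [l|l l' _|l l' l'' _ + _|u' x w' t|u' x b c w' t].
- exact: ins_refl.
- exact: ins_sym.
- exact: ins_trans.
- by rewrite -!catA !cat_cons !(catA u u'); exact: ins_dup.
- by rewrite -!catA !cat_cons !(catA u u'); exact: ins_step.
Qed.

(** A repetition of the last point is pushed back to the end of [u]: given [c :: c], the first copy
    moves to the preceding vertex. *)
Lemma moves_stutter a u w : linked a (u ++ w) -> moves a (u ++ w) (u ++ last a u :: w).
Proof.
elim: w u => [|c w IHw] u; first by rewrite cats0 cats1 => _; exact: moves_pad.
rewrite -cat_rcons => ll; apply: moves_trans (IHw _ ll) _.
rewrite last_rcons !cat_rcons; move: ll; rewrite cat_rcons linked_cat => -[_ [t _]].
by apply: moves_node; [tri_perm t | tri_perm t].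
Qed.

Lemma insertions_moves k k' : insertions k k' -> forall a l, k = a :: l -> linked a l ->
  exists l', [/\ k' = a :: l', moves a l l' & linked a l'].
Proof.
pose lifts k k' := forall a l, k = a :: l -> linked a l -> exists l',
  [/\ k' = a :: l', moves a l l' & linked a l'].
have step u x w w' :
    (forall a v, last a v = x -> linked a (v ++ w) ->
       moves a (v ++ w) (v ++ w') /\ linked a (v ++ w')) ->
    (forall a v, last a v = x -> linked a (v ++ w') -> linked a (v ++ w)) ->
    lifts (u ++ x :: w) (u ++ x :: w') /\ lifts (u ++ x :: w') (u ++ x :: w).
  move=> main back; case: u => [|y u]; split=> a l [<- <-] ll.
  - have [m ll'] := main _ [::] erefl ll; by exists w'.
  - have ll' := back _ [::] erefl ll; exists w; split=> //.
    by apply: moves_sym; have [] := main _ [::] erefl ll'.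
  - rewrite -cat_rcons in ll *; have [|m ll'] := main y (rcons u x) _ ll.
      by rewrite last_rcons.
    by exists (rcons u x ++ w'); split=> //; rewrite cat_rcons.
  - rewrite -cat_rcons in ll *; have lx : last y (rcons u x) = x by rewrite last_rcons.
    have ll' := back _ _ lx ll; exists (rcons u x ++ w); split=> //.
      by rewrite cat_rcons.
    by apply: moves_sym; have [] := main _ _ lx ll'.
move=> ins; suff [] : lifts k k' /\ lifts k' k by [].
elim: ins => {k k'} [k|k k' _ []//|k k' k'' _ [h1 h2] _ [h1' h2']|u x w t|u x b c w t].
- by split=> a l -> ll; exists l; split=> //; exact: moves_refl.
- split=> a l kE ll.
    have [l1 [k'E m1 ll1]] := h1 _ _ kE ll; have [l2 [-> m2 ll2]] := h1' _ _ k'E ll1.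
    by exists l2; split=> //; exact: moves_trans m1 m2.
  have [l1 [k'E m1 ll1]] := h2' _ _ kE ll; have [l2 [-> m2 ll2]] := h2 _ _ k'E ll1.
  by exists l2; split=> //; exact: moves_trans m1 m2.
- apply: step => a v vx ll.
    split; first by rewrite -vx; exact: moves_stutter.
    by move: ll; rewrite !linked_cat /= vx => -[? ?].
  by move: ll; rewrite !linked_cat /= vx => -[? []].
- apply: step => a v vx ll.
    split; last first.
      by move: ll; rewrite !linked_cat /= vx => -[? [_ ?]]; do ?split=> //; tri_perm t.
    apply: moves_trans (moves_stutter ll) _.
    by apply: moves_node; rewrite vx; [tri_perm t | tri_perm t].
  by move: ll; rewrite !linked_cat /= vx => -[? [_ [_ ?]]]; do ?split=> //; tri_perm t.
Qed.

Lemma pl_nth a l j t : (j < size l)%N -> j%:R <= t <= j.+1%:R ->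
  pl a l t = segment_point (nth a (a :: l) j) (nth a l j) (t - j%:R).
Proof.
elim: l a j t => [//|b l IHl] a [|j] t /=.
  by move=> _ t01; rewrite -[LHS]/(pl a (b :: l) t) pl_cons_le1// subr0.
rewrite ltnS -!natr1 => jl jt; have j0 := ler0n R j.
rewrite -[LHS]/(pl a (b :: l) t) pl_cons_ge1; last by move: jt; lra.
rewrite (IHl _ j)//; last by rewrite -natr1; move: jt; lra.
congr segment_point; last by lra.
  by case: j jl {IHl jt j0} => //= j jl; apply: set_nth_default; exact: ltnW.
exact: set_nth_default.
Qed.

End PiecewiseLinear.
End PathHomotopy.

(** * Approximation of loops by edge paths through open stars *)

Section LoopApproximation.
Variables (R : realType) (I : eqType) (A : set {ptws I -> R}).
Implicit Types (a p q : I -> R) (v w : I).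

Lemma clamp01_lip (x y : R) : `|clamp01 x - clamp01 y| <= `|x - y|.
Proof.
wlog xy : x y / x <= y.
  by move=> W; case: (leP x y) => [/W//|/ltW/W]; rewrite distrC (distrC y).
rewrite (ler0_norm (_ : x - y <= 0)) ?subr_le0//.
have [x0|x0] := leP x 0; have [y0|y0] := leP y 0; have [x1|x1] := leP 1 x;
  have [y1|y1] := leP 1 y; try lra;
  rewrite ?(clamp01_le0 x0) ?(clamp01_le0 y0) ?(clamp01_ge1 x1) ?(clamp01_ge1 y1);
  rewrite ?(@clamp01_id _ x) ?(@clamp01_id _ y) ?(ltW x0) ?(ltW y0) ?(ltW x1) ?(ltW y1) //;
  rewrite ler_norml; lra.
Qed.

(** A Lebesgue number for the covering by the open stars, the sets where a given coordinate is
    nonzero. As [g] factors through [clamp01], compactness of [[0, 1]] applies. *)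
Lemma lebesgue_window (g : R -> I -> R) : coordwise g ->
  (forall t, g t = g (clamp01 t)) -> (forall t, exists v, g t v != 0) ->
  exists2 e : R, 0 < e & forall c, exists v, forall t, `|t - c| < e -> g t v != 0.
Proof.
move=> cg gc gnz.
pose P (e c : R) := exists v, forall t, `|t - c| < e -> g t v != 0.
have /compact_near_coveringP/(_ R (0^'+) P) := @segment_compact R 0 1.
have cover (x : R) : `[0, 1]%classic x -> \forall x' \near x & i \near 0^'+, P i x'.
  move=> _; have [v xv] := gnz x.
  have : \forall t \near x, g t v != 0.
    have := cg v x => /(_ [set r | r != 0]); apply.
    by apply: open_nbhs_nbhs; split=> //; exact: open_neq.
  move=> /nbhs_ballP[d /= d0 dP].
  exists (ball x (d / 2), [set e : R | e < d / 2]).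
    split; first by apply: nbhsx_ballx; rewrite divr_gt0.
    by apply: nbhs_right_lt; rewrite divr_gt0.
  move=> [c e] /= [xc ed]; exists v => t tc; apply: dP.
  rewrite /ball /= in xc *.
  have -> : x - t = (x - c) + - (t - c) by rewrite opprB addrA subrK.
  apply: le_lt_trans (ler_normD _ _) _; rewrite normrN.
  by rewrite (splitr d) ltrD// (lt_trans tc).
move=> /(_ _ cover) near_e.
have [e [e0 eP]] : exists e : R, 0 < e /\ `[0, 1]%classic `<=` P e.
  near (0 : R)^'+ => e; exists e; split; first by near: e; exact: nbhs_right_gt.
  by near: e.
exists e => // c.
have [|v vP] := eP (clamp01 c); first by rewrite /= in_itv; exact: clamp01_itv.
exists v => t tc; rewrite gc; apply: vP.
exact: le_lt_trans (clamp01_lip _ _) tc.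
Unshelve. all: by end_near. Qed.

Variable D : set (set (I -> R)).
Hypothesis DA : forall s, D s -> s `<=` A.
Hypothesis D_convex : forall s p q t, D s -> s p -> s q -> 0 <= t <= 1 -> s (segment_point p q t).
Hypothesis A_nz : forall p, A p -> exists v, p v != 0.
Hypothesis star : forall p v w, A p -> p v != 0 -> p w != 0 ->
  tri D p (corner R v) (corner R w).
Local Notation e := (corner R).

Definition span_edge v w := exists p, [/\ A p, p v != 0 & p w != 0].

Hypothesis A_ne : A !=set0.
Hypothesis connected : forall v w, span_edge v v -> span_edge w w ->
  exists (x : nat -> I) n,
  [/\ x 0%N = v, x n = w & forall j, (j < n)%N -> span_edge (x j) (x j.+1)].
Hypothesis contract : forall (x : nat -> I) n, x n = x 0%N ->
  (forall j, (j < n)%N -> span_edge (x j) (x j.+1)) ->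
  insertions D [seq e (x j) | j <- iota 0 n.+1] [:: e (x 0%N)].

Lemma linked_vertices a (x : nat -> I) n b : A a -> a (x 0%N) != 0 ->
  (forall j, (j < n)%N -> span_edge (x j) (x j.+1)) -> A b -> b (x n) != 0 ->
  linked D a (rcons [seq e (x j) | j <- iota 0 n.+1] b).
Proof.
move=> Aa + + Ab; elim: n a x Aa => [|n IHn] a x Aa ax xx bx.
  split; first exact: star.
  split; first by have := star Ab bx bx; case=> s [Ds sb sv _]; exists s.
  by have := star Ab bx bx; case=> s [Ds sb sv _]; exists s.
have -> : [seq e (x j) | j <- iota 0 n.+2] =
    e (x 0%N) :: [seq e ((x \o succn) j) | j <- iota 0 n.+1].
  by rewrite -[iota 0 n.+2]/(0%N :: iota (1 + 0) n.+1) iotaDl map_cons -map_comp.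
rewrite rcons_cons; split; first exact: star.
have [p [Ap px px']] := xx 0%N isT.
have [s [Ds sp sx sx']] := star Ap px px'.
have [_ l1] := IHn p (x \o succn) Ap px' (fun j jn => xx j.+1 jn) bx.
by split=> //; exists s.
Qed.

Lemma contract_based a (x : nat -> I) n : A a -> a (x 0%N) != 0 -> a (x n) != 0 ->
  (forall j, (j < n)%N -> span_edge (x j) (x j.+1)) ->
  insertions D (a :: rcons [seq e (x j) | j <- iota 0 n.+1] a) [:: a; a].
Proof.
move=> Aa ax axn xx; have t0n := star Aa ax axn.
pose y j := if j == n.+1 then x 0%N else x j.
have yx j : (j <= n)%N -> y j = x j by rewrite /y => jn; rewrite ltn_eqF.
have y0 : y 0%N = x 0%N by rewrite yx.
have edges j : (j < n.+1)%N -> span_edge (y j) (y j.+1).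
  rewrite ltnS leq_eqVlt => /orP[/eqP ->|jn].
    by rewrite /y ltn_eqF// eqxx; exists a.
  by rewrite !yx//; [exact: xx | exact: ltnW].
have con : insertions D [seq e (y j) | j <- iota 0 n.+2] [:: e (y 0%N)].
  by apply: contract => //; rewrite {1}/y eqxx.
have E : [seq e (y j) | j <- iota 0 n.+2] = rcons [seq e (x j) | j <- iota 0 n.+1] (e (x 0%N)).
  rewrite -[n.+2]addn1 iotaD map_cat -cats1; congr (_ ++ _); last by rewrite /= /y add0n eqxx.
  by apply/eq_in_map => j; rewrite mem_iota add0n ltnS => /andP[_ /yx ->].
rewrite E y0 in con.
have step1 : insertions D (a :: rcons [seq e (x j) | j <- iota 0 n.+1] a)
    (a :: rcons [seq e (x j) | j <- iota 0 n.+1] (e (x 0%N)) ++ [:: a]).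
  have := @ins_step _ _ D (a :: [seq e (x j) | j <- iota 0 n]) (e (x n)) (e (x 0%N)) a [::].
  rewrite -addn1 iotaD map_cat /= add0n -!cats1 -!catA /=; apply.
  by case: t0n => s [Ds sa s0 sn]; exists s.
apply: ins_trans step1 _.
have := insertions_cat [:: a] [:: a] con => /= step2; apply: ins_trans step2 _.
apply: ins_sym; apply: (@ins_step _ _ D [::] a (e (x 0%N)) a [::]).
by case: t0n => s [Ds sa s0 sn]; exists s.
Qed.

Lemma star_path_connected : @path_connected R {ptws I -> R} A.
Proof.
split=> // a b Aa Ab; have [v av] := A_nz Aa; have [w bw] := A_nz Ab.
have vv : span_edge v v by exists a.
have ww : span_edge w w by exists b.
have [x [n [x0 xn xx]]] := connected vv ww.
have ll : linked D a (rcons [seq e (x j) | j <- iota 0 n.+1] b).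
  by apply: linked_vertices; rewrite ?x0 ?xn.
set l := rcons _ _ in ll.
have sl : 0 <= (size l)%:R :> R by [].
exists (fun t => pl a l ((size l)%:R * t)); split.
- have cm : continuous (fun t : R => (size l)%:R * t).
    by move=> t; apply: cvgM; [exact: cvg_cst | exact: cvg_id].
  apply: continuous_subspaceT; apply: ptws_continuous.
  exact: (coordwise_comp (@pl_coordwise _ _ a l) cm).
- by move=> _ [t _ <-]; exact: (pl_A DA D_convex).
- by rewrite mulr0 pl_le0.
- by rewrite mulr1 pl_ge_size// last_rcons.
Qed.

(** The polygon passes from [x (j - 1)] to [x j] during [[j, j + 1]], which lies in the windows of
    both, so [f t] and this segment share a simplex. The first and the last segment join [a] to
    [x 0] and [x n] to [a], while [f] rests at [a]. *)
Lemma loop_moves (f : R -> I -> R) (n : nat) (x : nat -> I) a : coordwise f ->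
  (forall t, A (f t)) -> (forall t, t <= 1 -> f t = a) ->
  (forall t, n.+1%:R <= t -> f t = a) ->
  (forall (j : nat) t, j%:R <= t <= j.+2%:R -> f t (x j) != 0) ->
  path_hom A a a f (fun=> a).
Proof.
move=> cf Af fa fa' fx.
have Aa : A a by rewrite -(fa 0).
have ax : a (x 0%N) != 0 by rewrite -(fa 1)//; apply: (fx 0%N); rewrite mulr0n ler01 ler1n.
have axn : a (x n) != 0 by rewrite -(fa' n.+1%:R)//; apply: fx; rewrite !ler_nat !leqnSn.
have xx j : span_edge (x j) (x j.+1).
  have le3 : (j.+1 <= j.+3)%N by rewrite -addn2 leq_addr.
  exists (f j.+1%:R); split=> //; apply: fx; rewrite !ler_nat; first by rewrite !leqnSn.
  by rewrite leqnn.
set l := rcons [seq e (x j) | j <- iota 0 n.+1] a.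
have sl : size l = n.+2 by rewrite size_rcons size_map size_iota.
have ll : linked D a l := linked_vertices Aa ax (fun j _ => xx j) Aa axn.
have nthl (j : nat) : (j <= n)%N -> nth a l j = e (x j).
  move=> jn; rewrite nth_rcons size_map size_iota ltnS jn (nth_map 0%N) ?size_iota//.
  by rewrite nth_iota.
have h1 : path_hom A a a f (pl a l).
  apply: (@path_hom_linear _ _ _ _ _ _ _ (n.+2)%:R) => //.
  - exact: pl_coordwise.
  - move=> t s s01.
    have [t0|t0] := leP t 0; first by rewrite fa ?pl_le0// ?segment_point_id// (le_trans t0).
    have [tn|tn] := leP n.+2%:R t.
      rewrite fa' ?pl_ge_size ?sl// ?last_rcons ?segment_point_id//.
      by apply: le_trans tn; rewrite ler_nat.
    have [j jt] : exists j : nat, j%:R <= t < j.+1%:R.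
      by exists (Num.truncn t); rewrite truncn_itv// ltW.
    have jl : (j < size l)%N.
      by rewrite sl -(ltr_nat R); case/andP: jt => jt _; exact: le_lt_trans tn.
    have jt' : j%:R <= t <= j.+1%:R by case/andP: jt => -> /ltW ->.
    rewrite (pl_nth _ jl jt').
    have t01 : 0 <= t - j%:R <= 1 by move: jt'; rewrite -natr1; lra.
    suff [r [Dr r1 r2 r3]] : tri D (f t) (nth a (a :: l) j) (nth a l j).
      by apply: (DA Dr); do 2?apply: D_convex.
    rewrite sl ltnS leq_eqVlt in jl; case/orP: jl => [/eqP jn|jn].
      have -> : f t = a by apply: fa'; move: jt'; rewrite jn => /andP[].
      rewrite jn /= nthl// nth_rcons size_map size_iota ltnn eqxx.
      by have [s' [Ds' sa se _]] := star Aa axn axn; exists s'.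
    case: j jn {jt} jt' {t01} => [|j] jn jt'.
      rewrite -[nth a (a :: l) 0]/a nthl// fa; last by case/andP: jt'.
      by have [s' [Ds' sa se _]] := star Aa ax ax; exists s'.
    rewrite -[nth a (a :: l) j.+1]/(nth a l j) !nthl//; last exact: ltnW.
    apply: star => //; apply: fx; case/andP: jt' => j1 j2.
      by rewrite j2 andbT (le_trans _ j1)// ler_nat.
    by rewrite j1 (le_trans j2)// ler_nat.
  - by move=> t t0; rewrite fa ?pl_le0// (le_trans t0).
  - move=> t tn; rewrite fa' ?pl_ge_size ?sl// ?last_rcons//.
    by apply: le_trans tn; rewrite ler_nat.
apply: path_hom_trans h1 _.
have ins := contract_based Aa ax axn (fun j _ => xx j).
have [l' [[<-] mv _]] := insertions_moves ins erefl ll.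
have := moves_hom DA D_convex mv ll; rewrite last_rcons.
suff -> : pl a [:: a] = fun=> a by [].
by apply/funext => t; apply/funext => i /=; rewrite subrr mul0r add0r.
Qed.

(* A loop is homotopic to a polygon whose vertices are corners v with f t v != 0
   for t in short intervals, since D contains a star around each point. *)
Lemma star_simply_connected : @simply_connected R {ptws I -> R} A.
Proof.
split; first exact: star_path_connected.
move=> g0 cg0 Ag0 g01; pose g t := g0 (clamp01 t).
have gI t : 0 <= t <= 1 -> g t = g0 t by move=> t01; rewrite /g clamp01_id.
have cgp : continuous (g : R -> {ptws I -> R}).
  move=> t W nW; have in01 : `[0, 1]%classic (clamp01 t) by rewrite /= in_itv; exact: clamp01_itv.
  have near_W := proj1 (subspace_continuousP _ _) cg0 _ in01 _ nW.
  have cW : \forall u \near t, `[0, 1]%classic (clamp01 u) -> W (g u).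
    exact: (@clamp01_continuous R t _ near_W).
  suff : \forall u \near t, W (g u) by [].
  near=> u; apply: (near cW u) => //.
  by rewrite /= in_itv; exact: clamp01_itv.
have cg : coordwise g.
  move=> i t; apply: (@continuous_comp _ _ _ (g : R -> {ptws I -> R}) (fun p => p i)); first exact: cgp.
  exact: (@proj_continuous I (fun=> R) i).
have Ag t : A (g t) by apply: Ag0; exists (clamp01 t) => //; rewrite /= in_itv; exact: clamp01_itv.
pose a := g0 0.
have g_le0 t : t <= 0 -> g t = a by move=> t0; rewrite /g clamp01_le0.
have g_ge1 t : 1 <= t -> g t = a by move=> t1; rewrite /g clamp01_ge1.
have [|t|d d0 dP] := lebesgue_window cg; first by move=> t; rewrite /g (clamp01_id (clamp01_itv t)).
  exact: A_nz.
have [n [n0 nd]] : exists n : nat, (0 < n)%N /\ n%:R^-1 < d.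
  exists (Num.truncn d^-1).+1; split=> //.
  have dV0 : 0 < d^-1 by rewrite invr_gt0.
  have dn : d^-1 < (Num.truncn d^-1).+1%:R by case/andP: (truncn_itv (ltW dV0)).
  by rewrite -[ltRHS]invrK ltf_pV2// posrE ltr0n.
have n0R : 0 < n%:R :> R by rewrite ltr0n.
have [x xP] := choice (fun j : nat => dP (j%:R / n%:R)).
(* The shift by 1 provides the initial rest. The window [[j, j + 2]] becomes the set of parameters
   of [g] within [1 / n] of [j / n]. *)
pose f t := g ((t - 1) / n%:R).
have cphi : continuous (fun t : R => (t - 1) / n%:R).
  by move=> t; apply: cvgM; [apply: cvgB; [exact: cvg_id|exact: cvg_cst] | exact: cvg_cst].
have cf : coordwise f by exact: (coordwise_comp cg cphi).
have fa t : t <= 1 -> f t = a.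
  by move=> t1; apply: g_le0; rewrite mulr_le0_ge0 ?invr_ge0 ?ler0n// subr_le0.
have fa' t : n.+1%:R <= t -> f t = a.
  by move=> t1; apply: g_ge1; rewrite ler_pdivlMr// mul1r; move: t1; rewrite -natr1; lra.
have [|j t|M [h [ch Ah h0 h1 hab]]] := loop_moves (x := x) cf _ fa fa'; first by move=> t; exact: Ag.
  move=> jt; apply: xP; apply: le_lt_trans nd.
  rewrite -mulrBl normrM [`|n%:R^-1|]gtr0_norm ?invr_gt0// ler_pdivrMr// mulVf ?gt_eqF//.
  by rewrite ler_norml; move: jt; rewrite -2!natr1; lra.
pose M' := Order.max M n.+1%:R.
have M'M : M <= M' by rewrite le_max lexx.
have M'n : n.+1%:R <= M' by rewrite le_max lexx orbT.
have M'0 : 0 <= M' by apply: le_trans M'n.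
pose u (s : R) := clamp01 (2 * s); pose v (s : R) := clamp01 (2 * s - 1).
(* In the first half of the square [g] is deformed into [f] by interpolating between the time
   scales; in the second half [h] contracts [f]. The middle loop is subtracted as in
   [path_hom_trans]. *)
pose phi (st : R * R) := (1 - u st.1) * st.2 + u st.1 * ((M' * st.2 - 1) / n%:R).
pose w st i := g (phi st) i + h (v st.1, M' * st.2) i - f (M' * st.2) i.
have wE s t : w (s, t) = if s <= 1 / 2 then g (phi (s, t)) else h (v s, M' * t).
  apply/funext => i; rewrite /w /=; case: leP => s2.
    by rewrite {1}/v clamp01_le0 ?h0 ?addrK//; lra.
  have -> : phi (s, t) = (M' * t - 1) / n%:R.
    by rewrite /phi /= {1 2}/u clamp01_ge1 ?subrr ?mul0r ?mul1r ?add0r//; lra.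
  by rewrite -/(f (M' * t)) addrC addKr.
have c2 : continuous (fun s : R => 2 * s).
  by move=> s; apply: cvgM; [exact: cvg_cst | exact: cvg_id].
have cu : continuous (fun st : R * R => u st.1).
  move=> st; apply: (@continuous_comp _ _ _ fst u); first exact: cvg_fst.
  by apply: (@continuous_comp R R R (fun s => 2 * s) (@clamp01 R)); [exact: c2 | exact: clamp01_continuous].
have cv : continuous (fun st : R * R => v st.1).
  move=> st; apply: (@continuous_comp _ _ _ fst v); first exact: cvg_fst.
  apply: (@continuous_comp R R R (fun s => 2 * s - 1) (@clamp01 R)); last exact: clamp01_continuous.
  by apply: cvgB; [exact: c2 | exact: cvg_cst].
have cM : continuous (fun st : R * R => M' * st.2).
  by move=> st; apply: cvgM; [exact: cvg_cst | exact: cvg_snd].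
have cp : continuous phi.
  move=> st; apply: cvgD; apply: cvgM.
  - by apply: cvgB; [exact: cvg_cst | exact: cu].
  - exact: cvg_snd.
  - exact: cu.
  - by apply: cvgM; [apply: cvgB; [exact: cM | exact: cvg_cst] | exact: cvg_cst].
have cw : coordwise w.
  move=> i st; apply: cvgB; last exact: (coordwise_comp cf cM).
  apply: cvgD; first exact: (coordwise_comp cg cp).
  by apply: (coordwise_comp ch (continuous_pair cv cM)).
exists w; split.
- by apply: continuous_subspaceT; exact: ptws_continuous.
- by move=> _ [[s t] _ <-]; rewrite wE; case: ifP => _; [exact: Ag | exact: Ah].
- move=> t t01; rewrite wE ifT ?divr_ge0// /phi /= /u mulr0 clamp01_le0//.
  by rewrite subr0 mul1r mul0r addr0 gI.
- move=> t t01; rewrite wE ifF; first by rewrite /v clamp01_ge1 ?h1//; lra.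
  by apply/negbTE; rewrite -ltNge; lra.
- move=> s s01; rewrite !wE /phi /= !mulr0 !mulr1 add0r.
  have /andP[u0 u1] : 0 <= u s <= 1 by exact: clamp01_itv.
  split; case: ifP => _.
  + by apply: g_le0; rewrite mulr_ge0_le0// sub0r mulN1r oppr_le0 invr_ge0 ler0n.
  + by have [-> //] := hab (v s) 0.
  + apply: g_ge1; have : 1 <= (M' - 1) / n%:R.
      by rewrite ler_pdivlMr// mul1r; move: M'n; rewrite -natr1; lra.
    by move=> ge1; have := ler_wpM2l u0 ge1; lra.
  + by have [_ ->] := hab (v s) M'.
Unshelve. all: by end_near. Qed.

End LoopApproximation.

(** * Triangulation of the polygonal complex by cones *)

Section Polygons.
Variables (R : realType) (X : graph) (k : nat).
Local Notation V := (X + set (seq X))%type.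
Local Notation A := (@polygonal_complex R X k : set (V -> R)).
Local Notation e := (@corner R V).
Implicit Types (x y u : X) (s : seq X) (i j l v w : V) (p : V -> R).

Definition simplex i j l : set (V -> R) := [set p | exists a b c : R,
  [/\ 0 <= a, 0 <= b, 0 <= c, a + b + c = 1 &
      p = fun m => a * e i m + b * e j m + c * e l m]].

(** An edge is a triangle with a repeated vertex, so that edges and sectors of polygons are treated
    alike. *)
Variant complex_simplex : V -> V -> V -> Prop :=
| edge_simplex x y : lazy (@adj X) x y -> complex_simplex (inl x) (inl y) (inl y)
| polygon_simplex s u : simple_loop s -> (size s <= k)%N -> u \in s ->
    complex_simplex (inr (cyclic_class s)) (inl u) (inl (next s u)).

Definition simplices : set (set (V -> R)) :=
  [set s | exists i j l, complex_simplex i j l /\ s = simplex i j l].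

Local Notation D := simplices.

Lemma simplices_sub (s : set (V -> R)) : D s -> s `<=` A.
Proof.
move=> [i [j [l [ijl ->]]]] p [a [b [c [a0 b0 c0 abc ->]]]].
case: ijl => [x y xy|t u tl tk tu].
  left; exists x, y, (b + c); split.
  - by case/orP: xy => [/eqP|]; [left|right].
  - by apply/andP; split; lra.
  - have -> : a = 1 - (b + c) by lra.
    by apply/funext => m; rewrite /edge_point /segment_point; ring.
right; have [bc|bc] := eqVneq (b + c) 0.
  exists t, u, 0, 0; split; rewrite ?lexx ?ler01 ?tl//.
  apply/funext => m; rewrite /segment_point /edge_point /segment_point.
  have [-> ->] : b = 0 /\ c = 0 by split; lra.
  have -> : a = 1 by lra.
  by ring.
exists t, u, (c / (b + c)), (b + c); split; rewrite ?tl//.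
- by rewrite divr_ge0 ?addr_ge0//= ler_pdivrMr ?mul1r ?lerDr// lt_def bc addr_ge0.
- by apply/andP; split; lra.
- have -> : a = 1 - (b + c) by lra.
  by apply/funext => m; rewrite /segment_point /edge_point /segment_point; field.
Qed.

Lemma complex_simplex_ex p : A p -> exists2 s, D s & s p.
Proof.
case=> [[x [y [t [xy /andP[t0 t1] ->]]]]|[s [u [t [c [/andP[sl sk] us /andP[t0 t1] /andP[c0 c1] ->]]]]]].
  exists (simplex (inl x) (inl y) (inl y)).
    exists (inl x), (inl y), (inl y); split=> //; constructor.
    by case: xy => [->|xy]; rewrite /lazy /= ?eqxx ?xy ?orbT.
  exists (1 - t), t, 0; split=> //; rewrite ?subr_ge0//; first by rewrite addr0 subrK.
  by apply/funext => m; rewrite mul0r addr0.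
exists (simplex (inr (cyclic_class s)) (inl u) (inl (next s u))).
  by exists (inr (cyclic_class s)), (inl u), (inl (next s u)); split=> //; constructor.
exists (1 - c), (c * (1 - t)), (c * t); split; rewrite ?mulr_ge0 ?subr_ge0//.
  by rewrite -addrA -mulrDr subrK mulr1 subrK.
by apply/funext => m; rewrite /segment_point /edge_point /segment_point mulrDr !mulrA addrA.
Qed.

Lemma simplices_convex (s : set (V -> R)) p q t : D s -> s p -> s q -> 0 <= t <= 1 ->
  s (segment_point p q t).
Proof.
move=> [i [j [l [_ ->]]]] [a [b [c [a0 b0 c0 abc ->]]]] [a' [b' [c' [a0' b0' c0' abc' ->]]]].
move=> /andP[t0 t1]; have t1' : 0 <= 1 - t by rewrite subr_ge0.
exists ((1 - t) * a + t * a'), ((1 - t) * b + t * b'), ((1 - t) * c + t * c').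
split; rewrite ?addr_ge0 ?mulr_ge0//.
  transitivity ((1 - t) * (a + b + c) + t * (a' + b' + c')); first by ring.
  by rewrite abc abc' !mulr1 subrK.
by apply/funext => m; rewrite /segment_point; ring.
Qed.

Lemma simplex_corner i j l v : [\/ v = i, v = j | v = l] -> simplex i j l (e v).
Proof.
case=> ->; [exists 1, 0, 0 | exists 0, 1, 0 | exists 0, 0, 1]; split=> //;
  rewrite ?ler01 ?addr0 ?add0r//; apply/funext => m; by rewrite mul1r !mul0r ?addr0 ?add0r.
Qed.

Lemma simplex_support i j l p v : simplex i j l p -> p v != 0 -> [\/ v = i, v = j | v = l].
Proof.
move=> [a [b [c [_ _ _ _ ->]]]]; rewrite /corner.
have [->|vi] := eqVneq v i; first by constructor 1.
have [->|vj] := eqVneq v j; first by constructor 2.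
have [->|vl] := eqVneq v l; first by constructor 3.
by rewrite !mulr0 !addr0 eqxx.
Qed.

(** Every simplex containing [p] has among its vertices all those where [p] is nonzero. *)
Lemma complex_star p v w : A p -> p v != 0 -> p w != 0 -> tri D p (e v) (e w).
Proof.
move=> /complex_simplex_ex[s Ds sp] pv pw; exists s; split=> //.
  by case: Ds sp => i [j [l [_ ->]]] /simplex_support => /(_ _ pv) /simplex_corner.
by case: Ds sp => i [j [l [_ ->]]] /simplex_support => /(_ _ pw) /simplex_corner.
Qed.

Lemma complex_nz p : A p -> exists v, p v != 0.
Proof.
move=> /complex_simplex_ex[_ [i [j [l [_ ->]]]] [a [b [c [a0 b0 c0 abc ->]]]]].
have le m : a * (m == i)%:R + b * (m == j)%:R + c * (m == l)%:R >= 0 :> R.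
  by rewrite !addr_ge0 ?mulr_ge0 ?ler0n.
apply: contrapT => nz; have z m : a * (m == i)%:R + b * (m == j)%:R + c * (m == l)%:R = 0 :> R.
  by apply/eqP/negPn/negP => nm; apply: nz; exists m.
have bn m n : 0 <= (m == n :> V)%:R :> R by exact: ler0n.
have a1 : a <= 0.
  rewrite -(z i) eqxx mulr1 -addrA lerDl addr_ge0 ?mulr_ge0//.
have b1 : b <= 0.
  by rewrite -(z j) eqxx mulr1 addrAC lerDr addr_ge0 ?mulr_ge0.
have c1 : c <= 0 by rewrite -(z l) eqxx mulr1 lerDr addr_ge0 ?mulr_ge0.
lra.
Qed.

Lemma tri_corner i j l (u v w : V) : complex_simplex i j l ->
  [\/ u = i, u = j | u = l] -> [\/ v = i, v = j | v = l] -> [\/ w = i, w = j | w = l] ->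
  tri D (e u) (e v) (e w).
Proof.
move=> ijl ui vi wi; exists (simplex i j l).
by split; [exists i, j, l|exact: simplex_corner..].
Qed.

Local Notation vspan := (span_edge A).

Lemma span_simplex v w : vspan v w -> exists i j l,
  [/\ complex_simplex i j l, [\/ v = i, v = j | v = l] & [\/ w = i, w = j | w = l]].
Proof.
move=> [p [/complex_simplex_ex[_ [i [j [l [ijl ->]]]] sp] pv pw]]; exists i, j, l.
by split=> //; exact: simplex_support sp _.
Qed.

Lemma simplex_span i j l v w : complex_simplex i j l ->
  [\/ v = i, v = j | v = l] -> [\/ w = i, w = j | w = l] -> vspan v w.
Proof.
move=> ijl vi wi; exists (segment_point (e v) (e w) (2^-1)).
have half : 1 - 2^-1 = 2^-1 :> R by lra.
have h0 : 0 < 2^-1 :> R by rewrite invr_gt0.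
have nz (a b : bool) : a || b -> 2^-1 * a%:R + 2^-1 * b%:R != 0 :> R.
  by case: a b => [] [] // _; rewrite ?mulr0 ?addr0 ?add0r; apply: lt0r_neq0; rewrite !mulr1 ?addr_gt0.
split.
- have Ds : D (simplex i j l) by exists i, j, l.
  apply: (simplices_sub Ds); apply: simplices_convex => //.
  + exact: simplex_corner.
  + exact: simplex_corner.
  + by apply/andP; split; lra.
- by rewrite /segment_point half /corner eqxx nz.
- by rewrite /segment_point half /corner eqxx nz ?orbT.
Qed.

End Polygons.

Section PolygonLoops.
Variables (R : realType) (X : graph) (k : nat).
Local Notation V := (X + set (seq X))%type.
Local Notation A := (@polygonal_complex R X k : set (V -> R)).
Local Notation e := (@corner R V).
Local Notation D := (@simplices R X k).
Local Notation adjl := (lazy (@adj X)).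
Implicit Types (x y z : X) (r s q : seq X) (v w : V) (l : seq V).

Definition vins l l' := insertions D (map e l) (map e l').

Lemma vins_refl l : vins l l. Proof. exact: ins_refl. Qed.
Lemma vins_sym l l' : vins l l' -> vins l' l. Proof. exact: ins_sym. Qed.
Lemma vins_trans l l' l'' : vins l l' -> vins l' l'' -> vins l l''.
Proof. exact: ins_trans. Qed.
Lemma vins_cat (u w : seq V) l l' : vins l l' -> vins (u ++ l ++ w) (u ++ l' ++ w).
Proof. by rewrite /vins !map_cat; exact: insertions_cat. Qed.
Lemma vins_catl (u : seq V) l l' : vins l l' -> vins (u ++ l) (u ++ l').
Proof. by move/(vins_cat u [::]); rewrite !cats0. Qed.
Lemma vins_catr (w : seq V) l l' : vins l l' -> vins (l ++ w) (l' ++ w).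
Proof. exact: (vins_cat [::] w). Qed.
Lemma vins_cons v l l' : vins l l' -> vins (v :: l) (v :: l').
Proof. exact: (@vins_catl [:: v]). Qed.

Definition tri3 v w (u : V) := tri D (e v) (e w) (e u).

Lemma vins_mid v w (u : V) l : tri3 v w u -> vins (v :: w :: u :: l) (v :: u :: l).
Proof. by move=> t; apply: vins_sym; exact: (@ins_step _ _ D [::] (e v) (e w) (e u) (map e l)). Qed.

Lemma vins_dup v l : tri3 v v v -> vins (v :: v :: l) (v :: l).
Proof. by move=> t; apply: vins_sym; exact: (@ins_dup _ _ D [::] (e v) (map e l)). Qed.

Lemma tri3_edge x y v w (u : V) : adjl x y ->
  v = inl x \/ v = inl y -> w = inl x \/ w = inl y -> u = inl x \/ u = inl y -> tri3 v w u.
Proof.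
move=> xy V W U; apply: (tri_corner R (edge_simplex k xy)).
- by case: V; [constructor 1 | constructor 2].
- by case: W; [constructor 1 | constructor 2].
- by case: U; [constructor 1 | constructor 2].
Qed.

Lemma tri3_id x : tri3 (inl x) (inl x) (inl x).
Proof. by apply: (tri3_edge (lazy_refl (@adj X) x)); left. Qed.

Lemma lazy_sym x y : adjl x y -> adjl y x.
Proof. by rewrite /lazy /= eq_sym adj_sym. Qed.

Lemma vins_back x s : path adjl x s ->
  vins (map inl (x :: s ++ rev (belast x s))) [:: inl x].
Proof.
elim: s x => [|y s IHs] x /=; first by move=> _; exact: vins_refl.
move=> /andP[xy /IHs ys]; rewrite rev_cons -cats1 catA.
have := vins_cat [:: inl x] [:: inl x] ys.
rewrite /= => h; rewrite (map_cat _ _ [:: x]); apply: vins_trans h _.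
apply: vins_trans (vins_mid _ _) _.
  by apply: (tri3_edge xy); auto.
by apply: vins_dup; exact: tri3_id.
Qed.

Section Cone.
Variables (s : seq X).
Hypotheses (sl : simple_loop s) (sk : (size s <= k)%N).
Local Notation c := (inr (cyclic_class s) : V).

Definition side : rel X := [rel x y | (x \in s) && (y == next s x)].

Lemma side_tri x y v w (u : V) : side x y ->
  [\/ v = c, v = inl x | v = inl y] -> [\/ w = c, w = inl x | w = inl y] ->
  [\/ u = c, u = inl x | u = inl y] -> tri3 v w u.
Proof. by move=> /andP[xs /eqP ->]; exact: (tri_corner R (polygon_simplex sl sk xs)). Qed.

Lemma cone_left x q : path side x q -> vins (c :: map inl (x :: q)) [:: c; inl (last x q)].
Proof.
elim: q x => [|y q IHq] x /=; first by move=> _; exact: vins_refl.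
move=> /andP[xy yq]; apply: vins_trans (IHq _ yq).
by apply: vins_mid; apply: (side_tri xy); [constructor 1|constructor 2|constructor 3].
Qed.

Lemma cone_right x q : path side x q -> x \in s ->
  vins (map inl (x :: q) ++ [:: c]) [:: inl x; c].
Proof.
elim: q x => [|y q IHq] x /=; first by move=> _ _; exact: vins_refl.
move=> /andP[xy yq] xs; have ys : y \in s by case/andP: xy => _ /eqP ->; rewrite mem_next.
apply: vins_trans (vins_cons _ (IHq _ yq ys)) _.
by apply: vins_mid; apply: (side_tri xy); [constructor 2|constructor 3|constructor 1].
Qed.

Lemma uniq_loop : uniq s. Proof. by case/andP: sl => _ /andP[]. Qed.

Lemma side_lazy x y : side x y -> adjl x y.
Proof.
move=> /andP[xs /eqP ->]; apply/orP; right.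
by case/andP: sl => _ /andP[cs _]; exact: next_cycle.
Qed.

Lemma side_path x y : x \in s -> y \in s -> exists2 q, path side x q & last x q = y.
Proof.
move=> xs ys; have [i q sE] := rot_to xs.
have cq : fcycle (next s) (x :: q).
  by rewrite -sE rot_cycle; apply: cycle_next; exact: uniq_loop.
have qs z : z \in x :: q -> z \in s by rewrite -sE mem_rot.
have pq : path side x q.
  have : path (frel (next s)) x q by move: cq; rewrite /= rcons_path => /andP[].
  have sub : {in x :: q &, subrel (frel (next s)) side}.
    by move=> a b /qs aq bq /= /eqP <-; rewrite /side /= eqxx andbT.
  by apply: (sub_in_path sub); apply/allP.
have : y \in x :: q by rewrite -sE mem_rot.
move=> yq; case/splitPl: yq pq => q1 q2 <-; rewrite cat_path => /andP[pq1 _].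
by exists q1.
Qed.

End Cone.

(** The centre is inserted after [x], the rest of the loop is swept across the cone, and the centre
    is removed again. *)
Lemma null_simple x r : path adjl x r -> last x r = x -> uniq r -> (2 < size r)%N ->
  (size r <= k)%N -> vins (map inl (x :: r)) [:: inl x].
Proof.
case: r => [//|y r] /= /andP[xy yr] rx ur sr rk.
have strict : path (@adj X) y r /\ adj x y.
  split; last first.
    case/orP: xy => [/eqP xy|//]; case: r rx ur sr {yr rk} => [//|z r] /= rx.
    by rewrite -xy -[X in X \notin _]rx mem_last.
  elim: r y yr ur {xy rx sr rk} => [//|z r IHr] y /= /andP[yz zr] /andP[yr ur].
  rewrite IHr// andbT; case/orP: yz => [/eqP yz|//].
  by rewrite yz inE eqxx in yr.
have sl : simple_loop (y :: r).
  rewrite /simple_loop /= sr /ucycleb /= ur andbT rcons_path.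
  by case: strict => -> /=; rewrite rx.
have pq : path (side (y :: r)) x (y :: r).
  have : fcycle (next (y :: r)) (y :: r) by exact: cycle_next.
  rewrite /= rcons_path rx => /andP[pr xyE]; apply/andP; split.
    by rewrite /side /= -{1}rx mem_last eq_sym.
  have sub : {in y :: r &, subrel (frel (next (y :: r))) (side (y :: r))}.
    by move=> a b aq bq /eqP <-; rewrite /side /= eqxx andbT.
  by apply: (sub_in_path sub _ pr); apply/allP.
set c := inr (cyclic_class (y :: r)) : V.
have xs : x \in y :: r by rewrite -rx mem_last.
have xy' : side (y :: r) x y by case/andP: pq.
have t v w (u : V) : [\/ v = c, v = inl x | v = inl y] -> [\/ w = c, w = inl x | w = inl y] ->
  [\/ u = c, u = inl x | u = inl y] -> tri3 v w u by exact: (side_tri sl rk xy').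
apply: vins_trans (vins_sym (vins_mid _ (t (inl x) c (inl y) _ _ _))) _;
  [by constructor 2|by constructor 1|by constructor 3|].
have yr' : path (side (y :: r)) y r by case/andP: pq.
have := cone_left sl rk yr'; rewrite rx => /(vins_cons (inl x)) h.
apply: vins_trans h _; apply: vins_trans (vins_mid _ (t (inl x) c (inl x) _ _ _)) _;
  [by constructor 2|by constructor 1|by constructor 2|].
by apply: vins_dup; exact: tri3_id.
Qed.

Lemma not_uniq_split r : ~~ uniq r -> exists y r1 r2 r3, r = r1 ++ y :: r2 ++ y :: r3.
Proof.
elim: r => [//|x r IHr] /=; rewrite negb_and negbK => /orP[xr|/IHr[y [r1 [r2 [r3 ->]]]]].
  by case/splitPr: xr => r2 r3; exists x, [::], r2, r3.
by exists y, (x :: r1), r2, r3.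
Qed.

(** By induction on the length, a loop is cut at a repeated vertex. Without repetition it is
    constant or a backtracking of length at most 2, or it bounds a 2-cell. *)
Lemma null_loop x r : path adjl x r -> last x r = x -> (size r <= k)%N ->
  vins (map inl (x :: r)) [:: inl x].
Proof.
have [n] := ubnP (size r); elim: n x r => [//|n IHn] x r; rewrite ltnS => rn xr rx rk.
have [ur|] := boolP (uniq r); last first.
  move=> /not_uniq_split[y [r1 [r2 [r3 rE]]]].
  have sr : size r = (size r1 + (size r2 + (size r3).+1).+1)%N.
    by rewrite rE size_cat /= size_cat.
  move: xr; rewrite rE cat_path /= cat_path /= => /and5P[xr1 r1y yr2 r2y yr3].
  have loop : vins (map inl (y :: rcons r2 y)) [:: inl y].
    have lt : (size (rcons r2 y) < size r)%N.
      by rewrite size_rcons sr addnS ltnS (leq_trans _ (leq_addl _ _))// -addSnnS leq_addr.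
    apply: IHn; rewrite ?last_rcons ?rcons_path ?yr2//.
      exact: leq_trans lt rn.
    exact: leq_trans (ltnW lt) rk.
  have h : vins (map inl (x :: r1 ++ y :: r2 ++ y :: r3)) (map inl (x :: r1 ++ y :: r3)).
    have -> : x :: r1 ++ y :: r2 ++ y :: r3 = (x :: r1) ++ (y :: rcons r2 y) ++ r3.
      by rewrite /= cat_rcons.
    have -> : x :: r1 ++ y :: r3 = (x :: r1) ++ [:: y] ++ r3 by [].
    rewrite !(map_cat _ (x :: r1)) !(map_cat _ _ r3).
    exact: (vins_cat (map inl (x :: r1)) (map inl r3) loop).
  apply: vins_trans h _.
  have lt : (size (r1 ++ y :: r3) < size r)%N.
    by rewrite size_cat /= sr ltn_add2l ltnS leq_addl.
  apply: IHn.
  - exact: leq_trans lt rn.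
  - by rewrite cat_path xr1 /= r1y yr3.
  - by move: rx; rewrite rE !last_cat /= last_cat.
  - exact: leq_trans (ltnW lt) rk.
have [sr|sr] := ltnP 2 (size r); first exact: null_simple.
case: r sr rx xr {rn rk ur} => [|y [|z [|]]] //=.
- by move=> _ _ _; exact: vins_refl.
- by move=> _ -> _; apply: vins_dup; exact: tri3_id.
- move=> _ -> /and3P[xy yx _]; apply: vins_trans (vins_mid _ _) _.
    by apply: (tri3_edge xy); auto.
  by apply: vins_dup; exact: tri3_id.
Qed.

Lemma path_rev_lazy x s : path adjl x s -> path adjl (last x s) (rev (belast x s)).
Proof.
rewrite -rev_path => h; apply: sub_path h => y z /=; exact: lazy_sym.
Qed.

Lemma last_rev_belast x s : last (last x s) (rev (belast x s)) = x.
Proof. by case: s => [//|y s] /=; rewrite rev_cons last_rcons. Qed.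

Lemma homotopic_vins r s : homotopic (@adj X) k r s -> vins (map inl r) (map inl s).
Proof.
elim=> {r s} [r|r s _|r s t _ + _|u v x s t xs xt st stk].
- exact: vins_refl.
- exact: vins_sym.
- exact: vins_trans.
- rewrite !map_cat; apply: vins_catl; rewrite -!cat_cons !map_cat; apply: vins_catr.
  (* The path [s] and its reverse are inserted before [t]; after [s] there remains a loop of length
     at most [k]. *)
  apply: vins_sym; apply: (@vins_trans _ (map inl ((x :: s ++ rev (belast x s)) ++ t))).
    rewrite map_cat; have := vins_catr (map inl t) (vins_back xs).
    exact: vins_sym.
  have loop : vins (map inl (last x s :: rev (belast x s) ++ t)) [:: inl (last x s)].
    apply: null_loop.
    - by rewrite cat_path path_rev_lazy//= last_rev_belast.
    - by rewrite last_cat last_rev_belast.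
    - by rewrite size_cat size_rev size_belast.
  have := vins_catl (map inl (belast x s)) loop.
  have -> : map inl (belast x s) ++ [:: inl (last x s)] = map inl (x :: s) :> seq V.
    by rewrite (lastI x s) map_rcons cats1.
  rewrite -map_cat -cat_rcons -(lastI x s).
  by rewrite catA.
Qed.

End PolygonLoops.

Section SimplyConnectedComplex.
Variables (R : realType) (X : graph) (k : nat).
Local Notation V := (X + set (seq X))%type.
Local Notation A := (@polygonal_complex R X k : set (V -> R)).
Local Notation e := (@corner R V).
Local Notation D := (@simplices R X k).
Local Notation vspan := (span_edge A).
Local Notation adjl := (lazy (@adj X)).
Local Notation vins := (@vins R X k).
Local Notation tri3 := (@tri3 R X k).
Implicit Types (x y z : X) (r s q : seq X) (v w : V) (l : seq V).

(** Moves the centre of a polygon to a vertex of its boundary, in order to push edge paths of the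
    complex into [X]. *)
Definition anchoring (a : V -> X) := (forall x, a (inl x) = x) /\
  forall s, simple_loop s -> a (inr (cyclic_class s)) \in s.

Lemma anchoring_ex : exists a, anchoring a.
Proof.
have [x0] := graph_inhabited X.
have ex v : exists x, (forall y, v = inl y -> x = y) /\
    forall s, simple_loop s -> v = inr (cyclic_class s) -> x \in s.
  case: v => [y|c]; first by exists y; split=> // z [].
  have [[s [sl cs]]|ns] := pselect (exists s, simple_loop s /\ c = cyclic_class s); last first.
    by exists x0; split=> // s sl [cs]; case: ns; exists s.
  case: s sl cs => [//|y s] sl cs; exists y; split=> // s' sl' [cs'].
  have : cyclic_class s' s' by exists 0%N; rewrite rot0.
  by rewrite -cs' cs => -[n ->]; rewrite mem_rot inE eqxx.
have [a aP] := choice ex; exists a; split=> [x|s sl].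
  by have [+ _] := aP (inl x); apply.
by have [_] := aP (inr (cyclic_class s)); apply.
Qed.

Variable a : V -> X.
Hypothesis aP : anchoring a.

Lemma tri3_perm v w (u : V) : tri3 v w u ->
  [/\ tri3 w v u, tri3 v v v, tri3 w w w & tri3 w v w].
Proof. by move=> [s [Ds sv sw su]]; split; exists s. Qed.

Lemma side_self s y : simple_loop s -> y \in s -> side s y (next s y).
Proof. by move=> sl ys; rewrite /side /= ys eqxx. Qed.

Lemma anchor_tri v : vspan v v -> tri3 v (inl (a v)) v.
Proof.
move=> /span_simplex[i [j [l [ijl vi _]]]].
case: ijl vi => [x y xy|s u sl sk us] vi.
  have [z [-> zE]] : exists z, v = inl z /\ (z = x \/ z = y).
    by case: vi => ->; [exists x|exists y|exists y]; auto.
  by rewrite (proj1 aP); exact: tri3_id.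
have [->|[z [zs ->]]] : v = inr (cyclic_class s) \/ exists z, z \in s /\ v = inl z.
  by case: vi => ->; [left|right; exists u|right; exists (next s u); rewrite mem_next].
  apply: (side_tri R sl sk (side_self sl (proj2 aP _ sl))); by [constructor 1|constructor 2|constructor 1].
by rewrite (proj1 aP); exact: tri3_id.
Qed.

Lemma vins_last (l : seq V) v : tri3 v v v -> vins (l ++ [:: v; v]) (l ++ [:: v]).
Proof. by move=> t; apply: vins_catl; exact: vins_dup. Qed.

Lemma anchor_edge v w : vspan v w -> exists q,
  [/\ path adjl (a v) q, last (a v) q = a w &
      vins [:: v; w] (v :: map inl (a v :: q) ++ [:: w])].
Proof.
have inlP x y : adjl x y -> exists q, [/\ path adjl (a (inl x)) q,
    last (a (inl x)) q = a (inl y) &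
    vins [:: inl x; inl y] (inl x :: map inl (a (inl x) :: q) ++ [:: inl y])].
  move=> xy; exists [:: y]; rewrite !(proj1 aP) /= andbT; split=> //; apply: vins_sym.
  apply: vins_trans (vins_dup _ (tri3_id R k x)) _.
  by apply: vins_cons; apply: vins_dup; exact: tri3_id.
move=> /span_simplex[i [j [l [ijl vi wi]]]].
case: ijl vi wi => [x y xy|s u sl sk us] vi wi.
  have yx := lazy_sym xy.
  by case: vi => ->; case: wi => ->; apply: inlP => //; exact: lazy_refl.
set c := inr (cyclic_class s) : V in vi wi.
have acs : a c \in s by exact: (proj2 aP).
have uu' : adjl u (next s u) := side_lazy sl (side_self sl us).
have u'u := lazy_sym uu'; have u's : next s u \in s by rewrite mem_next.
have pathl x q : path (side s) x q -> path adjl x q.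
  by apply: sub_path => y z; exact: side_lazy.
have cy y : y \in s -> exists q, [/\ path adjl (a c) q, last (a c) q = a (inl y) &
    vins [:: c; inl y] (c :: map inl (a c :: q) ++ [:: inl y])].
  move=> ys; have [q pq qy] := side_path sl acs ys.
  exists q; rewrite (proj1 aP); split=> //; first exact: pathl.
  apply: vins_sym; have h := cone_left R sl sk pq; rewrite qy in h.
  rewrite -cat_cons; apply: (vins_trans (vins_catr _ h)).
  exact: (vins_last [:: c] (tri3_id R k y)).
have yc y : y \in s -> exists q, [/\ path adjl (a (inl y)) q, last (a (inl y)) q = a c &
    vins [:: inl y; c] (inl y :: map inl (a (inl y) :: q) ++ [:: c])].
  move=> ys; have [q pq qy] := side_path sl ys acs; rewrite (proj1 aP).
  exists q; split=> //; first exact: pathl.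
  apply: vins_sym; apply: vins_trans (vins_cons _ (cone_right R sl sk pq ys)) _.
  by apply: vins_dup; exact: tri3_id.
have cc : exists q, [/\ path adjl (a c) q, last (a c) q = a c &
    vins [:: c; c] (c :: map inl (a c :: q) ++ [:: c])].
  exists [::]; split=> //; apply: vins_sym; apply: vins_mid.
  apply: (side_tri R sl sk (side_self sl acs)); by [constructor 1|constructor 2|constructor 1].
case: vi => ->; case: wi => -> //; first [exact: cy|exact: yc|apply: inlP => //; exact: lazy_refl].
Qed.

Definition vrel : rel V := [rel v w | `[< vspan v w >]].

Lemma anchor_path v l : vspan v v -> path vrel v l -> exists q,
  [/\ path adjl (a v) q, last (a v) q = a (last v l) &
      vins (v :: l) (v :: map inl (a v :: q) ++ [:: last v l])].
Proof.
elim: l v => [|w l IHl] v vv /=.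
  move=> _; exists [::]; split=> //; apply: vins_sym.
  have t := anchor_tri vv; apply: vins_trans (vins_mid _ t) _.
  by apply: vins_dup; case: (tri3_perm t).
move=> /andP[/asboolP vw wl].
have ww : vspan w w by case: vw => p [Ap _ pw]; exists p.
have [q [vq qw vinsq]] := anchor_edge vw.
have [q' [wq' qz vinsq']] := IHl _ ww wl.
exists (q ++ q'); split; first by rewrite cat_path vq qw.
  by rewrite last_cat qw.
apply: vins_trans (vins_cons v vinsq') _.
apply: (vins_trans (vins_catr (map inl (a w :: q') ++ [:: last w l]) vinsq)).
have -> : (v :: map inl (a v :: q) ++ [:: w]) ++ map inl (a w :: q') ++ [:: last w l] =
  (v :: map inl (belast (a v) q)) ++ [:: inl (a w), w, inl (a w) & map inl q' ++ [:: last w l]].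
  by rewrite (lastI (a v) q) qw map_rcons -cats1 /= -!catA.
have -> : v :: map inl (a v :: q ++ q') ++ [:: last w l] =
  (v :: map inl (belast (a v) q)) ++ (inl (a w) :: map inl q' ++ [:: last w l]).
  by rewrite -[a v :: q ++ q']cat_cons (lastI (a v) q) qw map_cat map_rcons -cats1 /= -!catA.
apply: vins_catl; have [t1 t2 t3 t4] := tri3_perm (anchor_tri ww).
by apply: vins_trans (vins_mid _ t4) _; exact: vins_dup.
Qed.

Hypothesis null : forall x s, path adjl x s -> last x s = x -> homotopic (@adj X) k (x :: s) [:: x].

Lemma anchor_contract (x : nat -> V) n : x n = x 0%N ->
  (forall j, (j < n)%N -> vspan (x j) (x j.+1)) ->
  insertions D [seq e (x j) | j <- iota 0 n.+1] [:: e (x 0%N)].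
Proof.
case: n => [|n] xn xx; first exact: ins_refl.
set v := x 0%N in xn *; pose l := [seq x j | j <- iota 1 n.+1].
have vv : vspan v v by have [p [Ap pv _]] := xx 0%N isT; exists p.
have vl : path vrel v l.
  apply/(pathP v) => i; rewrite size_map size_iota => il.
  have -> : nth v (v :: l) i = x i.
    by case: i il => [//|i il] /=; rewrite (nth_map 0%N) ?size_iota ?nth_iota// ltnW.
  by rewrite (nth_map 0%N) ?size_iota// nth_iota// add1n; apply/asboolP/xx.
have lv : last v l = v.
  by rewrite (last_nth v) size_map size_iota /= (nth_map 0%N) ?size_iota// nth_iota.
have [q [vq]] := anchor_path vv vl; rewrite lv => qv vinsq.
have h := homotopic_vins R (null vq qv).
have -> : [seq e (x j) | j <- iota 0 n.+2] = map e (v :: l) by rewrite /= -map_comp.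
suff : vins (v :: l) [:: v] by [].
apply: (vins_trans vinsq); apply: vins_trans (vins_cons v (vins_catr [:: v] h)) _.
have t := anchor_tri vv; apply: vins_trans (vins_mid _ t) _.
by apply: vins_dup; case: (tri3_perm t).
Qed.

Lemma tri3_span v w (u : V) : tri3 v w u -> vspan v w.
Proof.
move=> [_ [[i [j [l [ijl ->]]]] sv sw _]].
have nz i' : e i' i' != 0 by rewrite /corner eqxx oner_neq0.
exact: (simplex_span R ijl (simplex_support sv (nz v)) (simplex_support sw (nz w))).
Qed.

Lemma anchor_connected v w : vspan v v -> vspan w w -> exists (x : nat -> V) n,
  [/\ x 0%N = v, x n = w & forall j, (j < n)%N -> vspan (x j) (x j.+1)].
Proof.
move=> vv ww; have [q vq qw] := graph_connected (a v) (a w).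
pose l := inl (a v) :: map inl q ++ [:: w].
have vl : path vrel v l.
  rewrite /= cat_path /= last_map qw andbT; apply/and3P; split.
  - by apply/asboolP; exact: tri3_span (anchor_tri vv).
  - rewrite path_map; apply: sub_path vq => y z yz; apply/asboolP.
    by apply: (simplex_span R (@edge_simplex X k y z _)); [rewrite /lazy /= yz orbT|constructor 1|constructor 2].
  - by apply/asboolP; have [t _ _ _] := tri3_perm (anchor_tri ww); exact: tri3_span t.
exists (nth w (v :: l)), (size l); split=> //.
  by rewrite -(last_nth w) /l /= last_cat.
by move=> j jl; move/(pathP w): vl => /(_ j jl)/asboolP.
Qed.

End SimplyConnectedComplex.

Lemma polygonal_simply_connected (R : realType) (X : graph) (k : nat) :
  (forall x s, path (lazy (@adj X)) x s -> last x s = x ->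
     homotopic (@adj X) k (x :: s) [:: x]) ->
  simply_connected R (@polygonal_complex R X k).
Proof.
move=> null; have [a aP] := anchoring_ex X.
apply: (star_simply_connected (D := @simplices R X k)).
- by move=> s; exact: simplices_sub.
- by move=> s p q t; exact: simplices_convex.
- by move=> p; exact: complex_nz.
- by move=> p v w; exact: complex_star.
- have [x] := graph_inhabited X; exists (corner R (inl x)).
  left; exists x, x, 0; split; [by left|by rewrite lexx ler01|].
  by apply/funext => i; rewrite /edge_point /segment_point subr0 mul1r mul0r addr0.
- by move=> v w; exact: (anchor_connected aP).
- by move=> x n; exact: (anchor_contract aP null).
Qed.

(** * Isometries of balls and coverings *)

Section GraphDistanceTheory.
Variable X : graph.
Implicit Types (x y z : X) (p : seq X).

Lemma gdist_path x p : path (@adj X) x p -> (gdist x (last x p) <= size p)%N.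
Proof.
by move=> xp; rewrite /gdist; case: ex_minnP => m _; apply; apply/asboolP; exists p.
Qed.

Lemma gdist_ex x y : exists p, [/\ path (@adj X) x p, last x p = y & size p = gdist x y].
Proof. by rewrite /gdist; case: ex_minnP => m /asboolP. Qed.

Lemma gdist_refl x : gdist x x = 0%N.
Proof. by apply/eqP; rewrite -leqn0; apply: (@gdist_path x [::]). Qed.

Lemma gdist_eq0 x y : gdist x y = 0%N -> x = y.
Proof. by have [p [_ + <-]] := gdist_ex x y; case: p. Qed.

Lemma gdist_triangle x y z : (gdist x z <= gdist x y + gdist y z)%N.
Proof.
have [p [xp py <-]] := gdist_ex x y; have [q [yq qz <-]] := gdist_ex y z.
by rewrite -size_cat -qz -py -last_cat gdist_path// cat_path xp py.
Qed.

Lemma gdist_adj x y : adj x y -> (gdist x y <= 1)%N.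
Proof. by move=> xy; apply: (@gdist_path x [:: y]); rewrite /= xy. Qed.

Lemma gdist_adj1 x y : adj x y = (gdist x y == 1%N).
Proof.
apply/idP/eqP => [xy|].
  apply/eqP; rewrite eqn_leq gdist_adj//= lt0n; apply/eqP => /gdist_eq0 E.
  by rewrite E adj_irrefl in xy.
by have [p [+ + <-]] := gdist_ex x y; case: p => [//|z [|]]//= /andP[xz _] <-.
Qed.

Lemma gdist_step x y z : adj y z -> (gdist x z <= (gdist x y).+1)%N.
Proof. by move=> /gdist_adj yz; rewrite -addn1 (leq_trans (gdist_triangle x y z))// leq_add2l. Qed.

Lemma ball_finite x n : finite_set [set y | (gdist x y <= n)%N].
Proof.
elim: n => [|n IHn].
  apply: (@sub_finite_set _ _ [set x]); last exact: finite_set1.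
  by move=> y /=; rewrite leqn0 => /eqP/gdist_eq0.
apply: (@sub_finite_set _ _ ([set x] `|` \bigcup_(y in [set y | (gdist x y <= n)%N]) [set z | adj y z])).
  move=> y /=; have [p [xp py <-]] := gdist_ex x y.
  case/lastP: p xp py => [|p z]; first by move=> _ <- _; left.
  rewrite last_rcons size_rcons rcons_path ltnS => /andP[xp pz] <- pn.
  by right; exists (last x p) => //=; rewrite (leq_trans _ pn)// gdist_path.
rewrite finite_setU; split; first exact: finite_set1.
by apply: bigcup_finite => // y _; exact: graph_locally_finite.
Qed.

End GraphDistanceTheory.

Lemma gdist_le_lipschitz (X Y : graph) (f : X -> Y) L :
  (forall x y, adj x y -> (gdist (f x) (f y) <= L)%N) -> lipschitz_map L f.
Proof.
move=> fL x y; have [p [xp <- <-]] := gdist_ex x y; elim: p x xp => [|z p IHp] x.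
  by move=> _; rewrite [last _ _]/= gdist_refl.
rewrite [path _ _ _]/= [last _ _]/= [size _]/= => /andP[xz /IHp zp]; apply: leq_trans (gdist_triangle (f x) (f z) _) _.
by rewrite mulnS leq_add// fL.
Qed.

Section LocalAgreement.
Variables (R : realType) (X Y : graph) (f : X -> Y) (g : Y -> X).
Hypotheses (fK : cancel f g) (gK : cancel g f).
Variables (x0 : X) (M : nat).
Hypothesis fadj : forall u v, (gdist x0 u <= M)%N -> adj u v -> adj (f u) (f v).
Implicit Types (u v : X) (p q : X -> R) (A : set (X -> R)).

Definition push p : Y -> R := p \o g.

Lemma push_edge u v t : push (edge_point u v t) = edge_point (f u) (f v) t.
Proof.
apply/funext => y; rewrite /push /edge_point /segment_point /corner /=.
by rewrite -(can_eq gK y (f u)) fK -(can_eq gK y (f v)) fK.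
Qed.

Lemma push_corner u : push (corner R u) = corner R (f u).
Proof. by apply/funext => y; rewrite /push /corner /= -(can_eq gK y (f u)) fK. Qed.

Let W : seq X := projT1 (cid (proj1 (finite_seqP _) (@ball_finite X x0 M))).
Let WE u : (u \in undup W) = (gdist x0 u <= M)%N.
Proof. by rewrite /W mem_undup; case: cid => W' /= /seteqP[h1 h2]; apply/idP/idP => [/h2|/h1]. Qed.

Let height u : R := (M - gdist x0 u)%N%:R.
(* Decreases at most at unit speed along paths, so that short paths starting
   deep enough stay where f preserves adjacency. *)
Definition depth p : R := \sum_(w <- undup W) p w * height w.

Lemma depth_edge u v t : depth (edge_point u v t) = (1 - t) * height u + t * height v.
Proof.
have single w : \sum_(w' <- undup W) corner R w w' * height w' = height w.
  have [wW|wW] := boolP (w \in undup W).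
    rewrite (bigD1_seq w) ?undup_uniq//= /corner eqxx mul1r big1 ?addr0// => w' /negbTE ->.
    by rewrite mul0r.
  rewrite /height; have -> : (M - gdist x0 w)%N = 0%N.
    by apply/eqP; rewrite subn_eq0 ltnW// ltnNge -WE.
  rewrite big_seq big1// => w' w'W; rewrite /corner.
  have [E|] := eqVneq w' w; last by rewrite mul0r.
  by rewrite -E w'W in wW.
rewrite /depth -{1}(single u) -{1}(single v) !mulr_sumr -big_split; apply: eq_bigr => w _ /=.
by rewrite /edge_point /segment_point; ring.
Qed.

Lemma height_adj u v : adj u v -> `|height u - height v| <= 1.
Proof.
move=> uv; have h1 := gdist_step x0 uv; have h2 : (gdist x0 u <= (gdist x0 v).+1)%N.
  by apply: gdist_step; rewrite adj_sym.
rewrite /height; move: (gdist x0 u) (gdist x0 v) h1 h2 => a b h1 h2.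
wlog ab : a b h1 h2 / (a <= b)%N.
  by move=> wl; case/orP: (leq_total a b) => ab; [|rewrite distrC]; apply: wl.
move: h1; rewrite leq_eqVlt ltnS => /orP[/eqP ->|ba]; last first.
  by rewrite (_ : a = b) ?subrr ?normr0//; apply/eqP; rewrite eqn_leq ab.
rewrite subnS; case: (M - a)%N => [|m]; first by rewrite subrr normr0.
by rewrite /= -natr1 addrAC subrr add0r normr1.
Qed.

Lemma height_near u : 0 < height u -> (gdist x0 u <= M)%N.
Proof. by rewrite ltr0n subn_gt0 => /ltnW. Qed.

Lemma depth_edge_near u v t : adj u v -> 0 <= t <= 1 -> 0 < depth (edge_point u v t) ->
  adj (f u) (f v).
Proof.
move=> uv /andP[t0 t1]; rewrite depth_edge => pos.
have [hu|hu] := ltP 0 (height u); first by apply: fadj => //; exact: height_near.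
have [hv|hv] := ltP 0 (height v).
  by rewrite adj_sym; apply: fadj; rewrite 1?adj_sym//; exact: height_near.
have : (1 - t) * height u + t * height v <= 0.
  have h1 : (1 - t) * height u <= 0 by rewrite mulr_ge0_le0// subr_ge0.
  have h2 : t * height v <= 0 by rewrite mulr_ge0_le0.
  by lra.
by rewrite leNgt pos.
Qed.

Lemma depth_slope u v t t' : adj u v ->
  depth (edge_point u v t) - `|t - t'| <= depth (edge_point u v t').
Proof.
move=> uv; rewrite !depth_edge.
have := height_adj uv; set a := height u; set b := height v => ab.
have -> : (1 - t') * a + t' * b = (1 - t) * a + t * b + (t - t') * (a - b) by ring.
rewrite lerD2l lerNl (le_trans (ler_norm _))// normrN normrM.
by rewrite ler_piMr.
Qed.

Local Notation pwl := (@piecewise_linear R _).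
Local Notation XR := (@realization R X).
Local Notation YR := (@realization R Y).

Lemma push_realization p : XR p -> 0 < depth p -> YR (push p).
Proof.
move=> [u [v [t [uv t01 ->]]]] pos; exists (f u), (f v), t; rewrite push_edge; split=> //.
by case: uv => [->|uv]; [left | right; exact: depth_edge_near pos].
Qed.

Lemma push_pwl_in A (B : set (Y -> R)) p q l : (forall p, A p -> 0 < depth p) ->
  (forall p, A p -> B (push p)) -> pwl A p q l -> pwl B (push p) (push q) l.
Proof.
move=> Apos AB; elim=> {p q l} [p /AB Bp|u v t t' q l uv t01 t01' Ap _ IH].
  exact: pl_nil.
rewrite push_edge in IH; rewrite push_edge; apply: pl_cons => //.
  apply: (depth_edge_near uv t01); apply: Apos.
  by have := Ap 0; rewrite lexx ler01 => /(_ isT); rewrite subr0 mul1r mul0r addr0.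
by move=> a a01; rewrite -push_edge; apply: AB; exact: Ap.
Qed.

Lemma pwl_depth p q l : pwl XR p q l -> depth p - l <= depth q.
Proof.
elim=> {p q l} [p _|u v t t' q l uv _ _ _ _ IH]; first by rewrite subr0.
by apply: le_trans IH; have := depth_slope t t' uv; lra.
Qed.

Lemma pwl_ge0 A p q l : pwl A p q l -> 0 <= l.
Proof. by elim=> // *; rewrite addr_ge0. Qed.

(** The depth drops at most by the length travelled, so along the path it stays above 1, where [f]
    preserves edges. *)
Lemma push_pwl p q l : pwl XR p q l -> l + 1 < depth p -> pwl YR (push p) (push q) l.
Proof.
elim=> {p q l} [p Ap|u v t t' q l uv t01 t01' Ap pq IH] lp.
  by apply: pl_nil; apply: push_realization => //; lra.
have l0 := pwl_ge0 pq; have tt0 := normr_ge0 (t - t').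
have fuv : adj (f u) (f v) by apply: (depth_edge_near uv t01); lra.
rewrite push_edge in IH; rewrite push_edge; apply: pl_cons => //.
  move=> a /andP[a0 a1]; exists (f u), (f v), ((1 - a) * t + a * t'); split=> //; first by right.
  move: t01 t01' => /andP[t0 t1] /andP[t0' t1'].
  rewrite addr_ge0 ?mulr_ge0 ?subr_ge0//=.
  have : (1 - a) * t <= (1 - a) * 1 by rewrite ler_wpM2l// subr_ge0.
  have : a * t' <= a * 1 by rewrite ler_wpM2l.
  by lra.
by apply: IH; have := depth_slope t t' uv; lra.
Qed.

Lemma depth_center : depth (corner R x0) = M%:R.
Proof.
have -> : corner R x0 = edge_point x0 x0 0.
  by apply/funext => i; rewrite /edge_point /segment_point subr0 mul1r mul0r addr0.
by rewrite depth_edge subr0 mul1r mul0r addr0 /height gdist_refl subn0.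
Qed.

(** The distance is an infimum, so the argument takes a path of length less than [r + 1]; this is
    one source of the margin 2 in [r + 2 <= M]. *)
Lemma ball_depth r p : graph_ball x0 r p -> M%:R - (r + 1) < depth p.
Proof.
move=> [_ dp]; have : (intrinsic_dist XR (corner R x0) p < (r + 1)%:E)%E.
  by apply: le_lt_trans dp _; rewrite lte_fin ltrDl.
by move/ereal_inf_lt => -[_ [l /pwl_depth + <-]]; rewrite lte_fin depth_center; lra.
Qed.

Lemma push_ball r p : r + 2 <= M%:R -> graph_ball x0 r p -> graph_ball (f x0) r (push p).
Proof.
move=> rM pb; have := ball_depth pb; have [XRp dp] := pb => depthp; split.
  by apply: push_realization => //; lra.
rewrite leNgt; apply/negP => lt.
have : (intrinsic_dist XR (corner R x0) p <
    Order.min (r + 1)%:E (intrinsic_dist YR (corner R (f x0)) (push p)))%E.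
  rewrite lt_min (le_lt_trans dp lt) andbT; apply: le_lt_trans dp _.
  by rewrite lte_fin ltrDl.
move/ereal_inf_lt => -[_ [l xl <-]]; rewrite lt_min lte_fin => /andP[lr].
apply/negP; rewrite -leNgt; apply: ereal_inf_lbound; exists l => //.
by rewrite -push_corner; apply: push_pwl => //; rewrite depth_center; lra.
Qed.

End LocalAgreement.

Lemma balls_isometric (R : realType) (X Y : graph) (f : X -> Y) (g : Y -> X) x0 M r :
  cancel f g -> cancel g f ->
  (forall u v, (gdist x0 u <= M)%N -> adj u v -> adj (f u) (f v)) ->
  (forall u v, (gdist (f x0) u <= M)%N -> adj u v -> adj (g u) (g v)) ->
  r + 2 <= M%:R ->
  @intrinsically_isometric R X Y (graph_ball x0 r) (graph_ball (f x0) r).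
Proof.
move=> fK gK fadj gadj rM.
have fb p : graph_ball x0 r p -> graph_ball (f x0) r (push g p).
  exact: (push_ball fK gK fadj rM).
have gb p : graph_ball (f x0) r p -> graph_ball x0 r (push f p).
  by rewrite -{2}(fK x0); exact: (push_ball gK fK gadj rM).
have pK (p : X -> R) : push f (push g p) = p by apply/funext => x; rewrite /push /= fK.
have pK' (p : Y -> R) : push g (push f p) = p by apply/funext => x; rewrite /push /= gK.
have pos p : graph_ball x0 r p -> 0 < depth x0 M p by move=> pb; have := ball_depth M pb; lra.
have pos' p : graph_ball (f x0) r p -> 0 < depth (f x0) M p by move=> pb; have := ball_depth M pb; lra.
exists (push g); first split.
- by move=> p /fb.
- by move=> p q _ _ E; rewrite -(pK p) E pK.
- by move=> p pb; exists (push f p); [exact: gb | exact: pK'].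
move=> p q pb qb; congr (ereal_inf (image _ _)); apply/seteqP; split=> l.
  by move/(push_pwl_in gK fK gadj pos' gb); rewrite !pK.
exact: (push_pwl_in fK gK fadj pos fb).
Qed.

Section GraphMaps.
Variables (X Y : graph) (f : X -> Y).

Lemma adj_isometry : bijective f -> (forall x x', adj (f x) (f x') = adj x x') -> Defs.isometry f.
Proof.
move=> fb fadj; split=> // x x'; case: (fb) => g fK gK.
apply/eqP; rewrite eqn_leq; apply/andP; split.
  have : lipschitz_map 1 f by apply: gdist_le_lipschitz => a b ab; rewrite gdist_adj// fadj.
  by move=> /(_ x x'); rewrite mul1n.
have : lipschitz_map 1 g.
  by apply: gdist_le_lipschitz => a b ab; rewrite gdist_adj// -fadj !gK.
by move=> /(_ (f x) (f x')); rewrite mul1n !fK.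
Qed.

Lemma isometry_adj : Defs.isometry f -> forall x x', adj (f x) (f x') = adj x x'.
Proof. by move=> [_ fd] x x'; rewrite !gdist_adj1 fd. Qed.

End GraphMaps.

(** * Coverings of graphs in which loops contract by short moves *)

Section Covering.
Variables (X Y : graph) (f : X -> Y) (k : nat).
Hypothesis fcov : covering f.
Hypothesis finj : forall x a b, (gdist x a <= k)%N -> (gdist x b <= k)%N -> f a = f b -> a = b.
Local Notation lazyX := (lazy (@adj X)).
Local Notation lazyY := (lazy (@adj Y)).

Lemma covering_adj x x' : adj x x' -> adj (f x) (f x').
Proof. by move=> xx'; have [_ /(_ x)[fun_ _ _]] := fcov; exact: fun_. Qed.

Lemma covering_lift1 x y : lazyY (f x) y -> exists2 x', lazyX x x' & f x' = y.
Proof.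
case/orP=> [/eqP <-|xy]; first by exists x => //; exact: lazy_refl.
have [_ /(_ x)[_ _ /(_ y xy)[x' xx' <-]]] := fcov.
by exists x' => //; rewrite /lazy /= xx' orbT.
Qed.

Lemma covering_lift x s : path lazyY (f x) s -> exists2 a, path lazyX x a & map f a = s.
Proof.
elim: s x => [|y s IHs] x /=; first by exists [::].
move=> /andP[/covering_lift1[x' xx' <-] /IHs[a x'a <-]].
by exists (x' :: a) => //=; rewrite xx'.
Qed.

Lemma gdist_lazy_path (Z : graph) (x : Z) s : path (lazy (@adj Z)) x s -> (gdist x (last x s) <= size s)%N.
Proof.
elim: s x => [|y s IHs] x; first by rewrite [last _ _]/= gdist_refl.
rewrite [path _ _ _]/= [last _ _]/= [size _]/= => /andP[xy /IHs ys].
apply: leq_trans (gdist_triangle x y _) _; rewrite -add1n leq_add//.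
by case/orP: xy => [/eqP ->|/gdist_adj//]; rewrite gdist_refl.
Qed.

Definition lifts_along (s t : seq Y) := forall x a, path lazyX x a -> map f (x :: a) = s ->
  exists b, [/\ path lazyX x b, map f (x :: b) = t & last x b = last x a].

(** The lift of [t] starts where that of [s] does. Both ends are within distance [k] of this point
    and have the same image, so they agree. *)
Lemma lifts_step u v y s t : path lazyY y s -> path lazyY y t -> last y s = last y t ->
  (size s + size t <= k)%N -> lifts_along (u ++ y :: s ++ v) (u ++ y :: t ++ v).
Proof.
move=> ys yt st stk x a xa E.
have [a1 [x1 [a2 [a3 [aE x1E f1 f2 f3]]]]] : exists a1 x1 a2 a3,
  [/\ x :: a = a1 ++ x1 :: a2 ++ a3, f x1 = y, map f a1 = u, map f a2 = s & map f a3 = v].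
  have szE := congr1 size E; rewrite size_map size_cat /= size_cat in szE.
  pose a' := drop (size u) (x :: a).
  have : map f a' = y :: s ++ v by rewrite map_drop E drop_size_cat.
  have : x :: a = take (size u) (x :: a) ++ a' by rewrite cat_take_drop.
  have : map f (take (size u) (x :: a)) = u by rewrite map_take E take_size_cat.
  move: (take _ _) => a1 f1 ->; case: a' => [//|x1 a'] [f0 f'].
  exists a1, x1, (take (size s) a'), (drop (size s) a'); split=> //.
  - by rewrite cat_take_drop.
  - by rewrite map_take f' take_size_cat.
  - by rewrite map_drop f' drop_size_cat.
have [pa2 pa3] : path lazyX x1 a2 /\ path lazyX (last x1 a2) a3.
  have : path lazyX x1 (a2 ++ a3).
    case: a1 aE {f1} => [|x' a1] /= [E1 E2]; first by rewrite -E1 -E2.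
    by move: xa; rewrite E2 (cat_path _ x a1) /= => /and3P[].
  by rewrite cat_path => /andP[].
rewrite -x1E in yt; have [b2 pb2 fb2] := covering_lift yt.
have lE : last x1 b2 = last x1 a2.
  apply: (finj (x := x1)).
  - by apply: leq_trans (gdist_lazy_path pb2) _; rewrite -(size_map f) fb2 (leq_trans (leq_addl _ _) stk).
  - by apply: leq_trans (gdist_lazy_path pa2) _; rewrite -(size_map f) f2 (leq_trans (leq_addr _ _) stk).
  - by rewrite -2!(last_map f) fb2 f2 x1E st.
case: a1 f1 aE => [|x' a1] f1 /= [xE aE].
  exists (b2 ++ a3); rewrite -xE in x1E pb2 pa2 pa3 lE *; split.
  - by rewrite cat_path pb2 lE pa3.
  - by rewrite /= map_cat fb2 f3 x1E -f1.
  - by rewrite aE !last_cat lE.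
exists (a1 ++ x1 :: b2 ++ a3); rewrite -xE in f1; split.
- move: xa; rewrite aE !cat_path /= !cat_path => /and4P[-> -> _ _] /=.
  by rewrite pb2 lE pa3.
- by rewrite /= map_cat /= map_cat fb2 f3 x1E -f1.
- by rewrite aE !last_cat /= !last_cat lE.
Qed.

Lemma homotopic_lifts s t : homotopic (@adj Y) k s t -> lifts_along s t /\ lifts_along t s.
Proof.
elim=> {s t} [s|s t _ []//|s t w _ [h1 h2] _ [h1' h2']|u v y s t ys yt st stk].
- by split=> x a xa E; exists a.
- split=> x a xa E.
    have [b [xb Eb <-]] := h1 _ _ xa E; have [c [? ? <-]] := h1' _ _ xb Eb; by exists c.
  have [b [xb Eb <-]] := h2' _ _ xa E; have [c [? ? <-]] := h2 _ _ xb Eb; by exists c.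
- by split; apply: lifts_step => //; rewrite addnC.
Qed.

(** A path joining two points with the same image maps to a loop. Contracting it lifts to a constant
    path with the same ends, so [f] is injective. *)
Lemma covering_isometry :
  (forall y s, path lazyY y s -> last y s = y -> homotopic (@adj Y) k (y :: s) [:: y]) ->
  Defs.isometry f.
Proof.
move=> null.
have lazyf x x' : lazyX x x' -> lazyY (f x) (f x').
  by case/orP=> [/eqP ->|/covering_adj xx']; [exact: lazy_refl | rewrite /lazy /= xx' orbT].
have inj : injective f.
  move=> x x' fxx'; have [a xa ax'] := graph_connected x x'.
  have {}xa : path lazyX x a.
    by apply: sub_path xa => y z yz; rewrite /lazy /= yz orbT.
  have fa : path lazyY (f x) (map f a) by rewrite path_map; apply: sub_path xa; exact: lazyf.
  have fl : last (f x) (map f a) = f x by rewrite last_map ax'.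
  have [h _] := homotopic_lifts (null _ _ fa fl).
  by have [b [_ + bl]] := h x a xa erefl; case: b bl => //= ->.
have [g gK] : exists g, cancel g f.
  by have [s _] := fcov; have [g gP] := choice s; exists g.
apply: adj_isometry; first by exists g => // x; apply: inj.
move=> x x'; apply/idP/idP => [xx'|]; last exact: covering_adj.
have [_ /(_ x)[_ _ /(_ _ xx')[x'' xx'' /inj <-]]] := fcov.
exact: xx''.
Qed.

End Covering.

(** * The geometry of twisted graphs *)

Section TwistGraph.
Local Open Scope group_scope.
Variables (G Q H Ht : groupType) (F : frame G Q H Ht).
Local Notation K := (fK F).
Local Notation S := (fS F).
Local Notation iota := (fi F).
Local Notation p := (fp F).
Local Notation ext := (f_ext F).
Local Notation lift := (ext_lift ext).
Local Notation c0 := (fun _ _ => false).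
Implicit Types (x y w : Ht) (h : H) (u v : G) (c : G -> G -> bool).

Lemma twist_connected c x y : exists2 s, path (twist_adj F c) x s & last x s = y.
Proof.
have [n hn] := fT_gen F ((p x)^-1 * p y).
suff [s xs sE] : exists2 s, path (lazy (twist_adj F c)) x s & p (last x s) = p y.
  have [t xt tE] : exists2 t, path (twist_adj F c) x t & last x t = last x (rcons s y).
    by apply: lazy_path; rewrite rcons_path xs; exact: lazy_fiber.
  by exists t; rewrite ?tE ?last_rcons.
have : p y = p x * ((p x)^-1 * p y) by rewrite mulVKg.
move: ((p x)^-1 * p y) hn => h; elim: n h y => [|n IHn] h y /=.
  by rewrite inE => /eqP -> pE; exists [::]; rewrite //= pE mulg1.
move=> /allpairsP[[a b]] /= [an bT ->] pE.
have [|s xs sE] := IHn a (lift (p x * a)) an; first by rewrite ext_liftK.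
exists (rcons s (last x s * lift b)); last first.
  by rewrite last_rcons (extM ext) sE !ext_liftK pE mulgA.
rewrite rcons_path xs /=; apply: (@lazy_ball _ _ _ _ F c _ _ b).
  by apply: (@word_ball_mono _ _ (fT1 F) 1) => //; rewrite mem_word_ball1.
by rewrite (extM ext) ext_liftK.
Qed.

Lemma twist_locally_finite c x : finite_set [set y | twist_adj F c x y].
Proof. exact: (finite_seq (neighbors F c x)). Qed.

Definition twist_graph c (ct : tame F c) : graph :=
  Graph (twist_adj_sym ct) (twist_adj_irrefl F c) (inhabits 1)
    (twist_connected c) (twist_locally_finite c).

Definition cayley_gens : seq Ht := neighbors F c0 1.

Lemma twist_adj0 x y : twist_adj F c0 x y = (x^-1 * y \in cayley_gens).
Proof.
rewrite -[RHS]/(twist_adj F c0 1 (x^-1 * y)).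
apply/twist_adjP/twist_adjP => -[E|E|[u uS E]].
- by constructor 1; rewrite E mulKg mul1g.
- by constructor 2; rewrite invg1 mul1g.
- by constructor 3; exists u => //; rewrite E !mulgA mulVg.
- by constructor 1; apply: (mulgI x^-1); rewrite E mul1g mulKg.
- by constructor 2; move: E; rewrite invg1 mul1g.
- by constructor 3; exists u => //; apply: (mulgI x^-1); rewrite E !mulgA mulVg.
Qed.

Lemma cayley_gens_sym : symmetric_set cayley_gens.
Proof.
move=> a; rewrite -[a \in _]/(twist_adj F c0 1 a) (twist_adj_sym (tame0 F)) twist_adj0.
by rewrite mulg1.
Qed.

Lemma cayley_gens_generate : generates cayley_gens.
Proof.
move=> g; have [s] := twist_connected c0 1 g.
suff gen x : path (twist_adj F c0) x s -> exists2 w, all (mem cayley_gens) w &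
    x * \prod_(a <- w) a = last x s.
  move=> /gen[w wA <-] <-; exists w; last by rewrite mul1g.
  by apply: sub_all wA => a aA; apply/orP; left.
elim: s x => [|y s IHs] x /=; first by exists [::]; rewrite // big_nil mulg1.
move=> /andP[xy /IHs[w wA wE]]; exists (x^-1 * y :: w).
  by rewrite /= wA andbT -twist_adj0.
by rewrite big_cons mulgA mulVKg.
Qed.

Local Notation X := (cayley cayley_gens_sym cayley_gens_generate).

Lemma cayley_adjE (x y : X) : adj x y = twist_adj F c0 x y.
Proof.
rewrite twist_adj0 -[LHS]/((x != y) && ((x : Ht)^-1 * y \in cayley_gens)).
apply: andb_idl; rewrite -twist_adj0; apply: contraTneq => ->.
by rewrite twist_adj_irrefl.
Qed.

Lemma twist_iso_isometry c c' (ct : tame F c) (ct' : tame F c') (f : Ht -> Ht) :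
  twist_iso F c c' f -> @Defs.isometry (twist_graph ct) (twist_graph ct') f.
Proof. by move=> [fb fadj]; apply: (@adj_isometry (twist_graph ct) (twist_graph ct')). Qed.

Lemma isometry_twist_iso c c' (ct : tame F c) (ct' : tame F c') (f : Ht -> Ht) :
  @Defs.isometry (twist_graph ct) (twist_graph ct') f -> twist_iso F c c' f.
Proof. by move=> fi; split; [case: fi | exact: (isometry_adj fi)]. Qed.

Lemma twist_transitive c (ct : tame F c) : vertex_transitive (twist_graph ct).
Proof.
move=> x y; have [cP c11 _] := ct.
have [g fK gK] := translate_bij F c x.
exists (twist_translate F c y \o g).
  apply: twist_iso_isometry; apply: (@twist_iso_comp _ _ _ _ F c c c).
    exact: twist_iso_inv (translate_iso F x cP) fK gK.
  exact: translate_iso.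
by rewrite /= -{1}(translate1 F x c11 cP) fK translate1.
Qed.

(** A single edge is traded for the single edge of the other graph, followed if necessary by a fibre
    edge. *)
Lemma twist_close c c' (ct : tame F c) (ct' : tame F c') x y :
  twist_adj F c x y -> (@gdist (twist_graph ct') x y <= 2)%N.
Proof.
have step a b : twist_adj F c' a b -> (@gdist (twist_graph ct') a b <= 1)%N.
  by move=> ab; exact: (@gdist_adj (twist_graph ct')).
case/twist_adjP => [E|E|[u uS E]].
- by apply: leq_trans (step _ _ _) _ => //; apply/twist_adjP; constructor 1.
- by apply: leq_trans (step _ _ _) _ => //; apply/twist_adjP; constructor 2.
- pose w := x * fs F u * iota (c' (cg K (p x)) u).
  have xw : twist_adj F c' x w by apply/twist_adjP; constructor 3; exists u.
  apply: leq_trans (@gdist_triangle (twist_graph ct') x w y) _.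
  apply: (@leq_add _ _ 1 1); first exact: step.
  have [[] ->] : exists a, y = w * iota a.
    by apply: (ext_fiber ext); rewrite E !p_single.
    by apply: step; apply/twist_adjP; constructor 1.
  by rewrite (ext0 ext) mulg1 gdist_refl.
Qed.

Lemma cayley_gdist_twist (x y : Ht) : @gdist X x y = @gdist (twist_graph (tame0 F)) x y.
Proof.
have [_ -> //] : @Defs.isometry (twist_graph (tame0 F)) X id.
by apply: (@adj_isometry (twist_graph (tame0 F)) X); [exists id | move=> a b; exact: cayley_adjE].
Qed.

Lemma twist_bilipschitz c (ct : tame F c) : bilipschitz_equivalent 4 (twist_graph ct) X.
Proof.
exists id, id; split=> //.
  apply: (@gdist_le_lipschitz (twist_graph ct) X) => x y xy.
  by rewrite cayley_gdist_twist (leq_trans (twist_close ct (tame0 F) xy)).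
apply: (@gdist_le_lipschitz X (twist_graph ct)) => x y; rewrite cayley_adjE => xy.
by rewrite (leq_trans (twist_close (tame0 F) ct xy)).
Qed.

Definition deep M c := forall x u, (@gdist X 1%g x <= M)%N -> u \in S ->
  c (cg K (p x)) u = false.

Lemma deep_adj M c x y : deep M c -> (@gdist X 1%g x <= M)%N ->
  twist_adj F c x y = twist_adj F c0 x y.
Proof.
move=> cM xM; rewrite /twist_adj /= (neighbors_agree (c' := c0))// => u uS.
exact: cM.
Qed.

Lemma deep_gdist M c (ct : tame F c) m x : deep M c -> (m <= M)%N ->
  (@gdist (twist_graph ct) 1%g x <= m)%N -> (@gdist X 1%g x <= m)%N.
Proof.
move=> cM; elim: m x => [|m IHm] x mM.
  by rewrite leqn0 => /eqP/gdist_eq0 <-; rewrite gdist_refl.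
have [s [s1 sx <-]] := @gdist_ex (twist_graph ct) 1 x.
case/lastP: s s1 sx => [|s y]; first by move=> _ /= <- _; rewrite gdist_refl.
rewrite rcons_path last_rcons size_rcons ltnS => /andP[s1 sy] <- sm.
have lm : (@gdist X 1%g (last 1%g s) <= m)%N.
  apply: IHm; first exact: ltnW.
  exact: leq_trans (@gdist_path (twist_graph ct) 1 s s1) sm.
have h : @adj X (last 1%g s) y.
  by rewrite cayley_adjE -(deep_adj y cM (leq_trans lm (ltnW mM))).
exact: leq_trans (gdist_step (X := X) 1 h) _.
Qed.

Lemma twist_locally_like (R : realType) (r : R) M c (ct : tame F c) : deep M c ->
  (r + 2 <= M%:R)%R -> locally_like r X (twist_graph ct).
Proof.
move=> cM rM y; exists (1 : X); have [cP c11 _] := ct.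
have [g fK gK] := translate_bij F c y.
have iso := translate_iso F y cP.
have h := @balls_isometric R X (twist_graph ct) (twist_translate F c y) g 1 M r fK gK.
rewrite -(translate1 F y c11 cP); apply: h => //.
  move=> u v uM; rewrite cayley_adjE => uv.
  rewrite -[adj _ _]/(twist_adj F c _ _) twist_adj_translate//.
  by rewrite (deep_adj v cM uM).
move=> u v uM uv; rewrite cayley_adjE -(deep_adj _ cM).
  by rewrite -(twist_adj_translate F y cP) !gK.
apply: (@deep_gdist M c ct) => //.
have [_ iso_d] := twist_iso_isometry ct ct iso.
by have := iso_d 1 (g u); rewrite gK => <-.
Qed.

End TwistGraph.

Lemma uniq_map_in_inj (T1 T2 : eqType) (f : T1 -> T2) (s : seq T1) :
  uniq (map f s) -> {in s &, injective f}.
Proof.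
elim: s => //= a s IHs /andP[fa us] b c; rewrite !inE.
move=> /predU1P[->|bs] /predU1P[->|cs] // E; last exact: IHs.
  by move: fa; rewrite E map_f.
by move: fa; rewrite -E map_f.
Qed.

Section TwistCovering.
Local Open Scope group_scope.
Variables (G Q H Ht : groupType) (F : frame G Q H Ht).
Local Notation X := (cayley (@cayley_gens_sym _ _ _ _ F) (@cayley_gens_generate _ _ _ _ F)).
Implicit Types (x y w : Ht) (h : H) (u v : G) (c : G -> G -> bool).

Lemma deep_ball M c (ct : tame F c) x : deep F M c ->
  (@gdist X 1%g x <= M)%N -> (@gdist (twist_graph ct) 1%g x <= M)%N.
Proof.
move=> cM xM; have [s [s1 sx sE]] := @gdist_ex X 1%g x.
suff s1' : path (twist_adj F c) 1 s.
  by rewrite -sx (leq_trans (@gdist_path (twist_graph ct) 1%g s s1'))// sE.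
have {sE} sM : (size s <= M)%N by rewrite sE.
elim/last_ind: s s1 sM {sx} => [//|s y IHs].
rewrite !rcons_path size_rcons => /andP[s1 sy] sM; rewrite IHs ?(ltnW sM)//=.
rewrite (deep_adj (M := M))// -?cayley_adjE//.
exact: leq_trans (@gdist_path X 1%g s s1) (ltnW sM).
Qed.

Lemma cayley_translate x a b : @gdist X (x * a)%g (x * b)%g = @gdist X a b.
Proof. by rewrite !cayley_gdist invgM -mulgA mulKg. Qed.

(* A covering maps balls onto balls, and the balls of radius k of both graphs
   have the same number of vertices. *)
Lemma covering_ball_injective k c (ct : tame F c) (f : X -> twist_graph ct) :
  deep F k c -> covering f -> forall x a b : X,
  (gdist x a <= k)%N -> (gdist x b <= k)%N -> f a = f b -> a = b.
Proof.
move=> ck fcov x a b xa xb; have [cP c11 _] := ct.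
have [W WE] := proj1 (finite_seqP _) (@ball_finite X 1%g k).
pose L := undup W.
have LE w : (w \in L) = (@gdist X 1%g w <= k)%N.
  by rewrite mem_undup; have /seteqP[h1 h2] := WE; apply/idP/idP => [/h2|/h1].
pose Lx := [seq x * w | w <- L].
have LxE w : (w \in Lx) = (gdist x w <= k)%N.
  rewrite -(mulVKg x w) mem_map ?LE; last exact: mulgI.
  by rewrite -{2}(mulg1 x) cayley_translate.
suff /uniq_map_in_inj h : uniq (map f Lx) by apply: h; rewrite LxE.
have [_ dist] := twist_iso_isometry ct ct (translate_iso F (f x) cP).
apply: (@leq_size_uniq _ (map (twist_translate F c (f x)) L)).
- rewrite map_inj_uniq ?undup_uniq//; exact: bij_inj (translate_bij F c (f x)).
- move=> _ /mapP[w wL ->]; have := deep_ball ct ck; rewrite LE in wL.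
  move=> /(_ _ wL); rewrite -dist translate1// => wd.
  have [s [fs sw sk]] := @gdist_ex (twist_graph ct) (f x) (twist_translate F c (f x) w).
  have [|t xt tE] := covering_lift fcov (x := x) (s := s).
    by apply: sub_path fs => y y' yy'; apply/orP; right.
  rewrite -sw -tE last_map map_f// LxE.
  by rewrite (leq_trans (gdist_lazy_path xt))// -(size_map f) tE sk.
- by rewrite !size_map.
Qed.

Lemma covering_twist_isometry k c (ct : tame F c) (f : X -> twist_graph ct) :
  deep F k c ->
  (forall x s, path (lazy (twist_adj F c)) x s -> last x s = x ->
     homotopic (twist_adj F c) k (x :: s) [:: x]) ->
  covering f -> Defs.isometry f.
Proof.
by move=> ck null fcov; apply: (covering_isometry fcov (covering_ball_injective ck fcov)).
Qed.

End TwistCovering.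

(** * Isometry groups of twisted graphs *)

Section ImageGroup.
Local Open Scope group_scope.
Variables (A : groupType) (T : Type) (pi : A -> T).
Hypothesis piM : forall a a' b b', pi a = pi a' -> pi b = pi b' -> pi (a * b) = pi (a' * b').

(** The quotient of [A] by the congruence [pi a = pi a']. For isometry groups [pi] is the induced
    map of [H], so the quotient is by the isometries over the identity. *)
Record image_elt := ImageElt { image_val : T; image_valP : exists a, pi a = image_val }.

(* The hypothesis is an argument so that the group structure can be inferred. *)
Definition image_group of (forall a a' b b', pi a = pi a' -> pi b = pi b' ->
  pi (a * b) = pi (a' * b')) := image_elt.
Local Notation D := (image_group piM).

HB.instance Definition _ := gen_eqMixin D.
HB.instance Definition _ := gen_choiceMixin D.

Definition image_of a : D := ImageElt (ex_intro (fun a' => pi a' = pi a) a erefl).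

Lemma image_ofP a b : (image_of a = image_of b) <-> (pi a = pi b).
Proof.
split=> [[]//|ab]; rewrite /image_of; move: (ex_intro _ _ _) (ex_intro _ _ _).
by rewrite ab => e1 e2; rewrite (Prop_irrelevance e1 e2).
Qed.

Lemma image_of_surj (x : D) : exists a, image_of a = x.
Proof.
case: x => v vP; have [a av] := vP; exists a; rewrite /image_of.
move: (ex_intro _ _ _) => e; case: _ / av vP e => vP e.
by rewrite (Prop_irrelevance e vP).
Qed.

Definition image_rep x := projT1 (cid (image_of_surj x)).
Lemma image_repK x : image_of (image_rep x) = x.
Proof. by rewrite /image_rep; case: cid. Qed.

Definition image_mul x y := image_of (image_rep x * image_rep y).
Definition image_inv x := image_of (image_rep x)^-1.

Lemma image_ofM a b : image_of (a * b) = image_mul (image_of a) (image_of b).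
Proof. by apply/image_ofP; apply: piM; apply/image_ofP; rewrite image_repK. Qed.

Lemma image_ofV a : image_of a^-1 = image_inv (image_of a).
Proof.
set b := image_rep (image_of a); have ab : pi a = pi b by apply/image_ofP; rewrite image_repK.
apply/image_ofP; have -> : a^-1 = a^-1 * b * b^-1 by rewrite mulgK.
rewrite -[in RHS](mul1g b^-1) -(mulVg a).
by apply: (piM _ (erefl (pi b^-1))); apply: (piM (erefl (pi a^-1))).
Qed.

Lemma image_mulA : associative image_mul.
Proof. by move=> x y w; rewrite -(image_repK x) -(image_repK y) -(image_repK w) -!image_ofM mulgA. Qed.

Lemma image_mul1 : left_id (image_of 1) image_mul.
Proof. by move=> x; rewrite -(image_repK x) -image_ofM mul1g. Qed.

Lemma image_mulr1 : right_id (image_of 1) image_mul.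
Proof. by move=> x; rewrite -(image_repK x) -image_ofM mulg1. Qed.

Lemma image_mulV : left_inverse (image_of 1) image_inv image_mul.
Proof. by move=> x; rewrite -(image_repK x) -image_ofV -image_ofM mulVg. Qed.

Lemma image_mulrV : right_inverse (image_of 1) image_inv image_mul.
Proof. by move=> x; rewrite -(image_repK x) -image_ofV -image_ofM mulgV. Qed.

HB.instance Definition _ := isGroup.Build D
  image_mulA image_mul1 image_mulr1 image_mulV image_mulrV.

End ImageGroup.

Section IsometryTopology.
Variable X : graph.

Lemma eval_continuous (x : X) :
  continuous (fun f : isometry_group X => f x : discrete_topology X).
Proof.
move=> f; pose T := {ptws X -> discrete_topology X}.
apply: (@continuous_comp (isometry_group X) T (discrete_topology X)
  (fun g => isom_fun g) (fun g => g x)); first exact: initial_continuous.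
exact: (@proj_continuous X (fun _ => discrete_topology X) x).
Qed.

Lemma nbhs_agree (f : isometry_group X) (l : seq X) :
  nbhs f [set g : isometry_group X | {in l, g =1 f}].
Proof.
elim: l => [|x l IHl]; first by apply: filterS filterT => g _ y; rewrite in_nil.
have fx : nbhs f [set g : isometry_group X | g x = f x].
  apply: (eval_continuous (x := x) (t := [set f x])).
  by apply: open_nbhs_nbhs; split => //; exact: discrete_open.
apply: filterS (filterI fx IHl) => g [gx gl] y; rewrite inE => /predU1P[->//|]; exact: gl.
Qed.

End IsometryTopology.

Section TwistIsometryGroup.
Local Open Scope group_scope.
Variables (G Q H Ht : groupType) (F : frame G Q H Ht).
Local Notation K := (fK F).
Local Notation S := (fS F).
Local Notation T := (fT F).
Local Notation iota := (fi F).
Local Notation p := (fp F).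
Local Notation ext := (f_ext F).
Local Notation lift := (ext_lift ext).
Implicit Types (x y w : Ht) (h : H) (u v : G) (c : G -> G -> bool).

Definition flip (e : H -> bool) x := x * iota (e (p x)).

Lemma p_flip e x : p (flip e x) = p x. Proof. exact: (ext_p_iota ext). Qed.

Lemma flip_comp e e' x : flip e (flip e' x) = flip (fun h => e h (+) e' h) x.
Proof. by rewrite {1}/flip p_flip /flip -mulgA -(extD ext) addbC. Qed.

Lemma flip_self e : involutive (flip e).
Proof.
by move=> x; rewrite flip_comp /flip addbb (ext0 ext) mulg1.
Qed.

Lemma flip_iso c e : (forall h u, u \in S -> e (h * cj K u) = e h) ->
  twist_iso F c c (flip e).
Proof.
move=> eS; split; first by exists (flip e); exact: flip_self.
have imp x y : twist_adj F c x y -> twist_adj F c (flip e x) (flip e y).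
  case/twist_adjP => [->|xyB|[u uS ->]]; apply/twist_adjP.
  - constructor 1; rewrite /flip (ext_p_iota ext) -!mulgA; congr (_ * _).
    by rewrite (ext_central ext).
  - by constructor 2; rewrite pVM !p_flip -pVM.
  - constructor 3; exists u => //.
    rewrite p_flip /flip p_single eS// -!mulgA; congr (_ * _).
    by rewrite mulgA -(ext_central ext).
move=> x y; apply/idP/idP; last exact: imp.
by move/imp; rewrite !flip_self.
Qed.

(** Invariance under [S] gives invariance under [G], which [S] generates. *)
Lemma coset_constant (e : H -> bool) : (forall h u, u \in S -> e (h * cj K u) = e h) ->
  forall h, e h = e (cs K (cq K h)).
Proof.
move=> eS h; rewrite {1}(coordinatesE K h); have [w wS <-] := fS_gen F (cg K h).
move: (cs K _) => h0; elim: w h0 wS => [|u w IHw] h0 /=.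
  by rewrite big_nil cj1 mulg1.
by case/andP=> uS wS; rewrite big_cons cjM mulgA IHw// eS.
Qed.

Variables (c : G -> G -> bool) (ct : tame F c) (idx : Q -> nat) (qn : nat -> Q).
Hypotheses (idxK : cancel idx qn) (qnK : cancel qn idx).
Local Notation Y := (twist_graph ct).

Definition coset_flip (f : nat -> bool) := flip (fun h => f (idx (cq K h))).

Lemma coset_flip_isometry f : @Defs.isometry Y Y (coset_flip f).
Proof. by apply: twist_iso_isometry; apply: flip_iso => h u _; rewrite cq_mulj. Qed.

Definition flips f : isometry_group Y := Isometry (coset_flip_isometry f).

Definition isom_base (f : isometry_group Y) : H -> H := base_map F (f : Ht -> Ht).

Lemma isom_twist_iso (f : isometry_group Y) : twist_iso F c c f.
Proof. by apply: (isometry_twist_iso (ct := ct) (ct' := ct)); case: f. Qed.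

Lemma isom_baseE (f : isometry_group Y) x : isom_base f (p x) = p (f x).
Proof. exact: (base_mapE _ ct ct (isom_twist_iso f)). Qed.

Lemma isom_baseM (f f' g g' : isometry_group Y) : isom_base f = isom_base f' ->
  isom_base g = isom_base g' -> isom_base (f * g) = isom_base (f' * g').
Proof.
have comp (f1 g1 : isometry_group Y) h : isom_base (f1 * g1) h = isom_base f1 (isom_base g1 h).
  exact: (esym (isom_baseE f1 (g1 (lift h)))).
by move=> ff gg; apply/funext => h; rewrite !comp ff gg.
Qed.

Lemma isom_base1 h : isom_base 1 h = h.
Proof. by rewrite /isom_base /base_map; exact: ext_liftK. Qed.

Lemma isom_base_kernel (f : isometry_group Y) :
  isom_base f = isom_base 1 <-> range flips f.
Proof.
split=> [f1|[b _ <-]]; last first.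
  by apply/funext => h; rewrite isom_base1 -[h](ext_liftK ext) isom_baseE; exact: p_flip.
have fp x : p (f x) = p x by rewrite -isom_baseE f1 isom_base1.
have [e [fE eS]] := iso_over_id ct ct (isom_twist_iso f) fp.
have {}eS h u : u \in S -> e (h * cj K u) = e h.
  by move=> /(eS h); case: (c _ _); case: (e h); case: (e _).
exists (fun n => e (cs K (qn n))) => //; apply: isom_ext => x /=.
by rewrite /coset_flip /flip idxK -(coset_constant eS) fE.
Qed.

Lemma flips_morph : {morph flips : f g / (f + g)%R >-> f * g}.
Proof.
by move=> f g; apply: isom_ext => x /=; rewrite /isom_mul /= /coset_flip flip_comp.
Qed.

Let point n : Y := lift (cs K (qn n)).

Lemma flips_point f n : (flips f (point n) != point n) = f n.
Proof.
have -> : flips f (point n) = (point n : Ht) * iota (f n).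
  by rewrite /= /coset_flip /flip /point ext_liftK cq_s qnK.
case: (f n); last by rewrite (ext0 ext) mulg1 eqxx.
apply/eqP; rewrite -{2}[point n : Ht]mulg1 => /mulgI E.
by have := ext_true ext; rewrite E eqxx.
Qed.

Lemma flips_inj : injective flips.
Proof. by move=> f g fg; apply/funext => n; rewrite -flips_point fg flips_point. Qed.

Lemma flips_extension : group_extension flips (image_of isom_baseM).
Proof.
split.
- exact: flips_morph.
- exact: flips_inj.
- by move=> f g; exact: image_ofM.
- exact: image_of_surj.
- by apply/seteqP; split=> f /=; [move/isom_base_kernel/image_ofP | move/image_ofP/isom_base_kernel].
Qed.

Lemma discrete_continuous (T1 : discreteTopologicalType) (T2 : topologicalType) (f : T1 -> T2) :
  continuous f.
Proof. by apply/continuousP => A _; exact: discrete_open. Qed.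

Lemma flips_continuous : continuous (flips : {ptws nat -> bool} -> isometry_group Y).
Proof.
apply: (@continuous_comp_initial (isometry_group Y) {ptws nat -> bool}
  {ptws Y -> discrete_topology Y} (fun g => isom_fun g : {ptws Y -> discrete_topology Y}) flips).
apply: ptws_continuous => x.
pose n := idx (cq K (p x)).
have : continuous ((fun a => (x : Ht) * iota a : discrete_topology Y) \o (fun f : {ptws nat -> bool} => f n)).
  move=> f; apply: continuous_comp; last exact: discrete_continuous.
  exact: (@proj_continuous nat (fun _ => bool) n).
exact.
Qed.

(** The sequence of a flip is read off continuously from the images of one point over each coset. *)
Lemma flips_embedding (U : set {ptws nat -> bool}) :
  open U <-> exists2 W, open W & flips @^-1` W = U.
Proof.
split=> [oU|[W oW <-]]; last first.
  by have /continuousP := flips_continuous; apply.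
pose ev (f : isometry_group Y) : {ptws nat -> bool} := fun n => f (point n) != point n.
have evc : continuous ev.
  apply: ptws_continuous => n.
  have : continuous ((fun y : discrete_topology Y => ((y : Y) != point n) : bool) \o
      (fun f : isometry_group Y => f (point n) : discrete_topology Y)).
    move=> f; apply: continuous_comp; first exact: eval_continuous.
    exact: (@discrete_continuous (discrete_topology Y)).
  exact.
exists (ev @^-1` U); first by move/continuousP: evc; apply.
have evK f : ev (flips f) = f by apply/funext => n; exact: flips_point.
by apply/seteqP; split=> f; rewrite /preimage /= evK.
Qed.

Lemma twist_isometry_group : isometry_group_discrete_by_Z2N Y.
Proof.
exists (image_group isom_baseM), flips, (image_of isom_baseM); split.
- exact: flips_extension.
- exact: flips_embedding.
- move=> U; rewrite openE => f Uf.
  (* Agreeing on lifts of the ball of radius 2 is an open condition and determines the class in the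
     quotient. *)
  apply: filterS (nbhs_agree f [seq lift h | h <- word_ball T 2]) => g gf /=.
  have -> : image_of isom_baseM g = image_of isom_baseM f.
    apply/image_ofP/funext; apply: (base_map_determined ct ct ct (isom_twist_iso g) (isom_twist_iso f)).
    by move=> h h2; rewrite /base_map gf// map_f.
  exact: Uf.
Qed.

End TwistIsometryGroup.

(** * Choice of the generators *)

Section FrameExistence.
Local Open Scope group_scope.

Lemma semidirect_coordinates (G Q H : groupType) (a : group_action Q G) (phi : H -> semidirect a) :
  group_isomorphism phi ->
  exists K : coset_coordinates G Q H, forall u, phi (cj K u) = Semidirect a u 1.
Proof.
move=> [[psi phiK psiK] phiM].
have sdM (x y : semidirect a) : x * y =
    Semidirect a (sd_normal x * a (sd_quotient x) (sd_normal y)) (sd_quotient x * sd_quotient y).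
  by [].
have psiM : {morph psi : x y / x * y}.
  by move=> x y; apply: (can_inj phiK); rewrite phiM !psiK.
have phi_inj := can_inj phiK.
pose cj u := psi (Semidirect a u 1); pose cs q := psi (Semidirect a 1 q).
(* In a semidirect product [(m, q) = (1, q) * (g, 1)] means [m = a q g]. *)
pose cq h := sd_quotient (phi h); pose cg h := a (cq h)^-1 (sd_normal (phi h)).
have cjM : {morph cj : x y / x * y}.
  move=> u v; rewrite -psiM; congr psi.
  by rewrite sdM /= gact_1 mulg1.
have cqM : {morph cq : x y / x * y} by move=> h k; rewrite /cq phiM.
have cq_j u : cq (cj u) = 1 by rewrite /cq psiK.
have cg_j h u : cg (h * cj u) = cg h * u.
  rewrite /cg cqM cq_j mulg1 phiM psiK /= gactM -gact_comp mulVg.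
  by rewrite gact_1.
have cq_s q : cq (cs q) = q by rewrite /cq psiK.
have cg_s q : cg (cs q) = 1 by rewrite /cg cq_s psiK /= gact1.
have cs1 : cs 1 = 1 by apply: phi_inj; rewrite psiK (morph_one phiM).
have cE h : h = cs (cq h) * cj (cg h).
  apply: phi_inj; rewrite phiM !psiK /cg /cq; case: (phi h) => n q.
  by rewrite sdM /= -gact_comp mulgV gact_1 mul1g mulg1.
exists (CosetCoordinates cjM cqM cq_j cg_j cq_s cg_s cs1 cE) => u.
exact: psiK.
Qed.

(** One element of each pair [u], [u^-1] is lifted and the other receives the inverse lift; [choose]
    depends only on the pair. If [u^-1 = u] the lift must be its own inverse, which is where the
    assumption on elements of order 2 enters. *)
Lemma inverse_equivariant_lift (G Ht : groupType) (P : G -> set Ht) :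
  (forall u, exists x, P u x) -> (forall u x, P u x -> P u^-1 x^-1) ->
  (forall u x, u^-1 = u -> P u x -> x^-1 = x) ->
  exists2 s : G -> Ht, (forall u, P u (s u)) & {morph s : u / u^-1}.
Proof.
move=> /choice[l lP] PV Psqr.
pose rep (u : G) := choose (pred2 u u^-1) u.
have repP u : rep u = u \/ rep u = u^-1.
  by have := @chooseP _ (pred2 u u^-1) u; rewrite /= eqxx => /(_ isT)/orP[]/eqP; [left|right].
have repV u : rep u^-1 = rep u.
  rewrite /rep (@eq_choose _ _ (pred2 u u^-1)); last by move=> v; rewrite /= invgK orbC.
  by apply: choose_id; rewrite /= eqxx ?orbT.
exists (fun u => if rep u == u then l u else (l u^-1)^-1).
  move=> u; case: ifP => // _; rewrite -{1}(invgK u); exact: PV.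
move=> u /=; rewrite repV invgK; have [uu|uu] := eqVneq u^-1 u.
  have -> : rep u = u by case: (repP u) => ->.
  by rewrite uu eqxx; apply/esym/(Psqr u).
by have [->|->] := repP u; rewrite ?eqxx ?(negbTE uu) ?[u == _]eq_sym ?(negbTE uu)// invgK.
Qed.

(** A generator [s] is replaced by [s * r] and [r], where [r] is a power of an element of infinite
    order. For a high power all of these avoid the finite set [bad]. *)
Lemma generators_avoiding (G H : groupType) (j : G -> H) (bad : seq H) :
  injective j -> {morph j : u v / u * v} -> symmetric_set bad -> finitely_generated G ->
  (exists g : G, infinite_order g) ->
  exists S : seq G, [/\ uniq S, symmetric_set S,
    (forall g, exists2 w, all (mem S) w & \prod_(s <- w) s = g) &
    forall s, s \in S -> j s \notin bad].
Proof.
move=> jI jM bad_sym [S0 gen0] [t t_inf].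
have near_ok (L : seq G) : \forall n \near \oo, all (fun s => j (s * t ^+ n) \notin bad) L.
  elim: L => [|s L IHL]; first by near=> n.
  have ok := @near_avoid _ (fun n => j (s * t ^+ n)) bad.
  have {}ok := ok (fun m n E => infinite_order_inj t_inf (mulgI s _ _ (jI _ _ E))).
  by near=> n; apply/andP; split; near: n.
have [n _ /(_ n (leqnn n)) /= /andP[]] := near_ok (1 :: S0).
set r := t ^+ n; rewrite mul1g => r_ok /allP S0_ok.
pose L := r :: [seq s * r | s <- S0].
pose S := undup (L ++ [seq s^-1 | s <- L]).
have mS s : (s \in S) = (s \in L) || (s^-1 \in L).
  rewrite mem_undup mem_cat; congr (_ || _).
  by apply/mapP/idP => [[s' s'L ->]|sL]; [rewrite invgK | exists s^-1; rewrite ?invgK].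
have S_sym : symmetric_set S by move=> s; rewrite !mS invgK orbC.
have rS : r \in S by rewrite mS inE eqxx.
have srS s : s \in S0 -> s * r \in S by move=> sS; rewrite mS inE (map_f (fun s => s * r) sS) ?orbT.
exists S; split=> //.
- exact: undup_uniq.
- move=> g; have [w wS <-] := gen0 g; elim: w wS => [|s w IHw] /=.
    by exists [::]; rewrite ?big_nil.
  move=> /andP[sS /IHw[v vS vE]]; rewrite big_cons -vE; case/orP: sS => sS.
    exists [:: s * r, r^-1 & v]; first by rewrite /= srS // S_sym.
    by rewrite !big_cons !mulgA mulgK.
  exists [:: r, (s^-1 * r)^-1 & v]; first by rewrite /= rS S_sym// srS.
  by rewrite !big_cons invgM invgK !mulgA mulgV mul1g.
- have L_ok s : s \in L -> j s \notin bad.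
    by rewrite inE => /predU1P[->//|/mapP[s' s'S ->]]; exact: S0_ok.
  move=> s; rewrite mS => /orP[/L_ok//|/L_ok]; apply: contra => /bad_sym.
  by rewrite -(morph_inv jM).
Unshelve. all: by end_near.
Qed.

Lemma frame_exists (G Q H Ht : groupType) (K : coset_coordinates G Q H)
    (iota : bool -> Ht) (p : Ht -> H) n (x : 'I_n -> H) :
  group_extension iota p -> finitely_generated G ->
  (exists g : G, infinite_order g) ->
  (forall u y, order2 u -> p y = cj K u -> order2 y) ->
  (forall h, exists w, eval_word x w = h) ->
  exists F : frame G Q H Ht, forall i, x i \in fT F.
Proof.
move=> ext genG infG lift2 x_gen.
have [s sp sV] : exists2 s : G -> Ht, (forall u, p (s u) = cj K u) & {morph s : u / u^-1}.
  apply: (inverse_equivariant_lift (P := fun u y => p y = cj K u)).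
  - by move=> u; exists (ext_lift ext (cj K u)); exact: ext_liftK.
  - by move=> u y yu; rewrite (extV ext) yu cjV.
  - move=> u y uV yu; have [u1|u1] := eqVneq u 1.
      have [b ->] : exists b, y = iota b by apply: (ext_ker ext); rewrite yu u1 cj1.
      by apply: (mulgI (iota b)); rewrite mulgV (ext_sqr ext).
    have [_ y2] : order2 y.
      by apply: lift2 yu; split; [exact/eqP | rewrite expgS expg1 -{1}uV mulVg].
    by apply: (mulgI y); rewrite mulgV -y2 expgS expg1.
pose T := 1 :: [seq eval_letter x l | l <- enum {: bool * 'I_n}].
have letter_T l : eval_letter x l \in T by rewrite inE map_f ?orbT// mem_enum.
have T1 : 1 \in T by rewrite inE eqxx.
have T_sym : symmetric_set T.
  move=> t; rewrite inE => /predU1P[->|/mapP[[b i] _ ->]]; first by rewrite invg1.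
  suff -> : (eval_letter x (b, i))^-1 = eval_letter x (~~ b, i) by exact: letter_T.
  by case: b; rewrite /eval_letter /= ?invgK.
have T_gen h : exists m, h \in word_ball T m.
  have [w <-] := x_gen h; exists (size [seq eval_letter x l | l <- w]).
  rewrite /eval_word -(big_map (eval_letter x) xpredT id).
  by apply: word_ball_prod; apply/allP => _ /mapP[l _ ->]; exact: letter_T.
pose C := undup [seq h <- word_ball T 5 | h != 1].
have CE h : (h \in C) = (h != 1) && (h \in word_ball T 5) by rewrite mem_undup mem_filter.
have C_sym : symmetric_set C.
  move=> h; rewrite !CE => /andP[h1 hT]; rewrite word_ball_sym// andbT.
  by rewrite -(inj_eq (can_inj (@invgK H))) invgK invg1.
(* Avoiding these yields the hypotheses of [separating_set] on the image of [S]. *)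
pose bad := 1 :: C ++ [seq h ^+ 2 | h <- C].
have bad_sym : symmetric_set bad.
  move=> h; rewrite !inE !mem_cat => /predU1P[->|]; first by rewrite invg1 eqxx.
  case/orP => [/C_sym->|/mapP[k /C_sym kC ->]]; first by rewrite orbT.
  by rewrite -expVgn (map_f (fun h => h ^+ 2) kC) ?orbT.
have [S [S_uniq S_sym S_gen S_bad]] :=
  generators_avoiding (@cj_inj _ _ _ K) (cjM K) bad_sym genG infG.
have S1 : 1 \notin S by apply/negP => /S_bad; rewrite cj1 inE eqxx.
have [t t_inf] := infG.
have jt_inf : infinite_order (cj K t).
  move=> m m0; have <- : cj K (t ^+ m) = cj K t ^+ m.
    by elim: m {m0} => [|m IHm]; rewrite ?cj1// !expgS cjM IHm.
  by rewrite -(cj1 K) => /cj_inj; exact: t_inf.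
have [B [[B_uniq B_sym B1 CB SB] sep]] :
  exists B : seq H, [/\ uniq B, symmetric_set B, 1 \notin B, {subset C <= B} &
      forall s, s \in map (cj K) S -> s \notin B] /\
    forall c c', c \in C \/ c = 1 -> [\/ c' \in B, c' \in map (cj K) S | c' = 1] ->
      (triangles B c <= triangles B c' + (size S).+1)%N ->
      (triangles B c' <= triangles B c + (size S).+1)%N -> c' = c \/ c' = c^-1.
  apply: (separating_set jt_inf) => //.
  - exact: undup_uniq.
  - by rewrite CE eqxx.
  - by apply/negP => /mapP[u uS E]; have := S_bad _ uS; rewrite -E inE eqxx.
  - move=> _ /mapP[u uS ->]; apply/negP => uC.
    by have := S_bad _ uS; rewrite inE mem_cat uC orbT.
  - move=> _ c /mapP[u uS ->] cC E.
    by have := S_bad _ uS; rewrite inE mem_cat E (map_f (fun h => h ^+ 2) cC) ?orbT.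
have TB c : c \in word_ball T 5 -> c <> 1 -> c \in B.
  by move=> cT /eqP c1; apply: CB; rewrite CE c1.
have SB' u : u \in S -> cj K u \notin B by move=> uS; apply: SB; rewrite map_f.
have sep' c b : c \in word_ball T 5 -> [\/ b \in B, b \in map (cj K) S | b = 1] ->
    (triangles B c <= triangles B b + (size S).+1)%N ->
    (triangles B b <= triangles B c + (size S).+1)%N -> b = c \/ b = c^-1.
  by move=> cT; apply: sep; rewrite CE cT andbT; case: eqVneq => [->|_]; [right|left].
exists (Frame ext S_uniq S_sym S1 S_gen sp sV T1 T_sym T_gen B_uniq B_sym B1 TB SB' sep').
by move=> i; exact: (letter_T (false, i)).
Qed.

End FrameExistence.

(** * Families of pairwise non-isometric graphs *)

Section Isometric.
Variables X Y Z : graph.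

Lemma isometric_sym : isometric X Y -> isometric Y X.
Proof.
move=> [f [[g fK gK] fd]]; exists g; split; first by exists f.
by move=> x y; rewrite -fd !gK.
Qed.

Lemma isometric_trans : isometric X Y -> isometric Y Z -> isometric X Z.
Proof.
move=> [f [fb fd]] [g [gb gd]]; exists (g \o f); split; first exact: bij_comp.
by move=> x y /=; rewrite gd fd.
Qed.

End Isometric.

(* By diagonalization, for some n every binary sequence is the n-th row of the
   table coded by some f whose code in its class is n. *)
Lemma continuum_transversal (R : realType) (E : (nat -> bool) -> (nat -> bool) -> Prop) :
  (forall f, E f f) -> (forall f g, E f g -> E g f) ->
  (forall f g h, E f g -> E g h -> E f h) ->
  (forall f, exists code : (nat -> bool) -> nat,
     forall g h, E f g -> E f h -> code g = code h -> g = h) ->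
  exists s : R -> nat -> bool, forall x y, E (s x) (s y) -> x = y.
Proof.
move=> Erefl Esym Etrans /choice[code codeP].
pose rep f : nat -> bool := xget (fun=> false) [set g | E f g].
have repP f : E f (rep f) by apply: (@xgetPex _ _ [set g | E f g]); exists f.
have rep_eq f g : E f g -> rep f = rep g.
  move=> fg; congr xget; apply/seteqP; split=> h /=; apply: Etrans => //.
  exact: Esym.
pose row (f : nat -> bool) (n m : nat) := f (pickle (n, m)).
have [n /choice[s sP]] : exists n, forall y : nat -> bool, exists f, code (rep f) f = n /\ row f n = y.
  apply: contrapT => no.
  have /choice[y yP] n : exists y, forall f, code (rep f) f = n -> row f n <> y.
    apply: contrapT => noy; apply: no; exists n => y; apply: contrapT => nof.
    by apply: noy; exists y => f fn fy; apply: nof; exists f.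
  pose f k := if unpickle k is Some (n, m) then y n m else false.
  apply: (yP (code (rep f) f) f) => //; apply/funext => m.
  by rewrite /row /f pickleK.
have sE y y' : E (s y) (s y') -> y = y'.
  move=> yy'; have [[sy <-] [sy' <-]] := (sP y, sP y'); rewrite (_ : s y = s y')//.
  apply: (codeP (rep (s y))); first exact: Esym.
    by rewrite (rep_eq _ _ yy'); exact: Esym.
  by rewrite sy {1}(rep_eq _ _ yy') sy'.
(* Dedekind cuts embed the reals into the binary sequences. *)
pose cut (x : R) k := if unpickle k is Some q then ratr (q : rat) < x else false.
exists (fun x => s (cut x)) => x y /sE cxy; apply/eqP.
have noq (q : rat) : (ratr q < x) = (ratr q < y).
  by move/(congr1 (fun c => c (pickle q))): cxy; rewrite /cut pickleK.
rewrite eq_le !leNgt; apply/andP; split; apply/negP => /rat_in_itvoo[q];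
  by rewrite in_itv /= => /andP[q1 q2]; move: (noq q); rewrite ?q1 ?q2; rewrite ltNge ltW.
Qed.

Section Family.
Local Open Scope group_scope.
Variables (G Q H Ht : groupType) (F : frame G Q H Ht).
Local Notation K := (fK F).
Local Notation S := (fS F).
Local Notation B := (fB F).
Local Notation T := (fT F).
Local Notation p := (fp F).
Local Notation ext := (f_ext F).
Local Notation X := (cayley (@cayley_gens_sym _ _ _ _ F) (@cayley_gens_generate _ _ _ _ F)).
Implicit Types (x y : Ht) (h : H) (u v : G) (c : G -> G -> bool).

(** The composite of [f2] with the inverse of [f1] lies over the identity, hence flips fibres by
    some [e]. On [G] this [e], normalized at 1, has a coboundary that agrees with the sum of [c1]
    and [c2] whenever the second argument is in [S], hence everywhere. *)
Lemma iso_coboundary c c1 c2 f1 f2 : tame F c -> tame F c1 -> tame F c2 ->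
  twist_iso F c c1 f1 -> twist_iso F c c2 f2 ->
  {in word_ball T 2, base_map F f1 =1 base_map F f2} ->
  coboundary2 (fun u v => c1 u v (+) c2 u v).
Proof.
move=> ct ct1 ct2 iso1 iso2 /(base_map_determined ct ct1 ct2 iso1 iso2) base12.
have [[g1 f1K g1K] _] := iso1; have iso_g := twist_iso_inv iso1 f1K g1K.
have iso := twist_iso_comp iso_g iso2.
have [|e [_ eS]] := iso_over_id ct1 ct2 iso.
  move=> x /=; rewrite -(base_mapE _ ct ct2 iso2) -base12.
  by rewrite (base_mapE _ ct ct1 iso1) g1K.
have [cP1 c11 _] := ct1; have [cP2 c21 _] := ct2.
pose b v := e (cj K v) (+) e 1.
have bS v u : u \in S -> c2 v u = c1 v u (+) b v (+) b (v * u).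
  move=> uS; have := eS (cj K v) u uS; rewrite -cjM cg_cj => ->.
  by rewrite /b; xor_cases.
have b0 u : u \in S -> b u = false.
  move=> uS; have := bS 1 u uS; rewrite (cocycle_1x cP1 c11) (cocycle_1x cP2 c21) mul1g /b cj1 addbb.
  by rewrite !addFb => <-.
pose d u v := c1 u v (+) c2 u v (+) (b u (+) b v (+) b (u * v)).
have dP : cocycle2 d.
  apply: cocycle_add; first exact: cocycle_add.
  by apply: coboundary_cocycle; apply/coboundaryP; exists b.
have d11 : d 1 1 = false by rewrite /d c11 c21 mulg1 /b cj1 !addbb.
have dS v u : u \in S -> d v u = false.
  by move=> uS; rewrite /d (bS _ _ uS) (b0 _ uS); xor_cases.
have d0 := cocycle_vanish (fS_gen F) dP d11 dS.
apply/coboundaryP; exists b => u v; move: (d0 u v); rewrite /d.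
by case: (_ (+) c2 u v); case: (_ (+) _ (+) _).
Qed.

Lemma deep_family M : infinite_set (H2 G bool) ->
  exists cc : (nat -> bool) -> G -> G -> bool,
    [/\ (forall f, tame F (cc f)), (forall f, deep F M (cc f)) &
        forall f f', coboundary2 (fun u v => cc f u v (+) cc f' u v) -> f = f'].
Proof.
move=> H2inf; pose S1 := 1 :: S.
have S1_gen g : exists2 w, all (mem S1) w & \prod_(s <- w) s = g.
  have [w wS <-] := fS_gen F g; exists w => //.
  by apply: sub_all wS => u; rewrite /= inE => ->; rewrite orbT.
have [W WE] := proj1 (finite_seqP _) (@ball_finite X 1%g M.+1).
have WP x : (@gdist X 1%g x <= M.+1)%N -> x \in W.
  by move=> xM; have /seteqP[h _] := WE; exact: (h x xM).
have [cc [ccP cc1 ccF cc_inj]] := cocycle_family H2inf S1_gen (mem_head _ _) [seq cg K (p x) | x <- W].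
have near f x u : (@gdist X 1%g x <= M.+1)%N -> u \in S -> cc f (cg K (p x)) u = false.
  by move=> /WP xW uS; apply: ccF; [exact: (map_f (fun x => cg K (p x)) xW) | rewrite inE uS orbT].
exists cc; split=> // [f|f x u xM uS]; last by apply: near => //; exact: leqW.
split=> // x u xn uS; apply: near => //.
by apply: leq_trans (@gdist_adj X 1%g x _) _; rewrite ?cayley_adjE.
Qed.

Lemma deep_mono M N c : (N <= M)%N -> deep F M c -> deep F N c.
Proof. by move=> NM cM x u xN; apply: cM; exact: leq_trans NM. Qed.

Variables (n : nat) (g : 'I_n -> H) (rels : seq (word n)).
Hypothesis gT : forall i, g i \in T.
Hypothesis g_gen : forall h, exists v : word n, eval_word g v = h.
Hypothesis g_rels : forall w1 w2, eval_word g w1 = eval_word g w2 <-> presented_eq rels w1 w2.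

Lemma twist_null_homotopic : exists k, forall c x s,
  path (lazy (twist_adj F c)) x s -> last x s = x ->
  homotopic (twist_adj F c) k (x :: s) [:: x].
Proof.
have [wd wdP] := choice g_gen; pose L := 1 :: B ++ map (cj K) S.
(* The summand 4 provides for the squares of the ladders, for the 2 extra steps of an edge, and for
   strictness on relators. *)
pose k := (\max_(r <- rels) size r + \max_(b <- L) size (wd b) + 4)%N.
exists k => c x s; apply: (twist_simply_connected gT g_rels).
- exact: leq_addl.
- move=> r rR; rewrite /k -addnA (leq_ltn_trans (@leq_bigmax_seq _ _ xpredT size _ rR _))//.
  by rewrite -[X in (X < _)%N]addn0 ltn_add2l addn4.
- move=> b bL; exists (wd b) => //.
  have {}bL : b \in L.
    by rewrite inE mem_cat; case: bL => [->|->|->]; rewrite ?eqxx ?orbT.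
  have := @leq_bigmax_seq _ L xpredT (fun b => size (wd b)) b bL isT.
  move=> le; rewrite /k; apply: leq_add => //; exact: leq_trans (leq_addl _ _).
Qed.

Lemma H_pickle : exists f : H -> nat, injective f.
Proof.
have [wd wdP] := choice g_gen; exists (fun h => pickle (wd h)).
by move=> h h' /(pcan_inj pickleK) E; rewrite -(wdP h) -(wdP h') E.
Qed.

(** An isometry from the fixed graph is coded by the values of its base map on a finite ball. By
    [iso_coboundary] they determine the target within the family. *)
Lemma isometric_classes c (ct : tame F c) (cc : (nat -> bool) -> G -> G -> bool)
    (cct : forall f, tame F (cc f)) :
  (forall f f', coboundary2 (fun u v => cc f u v (+) cc f' u v) -> f = f') ->
  exists code : (nat -> bool) -> nat, forall f f',
    isometric (twist_graph ct) (twist_graph (cct f)) ->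
    isometric (twist_graph ct) (twist_graph (cct f')) ->
    code f = code f' -> f = f'.
Proof.
move=> cc_inj; have [pk pk_inj] := H_pickle.
have /choice[iso isoP] f : exists phi : Ht -> Ht,
    isometric (twist_graph ct) (twist_graph (cct f)) -> twist_iso F c (cc f) phi.
  have [[phi phiP]|no] := pselect (isometric (twist_graph ct) (twist_graph (cct f))).
    by exists phi => _; exact: isometry_twist_iso phiP.
  by exists id.
exists (fun f => pickle [seq pk (base_map F (iso f) h) | h <- word_ball T 2]).
move=> f f' /isoP if1 /isoP if2 /(pcan_inj pickleK)/eq_in_map E.
apply: cc_inj; apply: (iso_coboundary ct _ _ if1 if2) => // h h2.
by apply: pk_inj; exact: E.
Qed.

Lemma quotient_bijection : finitely_presented H -> infinite_set (H2 G bool) ->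
  exists idx : Q -> nat, bijective idx.
Proof.
move=> fpH H2inf; have [pk pk_inj] := H_pickle.
have Qc : countable [set: Q].
  apply/countable_injP; exists (fun q => pk (cs K q)) => q q' _ _ /pk_inj E.
  by rewrite -(cq_s K q) E cq_s.
have /card_set_bijP[idx idx_bij] := eq_card_nat Qc (quotient_infinite K fpH H2inf).
by exists idx; rewrite -setTT_bijective.
Qed.

Lemma graph_family (R : realType) (r : R) : finitely_presented H -> infinite_set (H2 G bool) ->
  exists Y : R -> graph,
    [/\ forall i, large_scale_simply_connected R (Y i),
        forall i, vertex_transitive (Y i),
        forall i j, i <> j -> ~ isometric (Y i) (Y j),
        forall i (f : X -> Y i), covering f -> Defs.isometry f &
        forall i, [/\ locally_like r X (Y i), bilipschitz_equivalent 4 (Y i) X &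
                      isometry_group_discrete_by_Z2N (Y i)]].
Proof.
move=> fpH H2inf; have [k null] := twist_null_homotopic.
have [idx [qn idxK qnK]] := quotient_bijection fpH H2inf.
have [M0 rM0] : exists M0 : nat, (r + 2 <= M0%:R)%R.
  exists (Num.Def.archi_bound `|r + 2|)%R.
  by apply: ltW; apply: le_lt_trans (ler_norm _) _; exact: archi_boundP.
(* [M0] ensures agreement on balls of radius [r], and [k] the injectivity of coverings on balls of
   radius [k]. *)
pose M := maxn M0 k.
have rM : (r + 2 <= M%:R)%R by rewrite (le_trans rM0)// ler_nat leq_maxl.
have [cc [cct ccM cc_inj]] := deep_family M H2inf.
pose Y f := twist_graph (cct f).
have [s sP] : exists s : R -> nat -> bool, forall i j, isometric (Y (s i)) (Y (s j)) -> i = j.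
  apply: (@continuum_transversal R (fun f f' => isometric (Y f) (Y f'))).
  - by move=> f; exists id; split=> //; exists id.
  - by move=> f f'; exact: isometric_sym.
  - by move=> f f' f''; exact: isometric_trans.
  - by move=> f; exact: isometric_classes.
exists (fun i => Y (s i)); split=> [i|i|i j ij|i f|i].
- by exists k; apply: polygonal_simply_connected => x t; exact: null.
- exact: twist_transitive.
- by move/sP.
- apply: (covering_twist_isometry (k := k)); last by move=> x t; exact: null.
  exact: deep_mono (leq_maxr _ _) (ccM _).
- split; first exact: twist_locally_like (ccM _) rM.
  + exact: twist_bilipschitz.
  + exact: twist_isometry_group idxK qnK.
Qed.

End Family.

Theorem theorem8 (R : realType) (H Ht : groupType)
    (iota : bool -> Ht) (p : Ht -> H)
    (G Q : groupType) (a : group_action Q G) (phi : H -> semidirect a) :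
  finitely_presented H ->
  group_extension iota p ->
  group_isomorphism phi ->
  finitely_generated G ->
  infinite_set (H2 G bool) ->
  (exists g : G, infinite_order g) ->
  (forall (g : G) (h : Ht),
     order2 g -> phi (p h) = Semidirect a g 1%g -> order2 h) ->
  exists (S : seq Ht) (symS : symmetric_set S) (genS : generates S),
    let X := cayley symS genS in
    ~ LG_rigid_transitive R X /\
    forall r : R, 1 <= r ->
      exists (I : Type) (Y : I -> graph),
        [/\ [set: I] #= [set: R],
            (forall i, large_scale_simply_connected R (Y i)),
            (forall i, vertex_transitive (Y i)),
            (forall i j, i <> j -> ~ isometric (Y i) (Y j)) &
            forall i,
              [/\ locally_like r X (Y i),
                  bilipschitz_equivalent 4 (Y i) X &
                  isometry_group_discrete_by_Z2N (Y i)]].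
Proof.
move=> fpH ext phiP genG H2inf infG lift2; have [n [x [rels [x_gen x_rels]]]] := fpH.
have [K phi_cj] := semidirect_coordinates phiP.
have [F xT] : exists F : frame G Q H Ht, forall i, x i \in fT F.
  apply: (@frame_exists _ _ _ _ K _ _ _ _ ext genG infG) x_gen => u y u2 yu.
  by apply: (lift2 u) => //; rewrite yu phi_cj.
have family (r : R) := graph_family xT x_gen x_rels r fpH H2inf.
exists (cayley_gens F), (@cayley_gens_sym _ _ _ _ F), (@cayley_gens_generate _ _ _ _ F).
split=> [[r r0 rigid]|r r1]; last first.
  have [Y [lsc vt ni _ loc]] := family r; exists R, Y; split=> //; exact: card_eqxx.
(* Rigidity would make the Cayley graph cover, hence be isometric to, every member of the family. *)
have [Y [_ vt ni cov loc]] := family r.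
have iso i : isometric (cayley (@cayley_gens_sym _ _ _ _ F) (@cayley_gens_generate _ _ _ _ F)) (Y i).
  by have [ll _ _] := loc i; have [f fcov] := rigid _ (vt i) ll; exists f; exact: cov.
apply: (ni 0 1); first by apply/eqP; rewrite eq_sym oner_eq0.
exact: isometric_trans (isometric_sym (iso 0)) (iso 1).
Qed.
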